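(* Let $\epsilon\in\{1,2\}$. For every $w\in\widehat W^{\widehat\Lambda_0}$, $$\widehat{\mathcal{M}}^\epsilon_w=\widehat{\mathcal{M}}^\epsilon\cap\mathcal{M}_w,\qquad \widehat\kappa(\widehat{\mathcal{M}}^\epsilon_w)=\bigsqcup_{\substack{\nu\ \text{a partition},\ \ell(\nu)\le d(w)\\ \epsilon\mid\nu}}SST_{\mathbf{B}_{>0}}(\nu^\pi)_{\phi(w)}.$$
   Context: **Weights.** $\mathbb{Z}^\times=\mathbb{Z}\setminus\{0\}$; $\mathfrak{h}=\bigoplus_{i\in\mathbb{Z}^\times}\mathbb{C}E_{ii}$ is the Cartan subalgebra of $\mathfrak{gl}_\infty$ (complex $\mathbb{Z}^\times\times\mathbb{Z}^\times$ matrices of finite support), $\langle\epsilon_i,E_{jj}\rangle=\delta_{ij}$ (the $\epsilon_i$ are not to be confused with the number $\epsilon$); $h_0=E_{-1,-1}-E_{11}$, $h_i=E_{ii}-E_{i+1,i+1}$, $h_{-i}=E_{-i-1,-i-1}-E_{-i,-i}$ and $\alpha_0=\epsilon_{-1}-\epsilon_1$, $\alpha_i=\epsilon_i-\epsilon_{i+1}$, $\alpha_{-i}=\epsilon_{-i-1}-\epsilon_{-i}$ ($i\ge1$). $\Lambda_0\in\mathfrak{h}^*$: $\langle\Lambda_0,E_{-i,-i}\rangle=-\langle\Lambda_0,E_{ii}\rangle=\frac12$ ($i\ge1$). $P=\bigoplus_i\mathbb{Z}\epsilon_i\oplus\mathbb{Z}\Lambda_0$; $\widehat\Lambda_0=\epsilon\Lambda_0$.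 **Words.** On the letters $\mathbf{B}_{>0}=\{1<2<3<\cdots\}$ let $\widetilde f_i(i)=i+1$, $\widetilde e_i(i+1)=i$ ($i>0$), all other values being the formal symbol $\mathbf 0$; on the letters $\mathbf{B}^\vee_{<0}=\{-1^\vee<-2^\vee<\cdots\}$ let $\widetilde f_{-i}(-i^\vee)=-(i+1)^\vee$, $\widetilde e_{-i}(-(i+1)^\vee)=-i^\vee$ ($i>0$), all other values being $\mathbf 0$. For a letter or word $b$, $\varepsilon_i(b)=\max\{k:\widetilde e_i^kb\ne\mathbf 0\}$, $\varphi_i(b)=\max\{k:\widetilde f_i^kb\neq\mathbf 0\}$. Words are tensors $w_1\otimes\cdots\otimes w_r$, with the rule: $\widetilde f_i(b_1\otimes b_2)=\widetilde f_ib_1\otimes b_2$ if $\varphi_i(b_1)>\varepsilon_i(b_2)$ and $b_1\otimes\widetilde f_ib_2$ otherwise; $\widetilde e_i(b_1\otimes b_2)=\widetilde e_ib_1\otimes b_2$ if $\varphi_i(b_1)\ge\varepsilon_i(b_2)$ and $b_1\otimes\widetilde e_ib_2$ otherwise ($\mathbf 0\otimes b=b\otimes\mathbf 0=\mathbf 0$; the empty word is sent to $\mathbf 0$). **$\mathcal{M}$ and $\widehat{\mathcal{M}}^\epsilon$.** $\mathcal{M}$ is the set of matrices $A=(a_{-i^\vee,j})_{i,j\ge1}$ with entries in $\mathbb{Z}_{\ge0}$ and finite support; $\mathbb{O}$ is the zero matrix. To $A$ associate two-row words $(\mathbf i,\mathbf j)$ and $(\mathbf k,\mathbf l)$, each containing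 $(-i^\vee,j)$ exactly $a_{-i^\vee,j}$ times: in $(\mathbf i,\mathbf j)$ the pairs are sorted so that $j_1\le j_2\le\cdots$ and $i_m\ge i_{m+1}$ whenever $j_m=j_{m+1}$; in $(\mathbf k,\mathbf l)$ so that $k_1\le k_2\le\cdots$ and $l_m\ge l_{m+1}$ whenever $k_m=k_{m+1}$. For $i<0$, $\widetilde e_i,\widetilde f_i$ act on $A$ through $\mathbf i$ ($\mathbf j$ fixed); for $i>0$ through $\mathbf l$ ($\mathbf k$ fixed); $\widetilde f_0A=A+E_{-1^\vee,1}$, and $\widetilde e_0A=A-E_{-1^\vee,1}$ if $a_{-1^\vee,1}\neq0$, else $\mathbf 0$. $\widehat{\mathcal{M}}^\epsilon=\{A\in\mathcal{M}\mid a_{-i^\vee,j}=a_{-j^\vee,i}\text{ for all }i,j\ge1,\ \epsilon\text{ divides }a_{-i^\vee,i}\text{ for all }i\ge1\}$. Put $\widetilde F_0=\widetilde f_0^{\,\epsilon}$ and $\widetilde F_i=\widetilde f_i\widetilde f_{-i}$ ($i>0$). **Tableaux and $\widehat\kappa$.** $\nu^\pi$ is the $180^\circ$-rotation of the Young diagram of $\nu$ (rows right-justified, $i$-th row from the bottom of length $\nu_i$, columns bottom-aligned). $SST_{\mathbf{B}_{>0}}(\nu^\pi)$ is the set of semistandard tableaux of shape $\nu^\pi$ with entries in $\mathbf{B}_{>0}$ (rows weakly increasing left to right, columns strictly increasing top to bottom). $T\leftarrow a$: let $a'$ be the largest entry $\le a$ in the rightmost column and replace $a'$ by $a$; if there is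 no such $a'$, put $a$ on top of that column and stop; otherwise repeat with $a'$ in the next column to the left. $\mathbf P(w_1\cdots w_r)=(\cdots((w_1\leftarrow w_2)\leftarrow w_3)\cdots)\leftarrow w_r$. For $A\in\widehat{\mathcal{M}}^\epsilon$, $\widehat\kappa(A)=\mathbf P(\mathbf l_{\rm rev})$ (rev = reversed word); $\widehat\kappa$ is a bijection from $\widehat{\mathcal{M}}^\epsilon$ to $\bigsqcup_{\epsilon\mid\nu}SST_{\mathbf{B}_{>0}}(\nu^\pi)$, where $\epsilon\mid\nu$ means $\epsilon\mid\nu_i$ for all $i$. **Weyl groups and Demazure crystals.** $W$ is generated by $s_i(\mu)=\mu-\langle\mu,h_i\rangle\alpha_i$ ($i\in\mathbb{Z}$); $s_i$ acts on $\mathbb{Z}^\times$ as $(i\;i{+}1)$ for $i>0$, $(i{-}1\;i)$ for $i<0$, $(-1\;1)$ for $i=0$. $W^{\Lambda_0}=\{w\in W\mid\ell(ws_i)>\ell(w)\ \forall i\ne0\}$. For $w=s_{i_1}\cdots s_{i_r}\in W^{\Lambda_0}$ reduced, $\mathcal{M}_w=\{\widetilde f_{i_1}^{m_1}\cdots\widetilde f_{i_r}^{m_r}\mathbb{O}\mid m_k\ge0\}\setminus\{\mathbf 0\}$. $\sigma$ is the linear automorphism of $P$ with $\sigma(\Lambda_0)=\Lambda_0$, $\sigma(\epsilon_i)=-\epsilon_{-i}$; $\widehat W=\{w\in W\mid w\sigma=\sigma w\}$ is a Coxeter group with generators $\widehat s_0=s_0$, $\widehat s_i=s_is_{-i}$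 ($i>0$); $\widehat W^{\widehat\Lambda_0}$ is the set of minimal length left coset representatives of the stabilizer of $\widehat\Lambda_0$ in $\widehat{W}$, and equals $\widehat W\cap W^{\Lambda_0}$. For $w\in\widehat W^{\widehat\Lambda_0}$ with reduced expression $w=\widehat s_{i_1}\cdots\widehat s_{i_r}$ in $\widehat W$, $\widehat{\mathcal{M}}^\epsilon_w=\{\widetilde F_{i_1}^{m_1}\cdots\widetilde F_{i_r}^{m_r}\mathbb{O}\mid m_k\ge0\}\setminus\{\mathbf 0\}$. (These sets do not depend on the reduced expression.) **Flags.** For $w\in W^{\Lambda_0}$, $\lambda(w)$ is the partition with $\lambda(w)_i=|\{j\in\mathbb{Z}^\times\mid-i<w^{-1}(j),\ j<w(-i)\}|$. Let $d(w)=d$ be the diagonal length of $\lambda=\lambda(w)$, $\alpha_i=\lambda'_i-i+1$ ($1\le i\le d$), and $\phi(w)=(\alpha_d,\dots,\alpha_1)$. For $\phi=(\phi_1\le\cdots\le\phi_d)$ and $\ell(\nu)\le d$ ($\ell(\nu)$ = number of nonzero parts), $SST_{\mathbf{B}_{>0}}(\nu^\pi)_\phi$ is the set of $T\in SST_{\mathbf{B}_{>0}}(\nu^\pi)$ whose entries in the $i$-th row from the bottom are $\le\phi_{d-i+1}$, $1\le i\le d$. *)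

(* Defs.v *)
From mathcomp Require Import all_boot all_order all_algebra.
From mathcomp Require Import finmap multiset.
From mathcomp Require Import boolp classical_sets functions cardinality.

Set Implicit Arguments.
Unset Strict Implicit.
Unset Printing Implicit Defensive.

Import Order.TTheory GRing.Theory Num.Theory.

Local Open Scope classical_set_scope.
Local Open Scope nat_scope.

(* Meaningful for finite A only: [fset_set A] is empty when A is infinite. *)
Definition card (T : choiceType) (A : set T) : nat := #|` fset_set A|.

Local Open Scope ring_scope.

(* A weight mu is given by its values mu j = <mu, E_jj>, j in Z \ {0}; the     *)
(* value at the index 0 carries no information and is 0 on the lattice P.      *)
(* Rational values suffice, since weights in P take values in (1/2)Z.          *)
Definition weight := int -> rat.

Definition eps (i : int) : weight := fun j => (i == j)%:R.

Definition Lambda0 : weight :=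
  fun j => if j < 0 then 1 / 2 else if 0 < j then - (1 / 2) else 0.

Definition P : set weight :=
  [set mu | exists (s : seq int) (n : int -> int) (m : int),
      0 \notin s /\
      mu = fun j => (\sum_(i <- s) (n i)%:~R * eps i j) + m%:~R * Lambda0 j].

(* h_i = E_pp - E_qq and alpha_i = eps_p - eps_q, where (p, q) is (i, i+1) for *)
(* i > 0, (i-1, i) for i < 0 and (-1, 1) for i = 0.                            *)
Definition node_p (i : int) : int := if 0 < i then i else i - 1.
Definition node_q (i : int) : int := if i < 0 then i else i + 1.

Definition pair_h (mu : weight) (i : int) : rat := mu (node_p i) - mu (node_q i).

Definition alpha (i : int) : weight := fun j => eps (node_p i) j - eps (node_q i) j.

Definition s (i : int) (mu : weight) : weight :=
  fun j => mu j - pair_h mu i * alpha i j.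

Definition shat (i : nat) : weight -> weight :=
  if i == 0%N then s 0 else s i%:Z \o s (- i%:Z).

(* sigma(Lambda_0) = Lambda_0 and sigma(eps_i) = - eps_{-i}, in coordinates.   *)
Definition sigma (mu : weight) : weight := fun j => - mu (- j).

(* Elements of W and \hat W are operators on P: maps [weight -> weight] that   *)
(* agree on P are identified.                                                  *)
Definition expresses (I : Type) (g : I -> weight -> weight) (a : seq I)
    (w : weight -> weight) : Prop :=
  forall mu, P mu -> foldr g mu a = w mu.

Definition is_length (I : Type) (g : I -> weight -> weight)
    (w : weight -> weight) : set nat :=
  [set n | (exists2 a, expresses g a w & size a = n) /\
           forall a, expresses g a w -> (n <= size a)%N].

Definition len (I : Type) (g : I -> weight -> weight)
    (w : weight -> weight) : nat := xget 0%N (is_length g w).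

Definition reduced (I : Type) (g : I -> weight -> weight) (a : seq I)
    (w : weight -> weight) : Prop :=
  expresses g a w /\ size a = len g w.

(* The s_i are involutions, so W consists of the products of the s_i. *)
Definition W : set (weight -> weight) := [set w | exists a, expresses s a w].

Definition What : set (weight -> weight) :=
  W `&` [set w | forall mu, P mu -> w (sigma mu) = sigma (w mu)].

Definition hatLambda0 (e : nat) : weight := fun j => e%:R * Lambda0 j.

(* Minimal length representatives of the left cosets of the stabilizer of      *)
(* \hat\Lambda_0 in \hat W; length is with respect to the generators shat.     *)
Definition What_min (e : nat) : set (weight -> weight) :=
  What `&` [set w | forall u, What u -> u (hatLambda0 e) = hatLambda0 e ->
                      (len shat w <= len shat (w \o u))%N].

(* Action of w and of its inverse on Z \ {0}: w eps_j = eps_{w(j)}. *)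
Definition zact (w : weight -> weight) (j : int) : int :=
  xget 0 [set k | k != 0 /\ w (eps j) = eps k].

Definition zact_inv (w : weight -> weight) (j : int) : int :=
  xget 0 [set k | k != 0 /\ w (eps k) = eps j].

(* Partitions lambda(w) are functions on the row indices i >= 1. *)
Definition lam (w : weight -> weight) (i : nat) : nat :=
  card [set j : int | [/\ j != 0, - i%:Z < zact_inv w j & j < zact w (- i%:Z)]].

Local Close Scope ring_scope.

Definition conj_part (l : nat -> nat) (i : nat) : nat :=
  card [set k | 0 < k /\ i <= l k].

Definition diag_length (l : nat -> nat) : nat := card [set i | 0 < i /\ i <= l i].

Definition d (w : weight -> weight) : nat := diag_length (lam w).

(* The subtraction is exact: lambda'_i >= i for 1 <= i <= d. *)
Definition phi (w : weight -> weight) : seq nat :=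
  rev [seq conj_part (lam w) i - i + 1 | i <- iota 1 (d w)].

(* [None] is the formal symbol 0.  Letters of B_{>0} and of B^\vee_{<0} are    *)
(* both encoded by positive integers, -i^\vee by i.  This preserves the orders *)
(* and carries e_{-i}, f_{-i} on B^\vee_{<0} to e_i, f_i on B_{>0}, so that    *)
(* one definition, for i > 0, serves both alphabets.                           *)
Definition letter_f (i a : nat) : option nat := if a == i then Some i.+1 else None.
Definition letter_e (i a : nat) : option nat := if a == i.+1 then Some i else None.

(* max {k | g^k b <> 0}, where n must bound this maximum. *)
Definition max_iter (T : Type) (g : T -> option T) (n : nat) (b : T) : nat :=
  \max_(k < n.+1 | iter k (obind g) (Some b)) k.

(* On a word of size n the operators e_i and f_i can be iterated at most n     *)
(* times, as each application turns one letter i+1 into i or conversely.       *)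
Definition letter_phi (i a : nat) : nat := max_iter (letter_f i) 1 a.

(* The tensor product rule for b_1 a letter and b_2 the rest of the word; the  *)
(* rule is associative, and the empty word is a unit.  [n] is the size of w.   *)
Fixpoint word_e_rec (i n : nat) (w : seq nat) : option (seq nat) :=
  if (n, w) is (n'.+1, a :: w') then
    if max_iter (word_e_rec i n') n' w' <= letter_phi i a
    then omap (cons^~ w') (letter_e i a)
    else omap (cons a) (word_e_rec i n' w')
  else None.

Definition word_e (i : nat) (w : seq nat) : option (seq nat) :=
  word_e_rec i (size w) w.

Definition word_eps (i : nat) (w : seq nat) : nat :=
  max_iter (word_e i) (size w) w.

Fixpoint word_f (i : nat) (w : seq nat) : option (seq nat) :=
  if w is a :: w' then
    if word_eps i w' < letter_phi i a
    then omap (cons^~ w') (letter_f i a)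
    else omap (cons a) (word_f i w')
  else None.

(* A finitely supported matrix (a_{-i^\vee, j}) is a finite multiset of pairs  *)
(* (i, j), with multiplicities A (i, j) = a_{-i^\vee, j}.                      *)
Notation mat := {mset nat * nat}%mset.

Definition M : set mat :=
  [set A | forall i j, A (i, j) != 0 -> 0 < i /\ 0 < j].

(* Sorting A for these orders gives the two-row words (i, j) and (k, l). *)
Definition le_ij : rel (nat * nat) := fun p q =>
  (p.2 < q.2) || (p.2 == q.2) && (q.1 <= p.1).
Definition le_kl : rel (nat * nat) := fun p q =>
  (p.1 < q.1) || (p.1 == q.1) && (q.2 <= p.2).

Definition word_i (A : mat) : seq nat := unzip1 (sort le_ij A).
Definition word_j (A : mat) : seq nat := unzip2 (sort le_ij A).
Definition word_k (A : mat) : seq nat := unzip1 (sort le_kl A).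
Definition word_l (A : mat) : seq nat := unzip2 (sort le_kl A).

(* [Negz n] is the index -(n+1). *)
Definition f (i : int) (A : mat) : option mat :=
  match i with
  | Posz 0 => Some (A `+` [mset (1, 1)])%mset
  | Posz i => omap (fun u => seq_mset (zip (word_k A) u)) (word_f i (word_l A))
  | Negz n => omap (fun u => seq_mset (zip u (word_j A))) (word_f n.+1 (word_i A))
  end.

Definition F (e i : nat) (A : mat) : option mat :=
  if i == 0 then iter e (obind (f 0%Z)) (Some A)
  else obind (f i%:Z) (f (- i%:Z)%R A).

Definition Mhat (e : nat) : set mat :=
  M `&` [set A | (forall i j, 0 < i -> 0 < j -> A (i, j) = A (j, i)) /\
                 (forall i, 0 < i -> e %| A (i, i))].

(* {g_{i_1}^{m_1} ... g_{i_r}^{m_r} O | m_k >= 0} \ {0} for a = i_1 ... i_r;   *)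
(* with g = f (resp. F e) and a a reduced expression of w in W (resp. \hat W)  *)
(* this is M_w (resp. \hat M^e_w).                                             *)
Definition demazure (I : Type) (g : I -> mat -> option mat) (a : seq I) : set mat :=
  [set A | exists2 m : seq nat, size m = size a &
     foldr (fun im x => iter im.2 (obind (g im.1)) x) (Some mset0) (zip a m)
       = Some A].

(* A tableau of rotated shape is the list of its columns from right to left,   *)
(* each column being read from bottom to top.                                  *)
Notation tableau := (seq (seq nat)).

Fixpoint insert (T : tableau) (a : nat) : tableau :=
  if T is c :: T' then
    if has (geq a) c then
      let a' := \max_(x <- c | x <= a) x in
      [seq if x == a' then a else x | x <- c] :: insert T' a'
    else rcons c a :: T'
  else [:: [:: a]].

Definition Ptab (w : seq nat) : tableau := foldl insert [::] w.

Definition kappa (A : mat) : tableau := Ptab (rev (word_l A)).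

(* A partition is the list of its nonzero parts, so that its size is l(nu). *)
Definition is_partition (nu : seq nat) : bool := sorted geq nu && (0 \notin nu).

(* Parts are indexed from 1. *)
Definition part (nu : seq nat) (i : nat) : nat := nth 0 nu i.-1.

(* nu^pi: columns bottom-aligned, rows right-justified, and the i-th row from  *)
(* the bottom has nu_i boxes.                                                  *)
Definition has_shape (nu : seq nat) (T : tableau) : Prop :=
  [/\ [::] \notin T, sorted geq (map size T) &
      forall i, 0 < i -> count (fun c => i <= size c) T = part nu i].

Definition SST (nu : seq nat) : set tableau :=
  [set T | [/\ has_shape nu T,
      all (all (leq 1)) T,
      all (sorted gtn) T &
      forall k r, k.+1 < size T -> r < size (nth [::] T k.+1) ->
        nth 0 (nth [::] T k.+1) r <= nth 0 (nth [::] T k) r]].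

(* Meant for size nu <= size ph. *)
Definition SST_flag (ph : seq nat) (nu : seq nat) : set tableau :=
  SST nu `&` [set T : tableau | forall (i : nat) (c : seq nat),
                 0 < i <= size ph -> c \in T -> i <= size c ->
                 nth 0 c i.-1 <= part ph (size ph - i + 1)].

(* Main.v *)
(* For a matrix A let c(A) be the rightmost column of kappa(A). The set M_w     *)
(* consists of the matrices A such that c(A) and c(A^T) are bounded entrywise  *)
(* by the Frobenius coordinates of lambda(w), i.e. such that every strict      *)
(* chain in the support of A fits into lambda(w). Indeed each letter s_i of a  *)
(* reduced word adds a box to the partition; the bound for the larger          *)
(* partition is stable under e_i and f_i, and an element killed by e_i         *)
(* satisfies the bound for the smaller one. This uses that insertion commutes  *)
(* with f_i for i > 0, and that kappa is invariant under f_{-i}: the two       *)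
(* families of operators commute, so A can be raised to a highest weight for   *)
(* i > 0, where the tableau is determined by its content.                      *)
(* The same argument with F_i on symmetric matrices gives the first equality.  *)
(* For the second, raising by the E_i reduces to diagonal matrices, whose      *)
(* tableaux are the highest weight ones and have the diagonal as their shape.  *)
Require Import Defs.
From mathcomp Require Import all_boot all_order all_algebra.
From mathcomp Require Import finmap multiset.
From mathcomp Require Import boolp classical_sets functions cardinality.
From mathcomp Require Import zify lra ring.

Set Implicit Arguments.
Unset Strict Implicit.
Unset Printing Implicit Defensive.

Local Open Scope classical_set_scope.
Import GRing.Theory Order.TTheory Num.Theory.
Local Open Scope nat_scope.

(** * Signatures of words *)

(** All the sets in question are cut out by bounds on one column. Encode w by its particles, the
    positions where w(Lambda_0) takes the value 1/2, and call the other nonzero positions holes. For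
    the words that occur here every letter moves a particle from [node_p i] to the hole [node_q i]
    ([What_min_adds], [reduced_adds]). Let I be the set of positive particles and J the set of j > 0
    with a hole at -j. By Schensted's theorem ([size_le_first_col], [first_col_subseq]) the number
    of entries >= m in the rightmost column of [kappa A] is the greatest length of a strict chain in
    the support of A with column indices >= m. [demazure_bounded] says that A lies in M_w if and
    only if this number is at most the number of elements >= m of I for all m > 0, and likewise for
    the transpose of A and J.

    The induction on the word uses the following. The operator f_i changes only the count at m = i+1
    ([cnt_first_col_f]), so a bound given by a set without i is stable under f_i and its inverse. If
    e_i kills A, each i+1 in the column comes with an i ([cnt_first_col_hw]), so i+1 in the set may
    be replaced by i. The transposed condition is untouched, because f_i and f_{-i} commute
    ([fr_fl_comm]) and [kappa] is invariant under f_{-i} ([kappa_fl]). The letter 0 adds 1 to both I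
    and J; it is treated by removing all copies of the entry (1, 1) ([first_col_no11]).

    On symmetric matrices F_i = f_i f_{-i} can be undone whenever f_i can ([E_exists]), and it
    preserves [Mhat e] for e = 1, 2 ([F_Mhat]). So the same induction runs inside [Mhat e]
    ([demazure_hat_bounded]), which gives the first equality.

    For the second, F_i acts on tableaux as f_i ([kappa_F]). A symmetric matrix of highest weight is
    diagonal ([sym_hw_diag]), and its diagonal is the shape of its tableau. Hence the shapes have
    parts divisible by e ([shape_dvd]), and every such tableau occurs ([kappa_surj]). Finally
    [phi w] lists I ([phiE]), and as rows increase to the right the flag condition is the bound on
    the rightmost column ([SST_flagP]). *)

Definition mult (a : nat) (w : seq nat) : nat := count_mem a w.
Arguments mult : simpl never.

Lemma mult_nil a : mult a [::] = 0. Proof. by []. Qed.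

Lemma mult_cons a b w : mult a (b :: w) = (b == a) + mult a w.
Proof. by []. Qed.

Lemma mult_cat a x y : mult a (x ++ y) = mult a x + mult a y.
Proof. exact: count_cat. Qed.

(* In the signature of a word each letter i cancels a later letter i+1.  What  *)
(* remains is a word (i+1)^p i^q with p = weps and q = wphi.                   *)
Fixpoint weps (i : nat) (w : seq nat) : nat :=
  if w is a :: w' then (a == i.+1) + (weps i w' - (a == i)) else 0.

Fixpoint wphi (i : nat) (w : seq nat) : nat :=
  if w is a :: w' then wphi i w' + ((a == i) - weps i w') else 0.

(** The letters i that survive in x cancel letters i+1 that survive in y; truncated subtraction
    stops the cancellation when one side is exhausted. *)
Lemma weps_cat i x y : weps i (x ++ y) = weps i x + (weps i y - wphi i x).
Proof. by elim: x => [|a x IH] /=; [lia | rewrite IH; lia]. Qed.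

Lemma wphi_cat i x y : wphi i (x ++ y) = wphi i y + (wphi i x - weps i y).
Proof. elim: x => [|a x IH] /=; [lia | rewrite IH weps_cat; lia]. Qed.

Lemma weps_wphi i w : weps i w + mult i w = wphi i w + mult i.+1 w.
Proof. elim: w => [|a w IH] //=; rewrite !mult_cons; lia. Qed.

(** In general [weps] is the largest excess of letters i+1 over letters i in a prefix. The induction
    needs this for every bound k; the case k = 0 is the lattice word condition. *)
Lemma weps_eq0P i w : reflect
  (forall x y, w = x ++ y -> mult i.+1 x <= mult i x)
  (weps i w == 0).
Proof.
apply: (iffP eqP) => [w0 x y E|H].
  have := weps_cat i x y; rewrite -E w0 => E0.
  by have := weps_wphi i x; lia.
suff H' : forall k, (forall x y, w = x ++ y ->
    mult i.+1 x <= mult i x + k) -> weps i w <= k.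
  have : weps i w <= 0 by apply: H' => x y /H; lia.
  by rewrite leqn0 => /eqP.
elim: w {H} => [|a w IH] k H //=.
have := H [:: a] w erefl; rewrite !mult_cons !mult_nil => H1.
have [|ai] := leqP (weps i w) (a == i); first lia.
suff /IH : forall x y, w = x ++ y ->
    mult i.+1 x <= mult i x + (k + (a == i) - (a == i.+1)) by lia.
move=> x y E; have := H (a :: x) y; rewrite E !mult_cons => /(_ erefl); lia.
Qed.

Lemma wphi_eq0P i w : reflect
  (forall x y, w = x ++ y -> mult i y <= mult i.+1 y)
  (wphi i w == 0).
Proof.
apply: (iffP eqP) => [w0 x y E|].
  have := wphi_cat i x y; rewrite -E w0 => E0.
  by have := weps_wphi i y; lia.
elim: w => [|a w IH] //= H.
have w0 : wphi i w = 0 by apply: IH => x y E; apply: (H (a :: x)); rewrite E.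
have := H [::] (a :: w) erefl; have := weps_wphi i w; rewrite w0 !mult_cons; lia.
Qed.

(** The letter found is the leftmost surviving i, the one that f_i changes. The same conditions on x
    and y single out the letter i+1 that e_i changes, so the two operators are inverse to each
    other. *)
Lemma wphi_gt0P i w : 0 < wphi i w ->
  exists x y, [/\ w = x ++ i :: y, wphi i x = 0 & weps i y = 0].
Proof.
elim: w => [|a w IH] //=.
have [E _|nE h] := boolP (weps i w < (a == i)).
  case: (eqVneq a i) E => [->|//] E; exists [::], w; split=> //; lia.
have /IH[x [y [E x0 y0]]] : 0 < wphi i w by lia.
exists (a :: x), y; split=> //=; first by rewrite E.
by move: nE; rewrite E weps_cat /= eqxx x0 y0; lia.
Qed.

Lemma weps_gt0P i w : 0 < weps i w ->
  exists x y, [/\ w = x ++ i.+1 :: y, wphi i x = 0 & weps i y = 0].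
Proof.
elim: w => [|a w IH] //=.
have [E|nE] := posnP (weps i w - (a == i)); last first=> [_|].
  have /IH[x [y [E x0 y0]]] : 0 < weps i w by lia.
  exists (a :: x), y; split=> //=; first by rewrite E.
  by move: nE; rewrite E weps_cat /= eqxx x0 y0; lia.
case: (eqVneq a i.+1) => [ai _|]; last by rewrite E.
by exists [::], w; rewrite {1}ai; split=> //; move: E; rewrite ai; lia.
Qed.

(** * The tensor product rule as a signature rule *)

Lemma max_iter_eq (T : Type) (g : T -> option T) n b k : k <= n ->
    (forall j, j <= n -> iter j (obind g) (Some b) = (j <= k) :> bool) ->
  max_iter g n b = k.
Proof.
move=> kn H; rewrite /max_iter; apply/eqP; rewrite eqn_leq; apply/andP; split.
  by apply/bigmax_leqP => j; rewrite H // -ltnS.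
have kn' : k < n.+1 by [].
apply: (@leq_bigmax_cond _ _ _ (Ordinal kn')).
by rewrite /= H.
Qed.

Lemma letter_phiE i a : letter_phi i a = (a == i).
Proof.
apply: max_iter_eq => [|[|[|j]]] //=; first by case: (a == i).
by rewrite /letter_f; case: (a == i).
Qed.

Lemma iter_None (T : Type) (g : T -> option T) n : iter n (obind g) None = None.
Proof. by elim: n => //= n ->. Qed.

Lemma weps_size i w : weps i w <= size w.
Proof. by elim: w => //= a v; lia. Qed.

Lemma max_iter_weps i n (g : seq nat -> option (seq nat)) w :
    (forall u, size u = n -> (g u : bool) = (0 < weps i u) /\
       forall v, g u = Some v -> size v = n /\ weps i u = (weps i v).+1) ->
  size w = n -> max_iter g n w = weps i w.
Proof.
move=> H sw; apply: max_iter_eq => [|j _]; first by rewrite -sw weps_size.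
elim: j w sw => [|j IHj] w sw //.
have [H1 H2] := H w sw; rewrite iterSr.
have -> : obind g (Some w) = g w by [].
case E: (g w) H1 => [u|] h; last by rewrite iter_None; move: h => /=; lia.
by have [su ->] := H2 _ E; rewrite IHj.
Qed.

Lemma word_e_recE i n w : size w = n ->
  (word_e_rec i n w : bool) = (0 < weps i w) /\
  forall u, word_e_rec i n w = Some u -> size u = n /\ weps i w = (weps i u).+1.
Proof.
elim: n w => [|n IH] [] // a u [su]; have [H1 H2] := IH u su.
rewrite /= (max_iter_weps IH su) letter_phiE; split.
  have [le|lt] := leqP (weps i u) (a == i).
    by rewrite /letter_e; case: eqP => /=; lia.
  by case: (word_e_rec i n u) H1 => [?|] /= h; lia.
have [le|lt] := leqP (weps i u) (a == i) => v.
  rewrite /letter_e; case: (eqVneq a i.+1) le => // -> le [<-] /=.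
  by move: le; rewrite eqxx; lia.
case E: (word_e_rec i n u) => [u'|] //= [<-] /=; have := H2 _ E; lia.
Qed.

Lemma word_epsE i w : word_eps i w = weps i w.
Proof.
apply: max_iter_weps => // u su; rewrite /word_e; have := @word_e_recE i _ u erefl.
by rewrite su.
Qed.

Lemma word_f_cons i a w : word_f i (a :: w) =
  if weps i w < (a == i) then Some (i.+1 :: w) else omap (cons a) (word_f i w).
Proof.
by rewrite /= word_epsE letter_phiE /letter_f; case: eqP.
Qed.

Lemma word_fP i w w' : word_f i w = Some w' <->
  exists x y, [/\ w = x ++ i :: y, w' = x ++ i.+1 :: y,
                 wphi i x = 0 & weps i y = 0].
Proof.
split=> [|[x [y [-> -> x0 y0]]]]; last first.
  elim: x x0 => [|a x IH]; first by rewrite word_f_cons y0 eqxx.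
  rewrite [wphi _ _]/= => ax0; rewrite cat_cons word_f_cons ifF; last first.
    by rewrite weps_cat /= y0 eqxx; lia.
  by rewrite IH //; lia.
elim: w w' => [|a w IH] w' //; rewrite word_f_cons.
case: ifP => [aw [<-]|/negbT aw].
  case: (eqVneq a i) aw => [->|_]; last by [].
  by move=> w0; exists [::], w; split=> //; lia.
case E: (word_f i w) => [u|] //= [<-].
have [x [y [Ew -> x0 y0]]] := IH _ E.
exists (a :: x), y; split=> //=; first by rewrite Ew.
by move: aw; rewrite Ew weps_cat /= eqxx x0 y0; lia.
Qed.

Lemma word_f_isSome i w : (word_f i w : bool) = (0 < wphi i w).
Proof.
case E: (word_f i w) => [u|] /=.
  by move/word_fP: E => [x [y [-> _ x0 y0]]]; rewrite wphi_cat /= x0 y0 eqxx; lia.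
case: posnP => // /wphi_gt0P[x [y [Ew x0 y0]]].
suff : word_f i w = Some (x ++ i.+1 :: y) by rewrite E.
by apply/word_fP; exists x, y.
Qed.

Lemma word_f_cat i x y : word_f i (x ++ y) =
  if weps i y < wphi i x then omap (cat^~ y) (word_f i x)
  else omap (cat x) (word_f i y).
Proof.
elim: x => [|a x IH]; first by case: (word_f i y).
rewrite cat_cons !word_f_cons IH weps_cat /=.
have [h1|h1] := ltnP (weps i y) (wphi i x).
  have -> : weps i x + (weps i y - wphi i x) = weps i x by lia.
  have -> : weps i y < wphi i x + ((a == i) - weps i x) by lia.
  by case: ifP => // _; case: (word_f i x).
have [h2|h2] := ltnP (weps i x + (weps i y - wphi i x)) (a == i).
  have -> : weps i y < wphi i x + ((a == i) - weps i x) by lia.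
  by have -> : weps i x < (a == i) by lia.
have -> : weps i y < wphi i x + ((a == i) - weps i x) = false by lia.
by case: (word_f i y).
Qed.

Lemma word_f_sumn i w w' : word_f i w = Some w' -> sumn w' = (sumn w).+1.
Proof. by case/word_fP=> [x [y [-> -> _ _]]]; rewrite !sumn_cat /=; lia. Qed.

Lemma word_f_size i w w' : word_f i w = Some w' -> size w' = size w.
Proof. by case/word_fP=> [x [y [-> -> _ _]]]; rewrite !size_cat. Qed.

(** * Column insertion *)

Definition sub1 (x y : nat) (c : seq nat) := [seq if z == x then y else z | z <- c].

Definition bumped (c : seq nat) (a : nat) := \max_(x <- c | x <= a) x.

Definition col_ins (c : seq nat) (a : nat) :=
  if has (geq a) c then sub1 (bumped c a) a c else rcons c a.

(** A word with at most one letter, so that insertion into a column sends the word [a :: rev c] to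
    [rev (col_ins c a) ++ bump_out c a]. *)
Definition bump_out (c : seq nat) (a : nat) :=
  if has (geq a) c then [:: bumped c a] else [::].

Lemma bumpedP c a : has (geq a) c ->
  [/\ bumped c a \in c, bumped c a <= a &
      forall x, x \in c -> x <= a -> x <= bumped c a].
Proof.
move=> ha; have le x : x \in c -> x <= a -> x <= bumped c a.
  by move=> xc xa; apply: (@leq_bigmax_seq _ c (fun x => x <= a) id).
suff [m [mc ma em]] : exists m, [/\ m \in c, m <= a & m = bumped c a].
  by rewrite -em in le *.
elim: c ha {le} => //= x c IH; rewrite /bumped big_cons -/(bumped c a).
have [xa _|xa /= /IH[m [mc ma me]]] := leqP x a; last first.
  by exists m; rewrite inE mc orbT.
have [|nh] := boolP (has (geq a) c).
  move=> /IH[m [mc ma <-]]; exists (maxn x m).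
  by rewrite inE /maxn; case: ifP => _; rewrite ?eqxx ?mc ?orbT //; split=> //; lia.
exists x; rewrite inE eqxx /bumped big1_seq ?maxn0 // => y /andP[ya yc].
by case/hasP: nh; exists y.
Qed.

Lemma bumped_eq c a m : m \in c -> m <= a ->
  (forall x, x \in c -> x <= a -> x <= m) -> bumped c a = m.
Proof.
move=> mc ma H; have /bumpedP[bc ba hb] : has (geq a) c by apply/hasP; exists m.
by apply/eqP; rewrite eqn_leq hb // H.
Qed.

Lemma mem_sub1 x y c z :
  (z \in sub1 x y c) = (z \in c) && (z != x) || (x \in c) && (z == y).
Proof.
elim: c => [|a c IH] //=; rewrite !inE IH.
case: (eqVneq a x) => [->|ax] /=.
  case: (z == x) => /=; case: (z == y); case: (z \in c); by case: (x \in c).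
case: (eqVneq z a) => [->|za] //=; by rewrite ax.
Qed.

Lemma sub1_id x c : sub1 x x c = c.
Proof. by rewrite /sub1 -[RHS]map_id; apply: eq_map => z; case: eqP. Qed.

Lemma sub1_notin x y c : x \notin c -> sub1 x y c = c.
Proof.
move=> xc; rewrite /sub1 -[RHS]map_id; apply/eq_in_map => z zc.
by case: eqP zc xc => // -> ->.
Qed.

Lemma sub1_sub1 x y z c : y \notin c -> sub1 y z (sub1 x y c) = sub1 x z c.
Proof.
move=> yc; rewrite /sub1 -map_comp; apply/eq_in_map => u uc /=.
case: (u == x); first by rewrite eqxx.
by case: eqP uc yc => // -> ->.
Qed.

Lemma sub1C x y u v c : x != u -> y != u -> v != x -> 
  sub1 x y (sub1 u v c) = sub1 u v (sub1 x y c).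
Proof.
move=> /eqP xu /eqP yu /eqP vx; rewrite /sub1 -!map_comp; apply: eq_map => z /=.
case: (z =P u) => ?; case: (z =P x) => ?; repeat (case: eqP => ?); congruence.
Qed.

Lemma sorted_gtn_pairwise c : sorted gtn c = pairwise gtn c.
Proof. by apply: sorted_pairwise => x y z; rewrite /=; lia. Qed.

Lemma path_gtnE a c : path gtn a c = all (gtn a) c && sorted gtn c.
Proof. by apply: path_sortedE => x y z; rewrite /=; lia. Qed.

Lemma sub1_sorted x y c : sorted gtn c ->
    (forall z, z \in c -> z < x -> z < y) -> (forall z, z \in c -> x < z -> y < z) ->
  sorted gtn (sub1 x y c).
Proof.
rewrite !sorted_gtn_pairwise pairwise_map => H h1 h2.
apply: (@sub_in_pairwise _ (mem c) gtn) H; last exact: allss.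
move=> u v uc vc /= uv; have := h1 v vc; have := h2 u uc.
by case: eqP; case: eqP; lia.
Qed.

Lemma rcons_sorted c a : sorted gtn c -> (forall x, x \in c -> a < x) ->
  sorted gtn (rcons c a).
Proof.
case: c => //= x c; rewrite rcons_path => -> H /=.
by apply: H; rewrite mem_last.
Qed.

Lemma hasN_gt c a : ~~ has (geq a) c -> forall x, x \in c -> a < x.
Proof. by move/hasPn => H x /H /=; rewrite -ltnNge. Qed.

Lemma col_ins_sorted c a : sorted gtn c -> sorted gtn (col_ins c a).
Proof.
rewrite /col_ins; case: ifP => [/bumpedP[bc ba hb]|/negbT/hasN_gt ha] cs.
  apply: sub1_sorted => // z zc h; first by lia.
  by have := hb z zc; lia.
exact: rcons_sorted.
Qed.

Lemma mem_col_ins c a z : (z \in col_ins c a) =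
  (z == a) || (z \in c) && ~~ (has (geq a) c && (z == bumped c a)).
Proof.
rewrite /col_ins; case: ifP => [/bumpedP[bc ba hb]|_].
  by rewrite mem_sub1 bc orbC.
by rewrite mem_rcons inE andbT.
Qed.

(** Columns are stored from bottom to top, so [rev c] increases: if i and i+1 both occur, i comes
    first and cancels i+1. *)
Lemma col_sig i c : sorted gtn c ->
  weps i (rev c) = (i.+1 \in c) && (i \notin c) /\
  wphi i (rev c) = (i \in c) && (i.+1 \notin c).
Proof.
elim: c => //= a c IH; rewrite path_gtnE.
move=> /andP[/allP ac /IH[e1 e2]].
rewrite rev_cons -cats1 weps_cat wphi_cat /= e1 e2 !inE.
have := ac i; have := ac i.+1; rewrite /=.
by case: (i \in c); case: (i.+1 \in c) => /= h1 h2;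
  do 2?[case: eqP]; lia.
Qed.

Lemma col_f i c : sorted gtn c -> i \in c -> i.+1 \notin c ->
  word_f i (rev c) = Some (rev (sub1 i i.+1 c)).
Proof.
elim: c => //= a c IH; rewrite path_gtnE.
move=> /andP[/allP ac cs]; have [e1 e2] := col_sig i cs.
rewrite !inE !negb_or => ic /andP[ia ic'].
rewrite /sub1 [map _ _]/= !rev_cons -!cats1 word_f_cat e2 ic' andbT.
rewrite [weps i [:: a]]/= word_f_cons [weps i [::]]/=.
case: (eqVneq a i) ic => [ai|ai].
  have ic : i \notin c by apply/negP => /ac /=; lia.
  by rewrite (negbTE ic) -/(sub1 i i.+1 c) sub1_notin.
rewrite /= => ic; rewrite ic IH //=.
by have -> : (a == i.+1) + (0 - 0) < true by lia.
Qed.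

Lemma col_ins_sig i c a : sorted gtn c ->
  weps i (rev (col_ins c a) ++ bump_out c a) = weps i (a :: rev c) /\
  wphi i (rev (col_ins c a) ++ bump_out c a) = wphi i (a :: rev c).
Proof.
move=> cs; have [e1 e2] := col_sig i cs.
have [e3 e4] := col_sig i (col_ins_sorted a cs).
rewrite weps_cat wphi_cat e3 e4 /= e1 e2 !mem_col_ins /bump_out.
set p := i \in c; set q := i.+1 \in c.
case: ifP => [/bumpedP[bc ba hb]|/negbT/hasN_gt ha] /=; last first.
  have hp : p -> a < i by apply: ha.
  have hq : q -> a < i.+1 by apply: ha.
  move: hp hq; rewrite /weps /wphi; case: p; case: q => /= hp hq; split; lia.
set b := bumped c a in bc ba hb *.
have bp : b == i -> p by move=> /eqP bi; rewrite /p -bi.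
have bq : b == i.+1 -> q by move=> /eqP bi; rewrite /q -bi.
have hp : p -> i <= a -> i <= b by apply: hb.
have hq : q -> i < a -> i < b by apply: hb.
clearbody p q.
case: (eqVneq b i) bp => [bi bp|bi _].
  have pT : p = true := bp isT; subst p; have {bp bq}hq' : q -> a < i.+1 by move=> /hq; lia.
  case: q hq' hq => /= hq' hq; split; lia.
case: (eqVneq b i.+1) bq => [bi' bq|bi' _].
  have qT : q = true := bq isT; subst q; case: p hp {bq} => /= hp; split; lia.
case: p hp; case: q hq => /= hq hp; split; lia.
Qed.

(* The tableau version of the Knuth relations: the bijection                   *)
(* a (x) c -> c' (x) a' given by the insertion of a into the column c commutes *)
(* with the crystal operators.                                                 *)
Lemma col_ins_f i c a a1 c1 : sorted gtn c -> size c1 = size c ->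
    word_f i (a :: rev c) = Some (a1 :: rev c1) ->
  word_f i (rev (col_ins c a) ++ bump_out c a) =
    Some (rev (col_ins c1 a1) ++ bump_out c1 a1) /\
  has (geq a) c = has (geq a1) c1.
Proof.
move=> cs sc; have [e1 e2] := col_sig i cs; rewrite word_f_cons e1.
have [ce1 ce2] := col_sig i (col_ins_sorted a cs).
have cf := @col_f i _ (col_ins_sorted a cs).
case: (eqVneq a i) => [-> | ai] in ce1 ce2 cf *.
  case: ifP => [w0 [<- /(can_inj revK) <-]|].
    (* Here f_i acts on a = i. If i+1 lies in c then so does i; the letters i and i+1 bump
       themselves, the column stays, and f_i acts on the bumped letter. *)
    have [ic1|ic1] := boolP (i.+1 \in c).
      have ic : i \in c by move: w0; rewrite ic1 /=; case: (i \in c).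
      have b0 : bumped c i = i by apply: bumped_eq.
      have b1 : bumped c i.+1 = i.+1 by apply: bumped_eq.
      have h0 : has (geq i) c by apply/hasP; exists i => /=.
      have h1 : has (geq i.+1) c by apply/hasP; exists i.+1 => /=.
      rewrite /col_ins /bump_out h0 h1 b0 b1 !sub1_id; split=> //.
      by rewrite word_f_cat e2 ic ic1 ltn0 word_f_cons eqxx.
    (* Without i+1 in c, the letters i and i+1 bump the same entry, and f_i acts on the new
       column. *)
    have h : has (geq i) c = has (geq i.+1) c.
      apply: eq_in_has => x xc /=; case: (x =P i.+1) => [xi|]; last by lia.
      by rewrite -xi xc in ic1.
    have b : bumped c i.+1 = bumped c i.
      rewrite /bumped big_seq_cond [RHS]big_seq_cond; apply: eq_bigl => x.
      case xc: (x \in c) => //=; case: (x =P i.+1) => [xi|]; last by lia.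
      by rewrite -xi xc in ic1.
    split=> //; rewrite word_f_cat ce2 mem_col_ins eqxx /=.
    have -> : i.+1 \notin col_ins c i.
      by rewrite mem_col_ins (negbTE ic1) orbF; lia.
    have -> : weps i (bump_out c i) < true.
      rewrite /bump_out; case: ifP => //= /bumpedP[_ ? _]; lia.
    rewrite cf ?mem_col_ins ?eqxx ?(negbTE ic1) ?orbF //; last by lia.
    rewrite /= /bump_out -h b; congr (Some (rev _ ++ _)).
    rewrite /col_ins -h b; case: ifP => hi; last first.
      rewrite /sub1 map_rcons eqxx; congr rcons; apply: sub1_notin.
      by apply/negP => /(hasN_gt (negbT hi)); lia.
    have [ib|ib] := eqVneq (bumped c i) i; first by rewrite ib sub1_id.
    apply: sub1_sub1; apply/negP => ic; case/eqP: ib; exact: bumped_eq.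
  case Ef: (word_f i (rev c)) => [u|] //= nw [Eu].
  have := word_f_isSome i (rev c).
  rewrite Ef e2 /= => /esym/idP.
  by move: nw; case: (i \in c); case: (i.+1 \in c).
rewrite ltn0.
case Ef: (word_f i (rev c)) => [u|] //= [<- Eu]; subst u.
have := word_f_isSome i (rev c); rewrite Ef e2 /=.
have [ic|//] := boolP (i \in c); have [//|ic1 _] := boolP (i.+1 \in c).
move: Ef; rewrite (col_f cs ic ic1) => -[/(can_inj revK) <-].
have has1 : has (geq a) (sub1 i i.+1 c) = has (geq a) c.
  rewrite /sub1 has_map; apply: eq_in_has => x xc /=.
  by case: (x =P i) => [->|//]; lia.
split; last by [].
(* Now f_i changes i into i+1 inside c. If a = i+1, or if a bumps i, the change shows in the bumped
   letter; if a > i+1 bumps another entry, or if a < i, it shows in the column. *)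
have [ia|ai'] := leqP a i; last first.
  have hc : has (geq a) c by apply/hasP; exists i => //=; lia.
  have [bc ba hb] := bumpedP hc.
  have [ea|na1] := eqVneq a i.+1.
    have bi : bumped c a = i.
      apply: bumped_eq => //; first lia.
      by move=> x xc; rewrite ea leq_eqVlt => /orP[/eqP xi|//]; rewrite -xi xc in ic1.
    have bi1 : bumped (sub1 i i.+1 c) a = a.
      apply: bumped_eq => //; rewrite mem_sub1 ic ea eqxx orbT //.
    rewrite word_f_cat ce2 /col_ins /bump_out has1 hc bi bi1 ea sub1_id.
    have -> : i \in sub1 i i.+1 c = false.
      by rewrite mem_sub1 eqxx andbF (ltn_eqF (ltnSn i)) andbF.
    by rewrite ltn0 word_f_cons eqxx.
  have hbi : i <= bumped c a by apply: hb => //; lia.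
  have [bi|nbi] := eqVneq (bumped c a) i.
    have bi1 : bumped (sub1 i i.+1 c) a = i.+1.
      apply: bumped_eq; first by rewrite mem_sub1 ic eqxx orbT.
        by lia.
      move=> x; rewrite mem_sub1 => /orP[/andP[xc xi] xa|/andP[_ /eqP ->] //].
      by rewrite (leq_trans (hb x xc xa)) // bi leqnSn.
    rewrite word_f_cat ce2 /col_ins /bump_out has1 hc bi bi1 sub1_sub1 //.
    have -> : i \in sub1 i a c = false.
      by rewrite mem_sub1 eqxx andbF eq_sym (negbTE ai) andbF.
    by rewrite ltn0 word_f_cons eqxx.
  have nb1 : bumped c a != i.+1 by apply: contraNneq ic1 => <-.
  have bi1 : bumped (sub1 i i.+1 c) a = bumped c a.
    apply: bumped_eq => //; first by rewrite mem_sub1 bc nbi.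
    move=> x; rewrite mem_sub1 => /orP[/andP[xc _]|/andP[_ /eqP ->]]; first exact: hb.
    by lia.
  have io : i \in col_ins c a.
    by rewrite mem_col_ins ic hc [i == bumped _ _]eq_sym nbi orbT.
  have io1 : i.+1 \notin col_ins c a.
    by rewrite mem_col_ins (negbTE ic1) orbF eq_sym.
  rewrite word_f_cat ce2 io io1 cf //.
  rewrite /bump_out has1 hc bi1 /= (negbTE nb1) /=.
  by rewrite /col_ins has1 bi1 hc; congr (Some (rev _ ++ _)); apply: sub1C; rewrite // eq_sym.
have {}ia : a < i by rewrite ltn_neqAle ai.
have ba x : x \in c -> x <= a -> (x != i) && (x != i.+1).
  by move=> _ xa; rewrite !ltn_eqF ?(leq_ltn_trans xa) // ltnW.
have b1 : bumped (sub1 i i.+1 c) a = bumped c a.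
  rewrite /bumped /sub1 big_map big_seq_cond [RHS]big_seq_cond.
  apply: eq_big => [x|x /andP[xc]]; last first.
    by case: (eqVneq x i) => // -> /=; rewrite leqNgt (ltn_trans ia).
  by case: (x \in c) => //=; case: (eqVneq x i) => // ->;
    rewrite [i < a]ltnNge (ltnW ia) [RHS]leqNgt ia.
have io : i \in col_ins c a.
  rewrite mem_col_ins ic /=; apply/orP; right; apply/negP => /andP[h /eqP e].
  by have [bc /(ba _ bc)] := bumpedP h; rewrite -e eqxx.
have io1 : i.+1 \notin col_ins c a.
  by rewrite mem_col_ins (negbTE ic1) orbF gtn_eqF // ltnW.
rewrite word_f_cat ce2 io io1 cf //.
have -> : weps i (bump_out c a) < true.
  rewrite /bump_out; case: ifP => // h /=.
  by have [bc /(ba _ bc)/andP[_ /negbTE ->]] := bumpedP h.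
rewrite /= /bump_out has1 b1; congr (Some (rev _ ++ _)).
rewrite /col_ins has1 b1; case: ifP => h; last first.
  by rewrite /sub1 map_rcons ltn_eqF.
have [bc /(ba _ bc)/andP[bi bi1] _] := bumpedP h.
by apply: sub1C => //; rewrite eq_sym.
Qed.

(** * Insertion tableaux *)

Definition reading (T : tableau) : seq nat := flatten (map rev T).

Definition Ptab_rev (l : seq nat) : tableau := foldr (fun a T => insert T a) [::] l.

Definition columns_sorted (T : tableau) := all (sorted gtn) T.

Lemma kappaE A : kappa A = Ptab_rev (word_l A).
Proof. by rewrite /kappa /Ptab foldl_rev. Qed.

Lemma insert_cons c T a : insert (c :: T) a =
  col_ins c a :: if has (geq a) c then insert T (bumped c a) else T.
Proof. by rewrite /= /col_ins /sub1 /bumped; case: ifP. Qed.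

Lemma insert_sorted T a : columns_sorted T -> columns_sorted (insert T a).
Proof.
elim: T a => [|c T IH] a //; rewrite insert_cons /= => /andP[cs Ts].
by rewrite col_ins_sorted //=; case: ifP => _ //; apply: IH.
Qed.

Lemma insert_sig i T a : columns_sorted T ->
  weps i (reading (insert T a)) = weps i (a :: reading T) /\
  wphi i (reading (insert T a)) = wphi i (a :: reading T).
Proof.
elim: T a => [|c T IH] a // /andP[cs Ts].
have [ce cp] := col_ins_sig i a cs.
have -> : a :: reading (c :: T) = (a :: rev c) ++ reading T by [].
rewrite weps_cat wphi_cat -ce -cp insert_cons /reading /= -/(reading _) -/(reading _).
rewrite /bump_out; case: ifP => _; last by rewrite cats0 -weps_cat -wphi_cat.
have [e p] := IH (bumped c a) Ts.
by rewrite -weps_cat -wphi_cat -catA cat1s !weps_cat !wphi_cat e p.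
Qed.

Lemma reading_cons c T : reading (c :: T) = rev c ++ reading T.
Proof. by []. Qed.

Lemma reading_inj T T1 : map size T = map size T1 -> reading T = reading T1 -> T = T1.
Proof.
elim: T T1 => [|c T IH] [|c1 T1] //= [sc sT]; rewrite !reading_cons => /eqP.
rewrite eqseq_cat ?size_rev // => /andP[/eqP/(can_inj revK) -> /eqP rT].
by rewrite (IH _ sT rT).
Qed.

Lemma size_col_ins c a : size (col_ins c a) = size c + ~~ has (geq a) c.
Proof.
by rewrite /col_ins; case: ifP => _; rewrite ?size_map ?size_rcons ?addn0 ?addn1.
Qed.

(** Apply [col_ins_f] to the first column and insert the bumped letter, changed or not, into the
    rest. Equal column heights let a tableau be recovered from its reading word. *)
Lemma insert_f i T a T1 a1 : columns_sorted T -> map size T1 = map size T ->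
    word_f i (a :: reading T) = Some (a1 :: reading T1) ->
  word_f i (reading (insert T a)) = Some (reading (insert T1 a1)) /\
  map size (insert T1 a1) = map size (insert T a).
Proof.
elim: T T1 a a1 => [|c T IH] [|c1 T1] a a1 // /andP[cs Ts] [sc sT].
have -> : a :: reading (c :: T) = (a :: rev c) ++ reading T by [].
have [ce cp] := col_ins_sig i a cs.
have [ie ip] := insert_sig i (bumped c a) Ts.
have [ce1 cp1] := col_sig i (col_ins_sorted a cs).
rewrite word_f_cat; case: ifP => h.
  case E: (word_f i (a :: rev c)) => [u|] // [] Eu.
  have [v Ev] : exists v, u = v :: rev c1 /\ v = a1 /\ reading T = reading T1.
    move: Eu; rewrite reading_cons -cat_cons => /eqP.
    rewrite eqseq_cat; last by rewrite (word_f_size E) /= !size_rev sc.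
    by move=> /andP[/eqP -> /eqP ->]; exists a1.
  case: Ev => Eu' [Ea rT]; subst u v.
  have ET := reading_inj sT (esym rT); subst T1.
  have [cf hh] := col_ins_f cs sc E.
  rewrite !insert_cons -hh !reading_cons; move: cf; rewrite /bump_out -hh.
  have sci : size (col_ins c1 a1) = size (col_ins c a) by rewrite !size_col_ins sc hh.
  move: h; rewrite -cp /bump_out.
  case: ifP => hc; last first.
    by rewrite !cats0 => h cf; rewrite word_f_cat h cf /= sci.
  rewrite wphi_cat word_f_cat => h.
  case: ifP => h1.
    case Ef: (word_f i (rev (col_ins c a))) => [v|] //= [].
    rewrite !cats1 => /rcons_inj[Ev Eb]; subst v; rewrite -Eb.
    rewrite word_f_cat ie ifT ?Ef ?sci //.
    by move: h h1; rewrite /=; lia.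
  rewrite word_f_cons [weps i [::]]/=.
  case: (eqVneq (bumped c a) i) h h1 => [bi h h1|] //.
  have bi1 : i == i.+1 = false by rewrite ltn_eqF.
  move=> /= [] /eqP; rewrite eqseq_cat ?size_rev ?sci //.
  move=> /andP[/eqP/(can_inj revK) ec /eqP[eb]].
  have [h0 h2] : weps i (reading T) = 0 /\ wphi i (rev (col_ins c a)) = 0.
    by move: h h1; rewrite /= ?bi eqxx bi1 /=; lia.
  have [|hf hs] := IH T (bumped c a) (bumped c1 a1) Ts erefl.
    by rewrite word_f_cons h0 bi eqxx eb.
  by rewrite -ec word_f_cat h2 ltn0 hf hs.
case E: (word_f i (reading T)) => [v|] //; rewrite [omap _ _]/= => -[ea] /eqP.
rewrite eqseq_cat ?size_rev // => /andP[/eqP/(can_inj revK) ec /eqP Ev]; subst a1 c1 v.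
rewrite !insert_cons !reading_cons; move: h; rewrite -cp /bump_out.
case: ifP => hc; first rewrite wphi_cat => h.
  have [|hf hs] := IH T1 (bumped c a) (bumped c a) Ts sT.
    by rewrite word_f_cons E ifF //; move: h => /=; lia.
  by rewrite word_f_cat ie hf ifF /= ?hs //; move: h => /=; lia.
by rewrite cats0 word_f_cat => ->; rewrite E /= sT.
Qed.

Lemma Ptab_rev_sorted l : columns_sorted (Ptab_rev l).
Proof. by elim: l => //= a l; apply: insert_sorted. Qed.

Lemma Ptab_rev_sig i l : weps i (reading (Ptab_rev l)) = weps i l /\
  wphi i (reading (Ptab_rev l)) = wphi i l.
Proof.
elim: l => //= a l [IH1 IH2]; have := insert_sig i a (Ptab_rev_sorted l).
by rewrite /= IH1 IH2.
Qed.

Lemma Ptab_rev_f i l l' : word_f i l = Some l' ->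
  word_f i (reading (Ptab_rev l)) = Some (reading (Ptab_rev l')) /\
  map size (Ptab_rev l') = map size (Ptab_rev l).
Proof.
elim: l l' => // a l IH l'; have [e _] := Ptab_rev_sig i l.
rewrite word_f_cons; case: ifP => [h [<-]|h].
  apply: insert_f; rewrite ?Ptab_rev_sorted // word_f_cons e h.
  by case: eqP h => // ->.
case E: (word_f i l) => [u|] //= [<-]; have [IHf IHs] := IH _ E.
by apply: insert_f; rewrite ?Ptab_rev_sorted // word_f_cons e h IHf.
Qed.

(** Insertion commutes with f_i, so the tableau of f_i l depends only on the tableau of l. This
    transports equalities of tableaux along f_i when the words themselves differ. *)
Lemma Ptab_rev_f_eq i l1 l2 l1' l2' : Ptab_rev l1 = Ptab_rev l2 ->
  word_f i l1 = Some l1' -> word_f i l2 = Some l2' -> Ptab_rev l1' = Ptab_rev l2'.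
Proof.
move=> E /Ptab_rev_f[h1 s1] /Ptab_rev_f[h2 s2].
apply: reading_inj; first by rewrite s1 s2 E.
by move: h1; rewrite E h2 => -[].
Qed.

Lemma mult_reading_insert j T a : columns_sorted T ->
  mult j (reading (insert T a)) = mult j (a :: reading T).
Proof.
elim: T a => [|c T IH] a // /andP[cs Ts].
rewrite insert_cons !reading_cons mult_cons !mult_cat /col_ins.
case: ifP => [hc|_]; last by rewrite rev_rcons mult_cons; lia.
rewrite IH // mult_cons.
have [bc _ _] := bumpedP hc.
suff : mult j (rev (sub1 (bumped c a) a c)) + (bumped c a == j) =
       mult j (rev c) + (a == j) by lia.
have uc : uniq c by apply: sorted_uniq cs => [x y z|x] /=; lia.
rewrite /mult !count_rev -/(mult _ _) -/(mult _ _).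
move: bc uc; move: (bumped c a) => b bc; case/splitPr: bc => x y.
rewrite cat_uniq /= => /and3P[_ /norP[bx _] /andP[by_ _]].
rewrite /sub1 map_cat /= eqxx -/(sub1 b a x) -/(sub1 b a y) !sub1_notin //.
by rewrite !mult_cat !mult_cons; lia.
Qed.

Lemma mult_reading_Ptab_rev j l : mult j (reading (Ptab_rev l)) = mult j l.
Proof.
elim: l => //= a l IH; rewrite mult_reading_insert ?Ptab_rev_sorted //.
by rewrite !mult_cons IH.
Qed.

(** * Semistandardness *)

Definition cnt (m : nat) (c : seq nat) := count (leq m) c.

(* For strictly decreasing columns this is entrywise comparison from the bottom. *)
Definition cntle (c d : seq nat) := forall m, cnt m c <= cnt m d.

Lemma cnt_cons m a c : cnt m (a :: c) = (m <= a) + cnt m c. Proof. by []. Qed.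

Lemma cnt0 c : cnt 0 c = size c.
Proof. by rewrite /cnt -count_predT; apply: eq_count => x. Qed.

Lemma leq_cnt m n c : m <= n -> cnt n c <= cnt m c.
Proof. by move=> mn; apply: sub_count => x /=; apply: leq_trans. Qed.

Lemma cnt_nth m c r : sorted gtn c -> (r < cnt m c) = (r < size c) && (m <= nth 0 c r).
Proof.
elim: c r => [|a c IH] r //; rewrite [sorted _ _]/= path_gtnE => /andP[/allP ac cs].
rewrite cnt_cons; have [ma|am] := leqP m a.
  by case: r => [|r] /=; rewrite ?ma // add1n ltnS IH.
have -> : cnt m c = 0.
  apply/eqP; rewrite -leqn0 leqNgt -has_count; apply/hasPn => x /ac /=.
  by rewrite -ltnNge; move/ltn_trans; apply.
case: r => [|r] /=; rewrite addn0 ltn0 ?ltnS; first by rewrite leqNgt am.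
apply/esym/negP => /andP[rc]; have /= := ac _ (mem_nth 0 rc).
by move=> /ltn_trans /(_ am) h; rewrite leqNgt h.
Qed.

Lemma cntleP c d : sorted gtn c -> sorted gtn d -> cntle c d <->
  size c <= size d /\ forall r, r < size c -> nth 0 c r <= nth 0 d r.
Proof.
move=> cs ds; split=> [le|[sz le] m].
  split=> [|r rc]; first by rewrite -!cnt0.
  have : r < cnt (nth 0 c r) d by apply: leq_trans (le _); rewrite cnt_nth // rc leqnn.
  by rewrite cnt_nth // => /andP[].
case E: (cnt m c) => [|k] //.
have := ltnSn k; rewrite -{2}E cnt_nth // => /andP[kc mk].
by rewrite cnt_nth // (leq_trans kc sz) (leq_trans mk) ?le.
Qed.

Lemma cnt_sub1 m x y c : uniq c -> x \in c ->
  cnt m (sub1 x y c) + (m <= x) = cnt m c + (m <= y).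
Proof.
move=> uc xc; case/splitPr: xc uc => u v.
rewrite cat_uniq /= => /and3P[_ /norP[xu _] /andP[xv _]].
rewrite /sub1 map_cat /= eqxx -/(sub1 x y u) -/(sub1 x y v) !sub1_notin //.
by rewrite /cnt !count_cat /=; lia.
Qed.

Lemma sorted_gtn_uniq c : sorted gtn c -> uniq c.
Proof. by apply: sorted_uniq => [x y z|x] /=; lia. Qed.

Lemma cnt_col_ins m c a : sorted gtn c ->
  cnt m (col_ins c a) + (has (geq a) c && (m <= bumped c a)) = cnt m c + (m <= a).
Proof.
move=> cs; rewrite /col_ins; case: ifP => [/bumpedP[bc _ _]|_].
  by rewrite cnt_sub1 // sorted_gtn_uniq.
by rewrite /cnt -cats1 count_cat /=; lia.
Qed.

(** Let b be the letter bumped from d. For m > b the count of c does not grow. For m <= b the count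
    of d is unchanged; if that of c grows, c has no entry in [m, b], so its count at m is its count
    at b+1, and d has strictly more entries >= m than >= b+1 because b lies in d. *)
Lemma cntle_col_ins c d a : sorted gtn c -> sorted gtn d -> cntle c d ->
  has (geq a) d -> cntle (col_ins c (bumped d a)) (col_ins d a).
Proof.
move=> cs ds cd hd m; have := cnt_col_ins m (bumped d a) cs.
have := cnt_col_ins m a ds; rewrite hd /=.
have [bd ba _] := bumpedP hd; move: (bumped d a) bd ba => b bd ba.
have [mb|bm] := leqP m b; last first.
  by have := cd m; case: (m <= a); case: (_ && _); lia.
rewrite (leq_trans mb ba) => E1 E2.
case: (boolP (_ && _)) E2 => [_|nh] E2; first by have := cd m; lia.
have e : cnt m c = cnt b.+1 c.
  apply: eq_in_count => x xc; apply/idP/idP => [mx|]; last by apply: leq_trans; rewrite ltnW.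
  rewrite ltnNge; apply: contra nh => xb; have hb : has (geq b) c by apply/hasP; exists x.
  by rewrite hb; have [_ _ /(_ x xc xb)] := bumpedP hb; apply: leq_trans.
have : cnt b.+1 d < cnt m d.
  case/splitPr: bd => u v; rewrite /cnt !count_cat /= ltnn mb.
  have : count (leq b.+1) u <= count (leq m) u by apply: leq_cnt; rewrite leqW.
  have : count (leq b.+1) v <= count (leq m) v by apply: leq_cnt; rewrite leqW.
  lia.
have := cd b.+1; lia.
Qed.

Fixpoint rows_ok (T : tableau) : Prop :=
  if T is c :: T' then cntle (head [::] T') c /\ rows_ok T' else True.

Lemma head_insert T a : head [::] (insert T a) = col_ins (head [::] T) a.
Proof. by case: T => // c T; rewrite insert_cons. Qed.

Lemma insert_rows_ok T a : columns_sorted T -> rows_ok T -> rows_ok (insert T a).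
Proof.
elim: T a => [|c T IH] a /= ; first by move=> _ _; split=> // m.
rewrite -/(insert (c :: T) a) => /andP[cs Ts] [hc rT]; rewrite insert_cons.
case: ifP => h; last first.
  split=> // m; apply: leq_trans (hc m) _.
  by have := cnt_col_ins m a cs; rewrite h; lia.
split; last exact: IH.
rewrite head_insert; apply: cntle_col_ins => //.
by case: (T) Ts => //= ? ? /andP[].
Qed.

Lemma Ptab_rev_rows_ok l : rows_ok (Ptab_rev l).
Proof. by elim: l => //= a l IH; apply: insert_rows_ok => //; apply: Ptab_rev_sorted. Qed.

Lemma insert_nonempty T a : [::] \notin T -> [::] \notin insert T a.
Proof.
elim: T a => [|c T IH] a //; rewrite insert_cons !inE !negb_or => /andP[c0 T0].
apply/andP; split; last by case: ifP => _ //; apply: IH.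
by case: c c0 => // x c _; rewrite eq_sym -size_eq0 size_col_ins.
Qed.

Lemma Ptab_rev_nonempty l : [::] \notin Ptab_rev l.
Proof. by elim: l => //= a l; apply: insert_nonempty. Qed.

(** The list p holds the letters already placed. The next letter of c is below all of p and at least
    the first entry of d, so it replaces that entry, which goes on to T: inserting a column pushes
    the old first column on as a whole. *)
Lemma foldl_insert (p c d : seq nat) (T : tableau) :
    (forall x y, x \in p -> y \in c -> y < x) -> sorted gtn c ->
    size d <= size c -> (forall r, r < size d -> nth 0 d r <= nth 0 c r) ->
    sorted gtn d ->
  foldl insert ((p ++ d) :: T) c = (p ++ c) :: foldl insert T d.
Proof.
elim: c p d T => [|a c IH] p d T pc cs; first by case: d.
have [ac cs'] : (forall x, x \in c -> x < a) /\ sorted gtn c.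
  by move: cs; rewrite /= path_gtnE => /andP[/allP].
have pa x : x \in p -> a < x by move=> xp; apply: pc; rewrite ?inE ?eqxx.
have pc' x y : x \in rcons p a -> y \in c -> y < x.
  rewrite mem_rcons inE => /orP[/eqP -> /ac //|xp yc].
  by apply: pc; rewrite // inE yc orbT.
have npa : has (geq a) p = false.
  by apply/negbTE/hasPn => x /pa /=; rewrite -ltnNge.
case: d => [|b d] /= sz le ds; rewrite -/(insert (_ :: T) a) insert_cons.
  rewrite /col_ins cats0 npa /= -(cats0 (rcons p a)) IH //.
  by rewrite cat_rcons.
have ba := le 0 isT; rewrite /= in ba.
have [bd ds'] : (forall x, x \in d -> x < b) /\ sorted gtn d.
  by move: ds; rewrite path_gtnE => /andP[/allP].
have h : has (geq a) (p ++ b :: d) by rewrite has_cat npa /= ba.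
have eb : bumped (p ++ b :: d) a = b.
  apply: bumped_eq => //; first by rewrite mem_cat inE eqxx orbT.
  move=> x; rewrite mem_cat inE => /or3P[/pa|/eqP -> //|/bd /ltnW //].
  by rewrite ltnNge => /negP.
rewrite /col_ins h eb /sub1 map_cat /= eqxx -/(sub1 b a p) -/(sub1 b a d).
have bp : b \notin p by apply/negP => /pa; rewrite ltnNge ba.
have bd' : b \notin d by apply/negP => /bd; rewrite ltnn.
rewrite !sub1_notin //.
rewrite -cat_rcons IH ?cat_rcons //.
by move=> r rd; apply: (le r.+1).
Qed.

Lemma foldl_insert_column T c : columns_sorted (c :: T) -> [::] \notin c :: T ->
  rows_ok (c :: T) -> foldl insert T c = c :: T.
Proof.
elim: T c => [|d T IH] c.
  case: c => [|a c] //= /andP[cs _] _ _.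
  rewrite -[[:: a]]/([:: a] ++ [::]) (@foldl_insert [:: a] c [::] [::]) //.
    move=> x y; rewrite inE => /eqP -> yc.
    by move: cs; rewrite path_gtnE => /andP[/allP /(_ _ yc)].
  by move: cs; rewrite path_gtnE => /andP[].
move=> /andP[cs Ts]; rewrite inE negb_or => /andP[c0 T0] [ch rT].
have ds : sorted gtn d by case/andP: Ts.
have [sz le] := (cntleP ds cs).1 ch.
by rewrite -[d]/([::] ++ d) foldl_insert // IH.
Qed.

Lemma Ptab_rev_reading T : columns_sorted T -> [::] \notin T -> rows_ok T ->
  Ptab_rev (reading T) = T.
Proof.
elim: T => // c T IH cTs cT0 crT.
rewrite /Ptab_rev reading_cons foldr_cat -/(Ptab_rev _).
rewrite IH -?foldl_rev ?revK ?foldl_insert_column //.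
- by case/andP: cTs.
- by move: cT0; rewrite inE negb_or => /andP[].
- by case: crT.
Qed.

Definition semistandard (T : tableau) : Prop :=
  [/\ columns_sorted T, [::] \notin T & rows_ok T].

Lemma Ptab_rev_semistandard l : semistandard (Ptab_rev l).
Proof.
by split; [apply: Ptab_rev_sorted|apply: Ptab_rev_nonempty|apply: Ptab_rev_rows_ok].
Qed.

Lemma rows_okP T : columns_sorted T -> rows_ok T <->
  sorted geq (map size T) /\ forall k r, k.+1 < size T -> r < size (nth [::] T k.+1) ->
    nth 0 (nth [::] T k.+1) r <= nth 0 (nth [::] T k) r.
Proof.
elim: T => [|c [|d T] IH]; [by split|by split=> _; split=> // m|].
move=> /andP[cs Ts]; have ds : sorted gtn d by case/andP: Ts.
split=> [[cd /(IH Ts)[sg le]]|[]].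
  have [sz le0] := (cntleP ds cs).1 cd.
  split; first by rewrite /= sz.
  by case=> [|k] r h; [apply: le0|apply: le].
rewrite /= => /andP[sz sg] le.
split; first by apply/cntleP => //; split=> // r; apply: (le 0).
by apply/(IH Ts); split=> // k r; apply: (le k.+1).
Qed.

Lemma all_reading p T : all p (reading T) = all (all p) T.
Proof. by elim: T => //= c T IH; rewrite reading_cons all_cat all_rev IH. Qed.

Lemma SST_semistandard nu T : SST nu T <->
  [/\ semistandard T, all (leq 1) (reading T) &
      forall i, 0 < i -> count (fun c => i <= size c) T = part nu i].
Proof.
rewrite all_reading; split=> [[[h1 h2 h3] h4 h5 h6]|[[h1 h2 h3] h4 h5]].
  by split=> //; split=> //; apply/rows_okP.
by have [h6 h7] := (rows_okP h1).1 h3.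
Qed.

Lemma is_partition_part0 nu i : is_partition nu -> (part nu i.+1 == 0) = (size nu <= i).
Proof.
move=> /andP[_ n0]; rewrite /part /=; case: leqP => [h|h]; first by rewrite nth_default.
by apply/negP => /eqP e; case/negP: n0; rewrite -e mem_nth.
Qed.

Lemma part_inj nu nu' : is_partition nu -> is_partition nu' ->
  (forall i, 0 < i -> part nu i = part nu' i) -> nu = nu'.
Proof.
move=> pn pn' H; have sz : size nu = size nu'.
  apply/eqP; rewrite eqn_leq -!is_partition_part0 //.
  by rewrite H // is_partition_part0 // leqnn -H // is_partition_part0 /=.
by apply: (@eq_from_nth _ 0) => // i _; apply: (H i.+1).
Qed.

Definition shape (T : tableau) : seq nat :=
  [seq count (fun c => i <= size c) T | i <- iota 1 (size (head [::] T))].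

Lemma size_shape T : size (shape T) = size (head [::] T).
Proof. by rewrite size_map size_iota. Qed.

Lemma size_le_head T c : rows_ok T -> c \in T -> size c <= size (head [::] T).
Proof.
elim: T => //= d T IH [dh rT]; rewrite inE => /orP[/eqP -> //|/(IH rT)].
by move/leq_trans; apply; rewrite -!cnt0.
Qed.

Lemma part_shape T i : rows_ok T -> 0 < i ->
  part (shape T) i = count (fun c => i <= size c) T.
Proof.
case: i => // i rT _; rewrite /part /shape /=.
have [h|h] := ltnP i (size (head [::] T)).
  by rewrite (nth_map 0) ?size_iota // nth_iota.
rewrite nth_default ?size_map ?size_iota //; apply/esym/eqP.
rewrite -leqn0 leqNgt -has_count; apply/hasPn => c /(size_le_head rT) cl.
by rewrite -leqNgt (leq_trans cl).
Qed.

Lemma shape_partition T : rows_ok T -> is_partition (shape T).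
Proof.
move=> rT; apply/andP; split.
  apply: (homo_sorted (e := leq)); last exact: iota_sorted.
  by move=> i j ij; apply: sub_count => c /=; apply: leq_trans.
apply/negP => /mapP[i]; rewrite mem_iota => /andP[i0 il] /esym/eqP.
rewrite -leqn0 leqNgt -has_count => /negP; apply; apply/hasP.
case: T il {rT} => [|c T] /=; first by case: i i0.
by rewrite add1n ltnS => ic; exists c; rewrite ?inE ?eqxx.
Qed.

(** * Highest weight tableaux *)

Lemma sorted_iota1 c : sorted gtn c -> all (leq 1) c ->
  (forall y, 0 < y -> y.+1 \in c -> y \in c) -> rev c = iota 1 (size c).
Proof.
move=> cs /allP c1 H.
have Hc x z : x \in c -> 0 < z <= x -> z \in c.
  elim: x => [|x IH] xc; first by case: z.
  move=> /andP[z0]; rewrite leq_eqVlt => /orP[/eqP -> //|]; rewrite ltnS => zx.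
  by apply: IH; rewrite ?z0 // H // (leq_trans z0).
have mc : c =i iota 1 (nth 0 c 0).
  move=> x; rewrite mem_iota add1n ltnS; apply/idP/idP => [xc|/andP[x0 xm]].
    rewrite c1 //=; have : 0 < cnt x c by rewrite -has_count; apply/hasP; exists x.
    by rewrite cnt_nth // => /andP[].
  apply: (Hc (nth 0 c 0)); rewrite ?x0 // mem_nth //.
  by case: c xm {cs c1 H Hc} => //=; rewrite leqn0 => /eqP xx; rewrite xx in x0.
have E : rev c = iota 1 (nth 0 c 0).
  apply: (@irr_sorted_eq _ ltn); rewrite ?rev_sorted ?iota_ltn_sorted //.
  - by move=> x y z; apply: ltn_trans.
  - by move=> x; apply: ltnn.
  by move=> x; rewrite mem_rev.
by rewrite -[in RHS]size_rev {2}E size_iota.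
Qed.

Lemma mult_iota y n : mult y (iota 1 n) = (0 < y <= n).
Proof. by rewrite /mult count_uniq_mem ?iota_uniq // mem_iota add1n ltnS. Qed.

(** The word p reads the earlier columns and contains 1, ..., N equally often. If the next column
    contained y+1 but not y, the prefix ending in this y+1 would have more letters y+1 than y. *)
Lemma hw_columns p N T : semistandard T -> all (leq 1) (reading T) ->
    (forall y, 0 < y -> y < N -> mult y.+1 p = mult y p) ->
    (forall x, x \in head [::] T -> x <= N) ->
    (forall j, 0 < j -> weps j (p ++ reading T) = 0) ->
  forall c, c \in T -> rev c = iota 1 (size c).
Proof.
elim: T p N => // c T IH p N [/andP[cs Ts] T0 [ch rT]].
rewrite reading_cons all_cat all_rev => /andP[c1 r1] hp cN hw.
have Ec : rev c = iota 1 (size c).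
  apply: sorted_iota1 => // y y0 yc; apply: contraT => ync.
  have yN : y < N by apply: cN.
  have : y.+1 \in rev c by rewrite mem_rev.
  case/splitPr E : _ / => [u v].
  have /eqP/weps_eq0P := hw y y0.
  move=> /(_ (p ++ rcons u y.+1) (v ++ reading T)).
  rewrite E -!catA cat_rcons => /(_ erefl).
  rewrite -cats1 !mult_cat !mult_cons !mult_nil eqxx hp //.
  have -> : mult y u = 0.
    apply/count_memPn; apply: contra ync => yu; rewrite -mem_rev E.
    by rewrite mem_cat yu.
  by lia.
move=> d; rewrite inE => /orP[/eqP -> //|dT].
have Tss : semistandard T by split=> //; move: T0; rewrite inE negb_or => /andP[].
apply: (IH (p ++ rev c) (size c) Tss r1) => //.
- move=> y y0 yc; have yN : y < N.
    by apply: cN; rewrite /= -mem_rev Ec mem_iota; lia.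
  by rewrite !mult_cat hp // Ec !mult_iota; lia.
- move=> x xT; have : 0 < cnt x c.
    by apply: leq_trans (ch x); rewrite -has_count; apply/hasP; exists x.
  rewrite -has_count => /hasP[y yc] /leq_trans; apply.
  by move: yc; rewrite -mem_rev Ec mem_iota; lia.
- by move=> j j0; rewrite -catA hw.
Qed.

Lemma hw_columns0 T : semistandard T -> all (leq 1) (reading T) ->
  (forall j, 0 < j -> weps j (reading T) = 0) ->
  forall c, c \in T -> rev c = iota 1 (size c).
Proof.
move=> sT r1; apply: (@hw_columns [::] (\max_(x <- head [::] T) x)) => //.
by move=> x xT; apply: (@leq_bigmax_seq _ _ predT id).
Qed.

Lemma hw_shape T : semistandard T -> all (leq 1) (reading T) ->
  (forall j, 0 < j -> weps j (reading T) = 0) ->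
  forall j, 0 < j -> part (shape T) j = mult j (reading T).
Proof.
move=> sT r1 hw j j0; have H := hw_columns0 sT r1 hw.
rewrite part_shape //; last by case: sT.
elim: T H {sT r1 hw} => // c T IH H.
rewrite reading_cons mult_cat -IH /=; last by move=> d dT; apply: H; rewrite inE dT orbT.
by rewrite H ?inE ?eqxx // mult_iota j0.
Qed.

Lemma sorted_geq_inj s s' : sorted geq s -> sorted geq s' ->
  (forall m, cnt m s = cnt m s') -> s = s'.
Proof.
move=> ss ss' H; apply: (@sorted_eq _ geq) => //.
- by move=> x y z /= h1 h2; apply: leq_trans h1.
- by move=> x y; rewrite /= andbC => /anti_leq.
have E m s0 : mult m s0 + cnt m.+1 s0 = cnt m s0.
  by elim: s0 => // x s0 IH; rewrite mult_cons !cnt_cons; lia.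
rewrite /perm_eq; apply/allP => m _; apply/eqP; rewrite -/(mult m s) -/(mult m s').
by have := E m s; have := E m s'; rewrite !H; lia.
Qed.

(** By [hw_shape] the content is the shape, and the shape determines the columns 1, ..., n. *)
Lemma hw_inj T T' : semistandard T -> semistandard T' ->
    all (leq 1) (reading T) -> all (leq 1) (reading T') ->
    (forall j, 0 < j -> weps j (reading T) = 0) ->
    (forall j, 0 < j -> weps j (reading T') = 0) ->
    (forall j, mult j (reading T) = mult j (reading T')) ->
  T = T'.
Proof.
move=> sT sT' r1 r1' hw hw' H.
have E T0 : semistandard T0 -> all (leq 1) (reading T0) ->
    (forall j, 0 < j -> weps j (reading T0) = 0) ->
    T0 = [seq rev (iota 1 n) | n <- map size T0].
  move=> s0 a0 h0; rewrite -map_comp -[LHS]map_id; apply/eq_in_map => c cT /=.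
  by rewrite -(hw_columns0 s0 a0 h0 cT) revK.
rewrite (E T) // (E T') //; congr map.
have srt T0 : semistandard T0 -> sorted geq (map size T0).
  by case=> h1 _ /(rows_okP h1)[].
apply: sorted_geq_inj; try exact: srt.
have C T0 m : cnt m (map size T0) = count (fun c => m <= size c) T0.
  by rewrite /cnt count_map.
have M m : 0 < m -> cnt m (map size T) = cnt m (map size T').
  move=> m0; rewrite !C -!part_shape //; [|by case: sT'|by case: sT].
  by rewrite !hw_shape.
case=> [|m]; last exact: M.
have Z T0 : semistandard T0 -> cnt 0 (map size T0) = cnt 1 (map size T0).
  case=> _ n0 _; rewrite !C; apply: eq_in_count => c cT.
  by case: c cT n0 => // ->.
by rewrite !Z // M.
Qed.

(** * Increasing subsequences *)

(** The rightmost column. Schensted's theorem, refined by a threshold: [cnt m (first_col l)] is the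
    greatest size of a strictly increasing subsequence of l with entries >= m. *)
Definition first_col (l : seq nat) : seq nat := head [::] (Ptab_rev l).

Lemma first_col_cons a l : first_col (a :: l) = col_ins (first_col l) a.
Proof. exact: head_insert. Qed.

Lemma first_col_sorted l : sorted gtn (first_col l).
Proof. by elim: l => // a l IH; rewrite first_col_cons col_ins_sorted. Qed.

Lemma cnt_split m n b c : m <= b < n -> b \in c -> cnt n c < cnt m c.
Proof.
move=> /andP[mb bn] bc; case/splitPr: bc => u v; rewrite /cnt !count_cat /= mb.
rewrite [n <= b]leqNgt bn /= add0n add1n addnS ltnS -/(cnt _ _).
by apply: leq_add; apply: leq_cnt; rewrite (leq_trans mb) // ltnW.
Qed.

Lemma cnt_gap m n c : m <= n -> (forall x, x \in c -> m <= x -> n <= x) ->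
  cnt m c = cnt n c.
Proof.
move=> mn H; apply: eq_in_count => x xc; apply/idP/idP; first exact: H.
exact: leq_trans.
Qed.

Lemma size_le_first_col (l s : seq nat) m : subseq s l -> sorted ltn s -> all (leq m) s ->
  size s <= cnt m (first_col l).
Proof.
elim: l s m => [|a l IH] s m; first by rewrite subseq0 => /eqP ->.
rewrite first_col_cons; have := cnt_col_ins m a (first_col_sorted l).
set C := first_col l => E; case: s => [|x s] //=.
case: eqP => [-> sl|_ sl] xs /andP[mx ms]; last first.
  have := IH (x :: s) m sl xs; rewrite -/C /= mx => /(_ ms).
  move: E; case: (boolP (has _ _)) => /= h; last by lia.
  by have [_ ba _] := bumpedP h; lia.
have sa : size s <= cnt a.+1 C.
  apply: IH => //; first exact: path_sorted xs.
  by move: xs; rewrite path_sortedE => [/andP[]//|y z t]; apply: ltn_trans.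
rewrite mx in E; case: (boolP (has _ _ && _)) E => [/andP[h mb]|_] /= E; last first.
  by have := leq_cnt C (leqW mx); lia.
have [bc ba _] := bumpedP h.
have : cnt a.+1 C < cnt m C by apply: (cnt_split _ bc); rewrite mb ltnS.
lia.
Qed.

Lemma first_col_subseq (l : seq nat) m : exists s : seq nat,
  [/\ subseq s l, sorted ltn s, all (leq m) s & size s = cnt m (first_col l)].
Proof.
elim: l m => [|a l IH] m; first by exists [::].
rewrite first_col_cons; have := cnt_col_ins m a (first_col_sorted l).
set C := first_col l => E.
have up s : subseq s l -> subseq s (a :: l).
  by move=> sl; apply: subseq_trans sl (subseq_cons _ _).
have keep : cnt m (col_ins C a) = cnt m C -> exists s,
    [/\ subseq s (a :: l), sorted ltn s, all (leq m) s & size s = cnt m (col_ins C a)].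
  by move=> ->; have [s [h1 h2 h3 h4]] := IH m; exists s; split=> //; apply: up.
case: (leqP m a) E => [ma|am] E; last first.
  apply: keep; case: (boolP (has _ _)) E => /= h E; last by lia.
  by have [_ ba _] := bumpedP h; lia.
case: (boolP (has _ _ && _)) E => [_|nh] E; first by apply: keep; lia.
(* The count at m grows, so C has no entry in [m, a]; a longest subsequence above a is then already
   longest for m, and a can be put in front of it. *)
have [s [h1 h2 h3 h4]] := IH a.+1; exists (a :: s); split=> /=.
- by rewrite eqxx.
- by rewrite path_sortedE ?h2 ?andbT // => x y z; apply: ltn_trans.
- by rewrite ma; apply: sub_all h3 => x; apply: leq_trans; rewrite leqW.
rewrite h4 -/C -(@cnt_gap m a.+1) ?leqW //; first by rewrite addn0 addn1 in E.
move=> x xc mx; rewrite ltnNge; apply: contra nh => xa.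
have h : has (geq a) C by apply/hasP; exists x.
by rewrite h; have [_ _ /(_ x xc xa)] := bumpedP h; apply: leq_trans.
Qed.

Lemma first_col_filter m n l : n <= m ->
  cnt m (first_col (filter (leq n) l)) = cnt m (first_col l).
Proof.
move=> nm; apply/eqP; rewrite eqn_leq; apply/andP; split.
  have [s [h1 h2 h3 <-]] := first_col_subseq (filter (leq n) l) m.
  by apply: size_le_first_col => //; apply: subseq_trans h1 (filter_subseq _ _).
have [s [h1 h2 h3 <-]] := first_col_subseq l m.
apply: size_le_first_col => //; rewrite subseq_filter h1 andbT.
by apply: sub_all h3 => x; apply: leq_trans.
Qed.

(** By [Ptab_rev_f] the first column is unchanged or has an i turned into i+1, and only the
    threshold i+1 separates these two letters. *)
Lemma cnt_first_col_f i l l' m : word_f i l = Some l' -> m != i.+1 ->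
  cnt m (first_col l') = cnt m (first_col l).
Proof.
move=> E mi; have [] := Ptab_rev_f E.
have := Ptab_rev_sorted l; rewrite /first_col.
case: (Ptab_rev l) => [|c T]; case: (Ptab_rev l') => [|c' T'] //= /andP[cs _].
rewrite !reading_cons word_f_cat => Ef [sc _].
have [Ec1|-> //] : word_f i (rev c) = Some (rev c') \/ c' = c.
  move: Ef; case: ifP => _.
    case Ec: (word_f i (rev c)) => [u|] //= [] /eqP.
    rewrite eqseq_cat ?(word_f_size Ec) ?size_rev //.
    by move=> /andP[/eqP -> _]; left.
  case: (word_f i (reading T)) => [u|] //= [] /eqP.
  by rewrite eqseq_cat ?size_rev // => /andP[/eqP/(can_inj revK) -> _]; right.
rewrite /cnt -(count_rev _ c') -(count_rev _ c).
move/word_fP: Ec1 => [x [y [-> -> _ _]]]; rewrite !count_cat /=.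
by have -> : (m <= i.+1) = (m <= i) by rewrite leq_eqVlt (negbTE mi).
Qed.

(* If no letter i+1 is unmatched, each i+1 in the first column comes with an i. *)
Lemma cnt_first_col_hw i l : weps i l = 0 ->
  cnt i.+1 (first_col l) = cnt i.+2 (first_col l) \/
  cnt i.+1 (first_col l) < cnt i (first_col l).
Proof.
move=> l0; have cs := first_col_sorted l.
have : weps i (rev (first_col l)) = 0.
  have [e _] := Ptab_rev_sig i l; move: e; rewrite l0 /first_col.
  case: (Ptab_rev l) => [|c T] //=; rewrite reading_cons weps_cat; lia.
have [-> _] := col_sig i cs.
have [ic|nic] := boolP (i.+1 \in _) => /= h; last first.
  left; apply: cnt_gap => // x xc; rewrite leq_eqVlt => /orP[/eqP xi|//].
  by rewrite xi xc in nic.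
right; apply: (@cnt_split _ _ i); first by rewrite leqnn ltnS leqnn.
by case: (_ \in _) h.
Qed.

(** * Operators on matrices *)

Definition sorted_mat (A : mat) : seq (nat * nat) := sort le_kl A.

Definition swap (p : nat * nat) : nat * nat := (p.2, p.1).

Definition tr (A : mat) : mat := seq_mset (map swap A).

(* f_i for i > 0; for i < 0 it is conjugated by transposition. *)
Definition fr (i : nat) (A : mat) : option mat :=
  omap (fun u => seq_mset (zip (word_k A) u)) (word_f i (word_l A)).

Lemma le_kl_total : total le_kl.
Proof. move=> [a b] [c d]; rewrite /le_kl /=; lia. Qed.

Lemma le_kl_trans : transitive le_kl.
Proof. move=> [a b] [c d] [e f]; rewrite /le_kl /=; lia. Qed.

Lemma le_kl_anti : antisymmetric le_kl.
Proof.
move=> [a b] [c d]; rewrite /le_kl /= => H.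
by have [-> ->] : a = c /\ b = d by lia.
Qed.

Lemma trE (A : mat) i j : tr A (i, j) = A (j, i).
Proof.
rewrite mset_seqE count_map -count_mem_mset; apply: eq_count => -[a b] /=.
by rewrite !xpair_eqE andbC.
Qed.

Lemma trK : involutive tr.
Proof. by move=> A; apply/msetP => -[i j]; rewrite !trE. Qed.

Lemma sorted_mat_sorted A : sorted le_kl (sorted_mat A).
Proof. exact/sort_sorted/le_kl_total. Qed.

Lemma perm_sorted_mat A : perm_eq (sorted_mat A) A.
Proof. by rewrite /sorted_mat perm_sort. Qed.

Lemma sorted_mat_seq s : sorted le_kl s -> sorted_mat (seq_mset s) = s.
Proof.
move=> ss; apply: (sorted_eq le_kl_trans le_kl_anti (sorted_mat_sorted _) ss).
by rewrite (perm_trans (perm_sorted_mat _)) // perm_eq_seq_mset.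
Qed.

Lemma seq_sorted_mat A : seq_mset (sorted_mat A) = A.
Proof. by rewrite -[RHS]seq_mset_id; apply/eq_seq_msetP/perm_sorted_mat. Qed.

Lemma sorted_mat_tr A : sorted_mat (tr A) = map swap (sort le_ij A).
Proof.
apply: (sorted_eq le_kl_trans le_kl_anti (sorted_mat_sorted _)).
  rewrite sorted_map (eq_sorted (e' := le_ij)) //.
  apply: sort_sorted => -[a b] [c d]; rewrite /le_ij /=; lia.
rewrite (perm_trans (perm_sorted_mat _)) // (perm_trans (perm_eq_seq_mset _)) //.
by rewrite perm_map // perm_sym perm_sort.
Qed.

Lemma map_swap_zip s t : map swap (zip s t) = zip t s.
Proof. by elim: s t => [|a s IH] [|b t] //=; rewrite IH. Qed.

Lemma tr_seq s : tr (seq_mset s) = seq_mset (map swap s).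
Proof. by apply/eq_seq_msetP; rewrite perm_map // perm_eq_seq_mset. Qed.

Lemma f_pos i A : 0 < i -> f i%:Z A = fr i A.
Proof. by case: i. Qed.

Lemma f_neg i A : 0 < i -> f (- i%:Z)%R A = omap tr (fr i (tr A)).
Proof.
case: i => // i _; rewrite -NegzE /= /fr.
have -> : word_l (tr A) = word_i A.
  by rewrite /word_l -/(sorted_mat _) sorted_mat_tr /unzip2 -map_comp.
have -> : word_k (tr A) = word_j A.
  by rewrite /word_k -/(sorted_mat _) sorted_mat_tr /unzip1 -map_comp.
by case: (word_f _ _) => //= u; rewrite tr_seq map_swap_zip.
Qed.

Lemma zip_unzip_mid (x y : seq (nat * nat)) k i j :
  zip (unzip1 (x ++ (k, i) :: y)) (unzip2 x ++ j :: unzip2 y) = x ++ (k, j) :: y.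
Proof.
elim: x => [|[a b] x IH] /=; last by rewrite IH.
by congr cons; elim: y => //= -[a b] y ->.
Qed.

Lemma unzip2_split (s : seq (nat * nat)) x' j y' : unzip2 s = x' ++ j :: y' ->
  exists x k y, [/\ s = x ++ (k, j) :: y, unzip2 x = x' & unzip2 y = y'].
Proof.
elim: x' s => [|b x' IH] [|[a c] s] //= [-> E].
  by exists [::], a, s.
by have [x [k [y [-> <- <-]]]] := IH _ E; exists ((a, b) :: x), k, y.
Qed.

Lemma sorted_kl_pairwise s : sorted le_kl s = pairwise le_kl s.
Proof. exact: (sorted_pairwise le_kl_trans). Qed.

Lemma sorted_kl_cat x q y : sorted le_kl (x ++ q :: y) =
  [&& sorted le_kl x, sorted le_kl y, all (le_kl^~ q) x, all (le_kl q) y & 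
      all (fun p => all (le_kl p) y) x].
Proof.
rewrite !sorted_kl_pairwise pairwise_cat /= allrel_consr -!andbA.
rewrite /allrel; case: (all (le_kl^~ q) x) => /=; rewrite ?andbF //.
by case: (pairwise le_kl x); case: (all (le_kl q) y); case: (pairwise le_kl y);
  rewrite /= ?andbF ?andbT.
Qed.

(** Within a row the letters decrease, so the changed pair must be the first copy of (k, i). An
    earlier copy would be followed in x by copies of itself only, and its i would survive, against
    [wphi i (unzip2 x) = 0]. *)
Lemma sorted_f_kl i k x y : sorted le_kl (x ++ (k, i) :: y) ->
  wphi i (unzip2 x) = 0 -> sorted le_kl (x ++ (k, i.+1) :: y).
Proof.
rewrite !sorted_kl_cat => /and5P[xs ys /allP xk /allP ky ->] x0.
rewrite xs ys andbT /=; apply/andP; split; apply/allP => p; last first.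
  by move/ky; rewrite /le_kl /=; lia.
move=> xp; have := xk _ xp; have : p != (k, i).
  apply/eqP => E; subst p; case/splitPr: xp xs xk x0 => x1 x2.
  rewrite sorted_kl_cat => /and5P[_ _ _ /allP x2k _] xk /eqP/wphi_eq0P.
  rewrite /unzip2 map_cat => /(_ _ _ erefl); rewrite mult_cons eqxx.
  suff -> : mult i.+1 (map snd ((k, i) :: x2)) = 0 by [].
  apply/count_memPn/negP => /mapP[q]; rewrite inE => /orP[/eqP -> /=|qx]; first by lia.
  have := x2k _ qx; have := xk q; rewrite mem_cat inE qx !orbT => /(_ isT).
  by rewrite /le_kl /=; lia.
by case: p {xp} => a b; rewrite xpair_eqE /le_kl /=; lia.
Qed.

Lemma sorted_e_kl i k x y : sorted le_kl (x ++ (k, i.+1) :: y) ->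
  weps i (unzip2 y) = 0 -> sorted le_kl (x ++ (k, i) :: y).
Proof.
rewrite !sorted_kl_cat => /and5P[xs ys /allP xk /allP ky ->] y0.
rewrite xs ys andbT /=; apply/andP; split; apply/allP => p.
  by move/xk; rewrite /le_kl /=; lia.
move=> yp; have := ky _ yp; have : p != (k, i.+1).
  apply/eqP => E; subst p; case/splitPr: yp ys ky y0 => y1 y2.
  rewrite sorted_kl_cat => /and5P[_ _ /allP y1k _ _] ky /eqP/weps_eq0P.
  rewrite /unzip2 map_cat /= -cat_rcons => /(_ _ _ erefl).
  rewrite -cats1 !mult_cat !mult_cons eqxx.
  suff -> : mult i (map snd y1) = 0 by rewrite !mult_nil; lia.
  apply/count_memPn/negP => /mapP[q qx].
  have := y1k _ qx; have := ky q; rewrite mem_cat inE qx => /(_ isT).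
  by rewrite /le_kl /=; lia.
by case: p {yp} => a b; rewrite xpair_eqE /le_kl /=; lia.
Qed.

Lemma word_lE A : word_l A = unzip2 (sorted_mat A). Proof. by []. Qed.

Lemma frP i A B : fr i A = Some B <-> exists k x y,
  [/\ sorted_mat A = x ++ (k, i) :: y, sorted_mat B = x ++ (k, i.+1) :: y,
      wphi i (unzip2 x) = 0 & weps i (unzip2 y) = 0].
Proof.
split=> [|[k [x [y [EA EB x0 y0]]]]].
  rewrite /fr; case E: (word_f i (word_l A)) => [u|] // [<-].
  have [x' [y' [El Eu x0 y0]]] := (word_fP _ _ _).1 E.
  have [x [k [y [EA Ex Ey]]]] := unzip2_split (El : unzip2 (sorted_mat A) = _).
  exists k, x, y; rewrite Ex Ey; split=> //.
  have -> : zip (word_k A) u = x ++ (k, i.+1) :: y.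
    by rewrite /word_k -/(sorted_mat A) EA Eu -Ex -Ey zip_unzip_mid.
  apply: sorted_mat_seq; apply: sorted_f_kl; last by rewrite Ex.
  by rewrite -EA sorted_mat_sorted.
rewrite /fr; have -> : word_f i (word_l A) = Some (unzip2 x ++ i.+1 :: unzip2 y).
  apply/word_fP; exists (unzip2 x), (unzip2 y); split=> //.
  by rewrite /word_l -/(sorted_mat A) EA /unzip2 map_cat.
by rewrite /= /word_k -/(sorted_mat A) EA zip_unzip_mid -EB seq_sorted_mat.
Qed.

Lemma fr_word i A B : fr i A = Some B -> word_f i (word_l A) = Some (word_l B).
Proof.
case/frP=> k [x [y [EA EB x0 y0]]]; apply/word_fP; exists (unzip2 x), (unzip2 y).
by rewrite !word_lE EA EB /unzip2 !map_cat.
Qed.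

(** The operator e_i on matrices is used only in this form, as a preimage under f_i. *)
Lemma er_exists i A : 0 < weps i (word_l A) -> exists B, fr i B = Some A.
Proof.
move=> /weps_gt0P[x' [y' [El x0 y0]]].
have [x [k [y [EA Ex Ey]]]] := unzip2_split (El : unzip2 (sorted_mat A) = _).
exists (seq_mset (x ++ (k, i) :: y)); apply/frP; exists k, x, y; rewrite Ex Ey; split=> //.
apply: sorted_mat_seq; apply: sorted_e_kl; last by rewrite Ey.
by rewrite -EA sorted_mat_sorted.
Qed.

Lemma fr_isSome i A : (fr i A : bool) = (0 < wphi i (word_l A)).
Proof. by rewrite /fr -word_f_isSome; case: (word_f _ _). Qed.

(** * Height functions *)

Definition low (i m : nat) (s : seq (nat * nat)) : nat :=
  count (fun p => (p.2 == i) && (p.1 < m)) s.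

Arguments low : simpl never.

Lemma low_cat i m s t : low i m (s ++ t) = low i m s + low i m t.
Proof. exact: count_cat. Qed.

Lemma low_cons i m p s : low i m (p :: s) = ((p.2 == i) && (p.1 < m)) + low i m s.
Proof. by []. Qed.

Lemma low_perm i m s t : perm_eq s t -> low i m s = low i m t.
Proof. by move/permP; apply. Qed.

Lemma leq_low i m n s : m <= n -> low i m s <= low i n s.
Proof. by move=> mn; apply: sub_count => p /= /andP[-> /leq_trans]; apply. Qed.

Lemma low_le_mult i m (s : seq (nat * nat)) : low i m s <= mult i (unzip2 s).
Proof. by rewrite /mult count_map; apply: sub_count => p /= /andP[]. Qed.

Lemma low_all i m (s : seq (nat * nat)) : (forall p, p \in s -> p.2 = i -> p.1 < m) ->
  low i m s = mult i (unzip2 s).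
Proof.
move=> H; rewrite /mult count_map; apply: eq_in_count => p ps /=.
by case: eqP => //= /(H p ps).
Qed.

Lemma low_none i m (s : seq (nat * nat)) : (forall p, p \in s -> p.2 = i -> m <= p.1) ->
  low i m s = 0.
Proof.
move=> H; apply/eqP; rewrite -leqn0 leqNgt -has_count; apply/hasPn => p ps.
by apply/negP => /andP[/eqP e]; rewrite ltnNge H.
Qed.

Lemma filter_prefix (Q : pred (nat * nat)) s : sorted le_kl s ->
  (forall p q, le_kl p q -> Q q -> Q p) -> s = filter Q s ++ filter (predC Q) s.
Proof.
move=> ss H; elim: s ss => // p s IH ps /=.
have ss : sorted le_kl s by apply: path_sorted ps.
case: ifP => Qp /=; first by rewrite -IH.
have nQ q : q \in s -> Q q = false.
  move: ps; rewrite /= (path_sortedE le_kl_trans) => /andP[/allP pq _] qs.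
  by apply: contraFF Qp; apply: H; apply: pq.
rewrite (eq_in_filter (a2 := pred0)) ?filter_pred0 //=; congr cons.
by rewrite -[LHS]filter_predT; apply: eq_in_filter => q qs /=; rewrite nQ.
Qed.

Definition before_kl (i m : nat) : pred (nat * nat) := fun p => le_kl p (m, i.+1).

Lemma before_kl_split i m s : sorted le_kl s ->
  s = filter (before_kl i m) s ++ filter (predC (before_kl i m)) s.
Proof. by move=> ss; apply: filter_prefix => // p q; apply: le_kl_trans. Qed.

Lemma mult_before_kl i m (s : seq (nat * nat)) :
  mult i (unzip2 (filter (before_kl i m) s)) = low i m s /\
  mult i.+1 (unzip2 (filter (before_kl i m) s)) = low i.+1 m.+1 s.
Proof.
rewrite /mult !count_map !count_filter.
by split; apply: eq_count => -[a b]; rewrite /before_kl /le_kl /=; lia.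
Qed.

Lemma low_prefix i m (s : seq (nat * nat)) : sorted le_kl s -> weps i (unzip2 s) = 0 ->
  low i.+1 m.+1 s <= low i m s.
Proof.
move=> ss /eqP/weps_eq0P; have [<- <-] := mult_before_kl i m s; apply.
by rewrite [in LHS](before_kl_split i m ss) /unzip2 map_cat.
Qed.

Lemma low_suffix i m (s : seq (nat * nat)) : sorted le_kl s -> wphi i (unzip2 s) = 0 ->
  mult i (unzip2 s) + low i.+1 m.+1 s <= mult i.+1 (unzip2 s) + low i m s.
Proof.
move=> ss /eqP/wphi_eq0P H; have [e1 e2] := mult_before_kl i m s.
set s1 := unzip2 (filter (before_kl i m) s) in e1 e2.
set s2 := unzip2 (filter (predC (before_kl i m)) s).
have E : unzip2 s = s1 ++ s2 by rewrite [in LHS](before_kl_split i m ss) /unzip2 map_cat.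
by have := H _ _ E; rewrite -e1 -e2 E !mult_cat; lia.
Qed.

(** The excess of letters i over letters i+1 in the prefix that ends just before the letters i of
    row m. As each row decreases, the least excess over all prefixes is attained at such a
    prefix. *)
Definition height (i : nat) (A : mat) (m : nat) : int :=
  ((low i m A)%:Z - (low i.+1 m.+1 A)%:Z)%R.

Lemma low_sorted_mat i m (A : mat) : low i m A = low i m (sorted_mat A).
Proof. by apply: low_perm; rewrite perm_sym perm_sorted_mat. Qed.

Lemma lowS i m (A : mat) : low i m.+1 A = low i m A + A (m, i).
Proof.
rewrite -count_mem_mset; elim: (enum_mset A) => //= -[a b] s IH.
by rewrite !low_cons IH /= xpair_eqE; lia.
Qed.

Lemma heightS i A m : height i A m.+1 = (height i A m + (A (m, i))%:Z - (A (m.+1, i.+1))%:Z)%R.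
Proof. by rewrite /height lowS (lowS i.+1); lia. Qed.

(* The operator f_i acts in the last row where the height is minimal. *)
Definition f_row (i : nat) (A : mat) (k : nat) : Prop :=
  (forall m, m < k -> (height i A k <= height i A m)%R) /\
  (forall m, k < m -> (height i A k < height i A m)%R).

Lemma f_row_uniq i A k k' : f_row i A k -> f_row i A k' -> k = k'.
Proof.
move=> [h1 h2] [h3 h4]; case: (ltngtP k k') => // h.
  by have := h2 _ h; have := h3 _ h; lia.
by have := h1 _ h; have := h4 _ h; lia.
Qed.

(** The leftmost surviving i comes right after the last prefix of minimal excess: [low_suffix]
    controls the heights before it and [low_prefix] those after it. *)
Lemma frP_row i A B : fr i A = Some B -> exists k,
  f_row i A k /\ forall p, B p + (p == (k, i)) = A p + (p == (k, i.+1)).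
Proof.
case/frP=> k [x [y [EA EB x0 y0]]]; exists k; split; last first.
  move=> p; rewrite -[A]seq_sorted_mat -[B]seq_sorted_mat EA EB !mset_seqE.
  by rewrite !count_cat /= ![_ == p]eq_sym; lia.
have := sorted_mat_sorted A; rewrite EA sorted_kl_cat.
move=> /and5P[xs ys /allP xk /allP ky _].
have hL j m : low j m A = low j m x + ((i == j) && (k < m)) + low j m y.
  by rewrite low_sorted_mat EA low_cat low_cons addnA.
have xr p : p \in x -> p.1 <= k by move/xk; case: p => a b; rewrite /le_kl /=; lia.
have yr p : p \in y -> k <= p.1 by move/ky; case: p => a b; rewrite /le_kl /=; lia.
have yi : low i.+1 k.+1 y = 0 by apply: low_none => p /ky; case: p => a b; rewrite /le_kl /=; lia.
have yk : low i k y = 0 by apply: low_none => p /yr.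
have xk1 m : k <= m -> low i.+1 m.+1 x = mult i.+1 (unzip2 x).
  by move=> km; apply: low_all => p /xr; rewrite ltnS => /leq_trans h _; apply: h.
have ii : (i == i.+1) = false by apply: ltn_eqF.
rewrite /f_row /height !hL eqxx ltnn ii yi yk xk1 //=.
split=> m h; rewrite !hL eqxx ii /=.
  have -> : low i m y = 0 by apply: low_none => p /yr kp _; apply: leq_trans kp; apply: ltnW.
  have -> : low i.+1 m.+1 y = 0.
    by apply: low_none => p /yr kp _; apply: leq_trans kp.
  have -> : (k < m) = false by rewrite ltnNge ltnW.
  by have := low_suffix m xs x0; have := low_le_mult i k x; lia.
have := low_prefix m ys y0; have := leq_low i x (ltnW h).
rewrite xk1; last exact: ltnW.
by rewrite h; lia.
Qed.

(** In a row M beyond the support the height is the total excess. If f_i were undefined,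
    [low_suffix] would bound this by the height at k. *)
Lemma fr_exists i A k : (forall m, k < m -> (height i A k < height i A m)%R) ->
  exists B, fr i A = Some B.
Proof.
move=> H; case E: (fr i A) => [B|]; first by exists B.
have := fr_isSome i A; rewrite E => /esym/negbT; rewrite -eqn0Ngt => /eqP w0.
have := low_suffix k (sorted_mat_sorted A) w0.
pose M := maxn k.+1 (\max_(p <- sorted_mat A) p.1).+1.
have hM j m : M <= m -> low j m A = mult j (unzip2 (sorted_mat A)).
  rewrite low_sorted_mat geq_max => /andP[_ hm]; apply: low_all => p pA _.
  by apply: leq_trans hm; rewrite ltnS; apply: (@leq_bigmax_seq _ _ predT (fun p => p.1)).
have := H M (leq_maxl _ _).
by rewrite /height (hM i M (leqnn M)) (hM i.+1 M.+1 (leqnSn M)) -!low_sorted_mat; lia.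
Qed.

Lemma weps_height i A : weps i (word_l A) = 0 <-> forall m, (0 <= height i A m)%R.
Proof.
split=> [h m|H].
  have := low_prefix m (sorted_mat_sorted A) h.
  by rewrite -!low_sorted_mat /height; lia.
case: (posnP (weps i (word_l A))) => // /er_exists[B /frP[k [x [y [EB EA x0 y0]]]]].
have := sorted_mat_sorted A; rewrite EA sorted_kl_cat.
move=> /and5P[xs ys /allP xk /allP ky _].
have := H k; rewrite /height !low_sorted_mat EA !low_cat !low_cons /=.
have -> : low i k y = 0.
  by apply: low_none => p /ky; case: p => a b; rewrite /le_kl /=; lia.
have -> : low i.+1 k.+1 x = mult i.+1 (unzip2 x).
  by apply: low_all => p /xk; case: p => a b; rewrite /le_kl /=; lia.
have := low_le_mult i k x.
have := (wphi_eq0P i (unzip2 x)); rewrite x0 => /elimT/(_ erefl)/(_ [::] _ erefl).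
by rewrite eqxx ltnSn /= ; lia.
Qed.

(** * The two commuting crystal structures *)

Definition fl (i : nat) (A : mat) : option mat := omap tr (fr i (tr A)).

Lemma fl_tr i A : fl i (tr A) = omap tr (fr i A).
Proof. by rewrite /fl trK. Qed.

Lemma fr_tr i A : fr i (tr A) = omap tr (fl i A).
Proof. by rewrite /fl; case: (fr _ _) => //= B; rewrite trK. Qed.

Definition moves (q q' : nat * nat) (A B : mat) : Prop :=
  forall p, B p + (p == q) = A p + (p == q').

Lemma moves_tr i j k l A B : moves (i, j) (k, l) A B -> moves (j, i) (l, k) (tr A) (tr B).
Proof.
move=> H [a b]; rewrite !trE; have := H (b, a); rewrite !xpair_eqE.
by rewrite ![(b == _) && _]andbC.
Qed.

Lemma frP_moves i A B : fr i A = Some B ->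
  exists k, f_row i A k /\ moves (k, i) (k, i.+1) A B.
Proof. exact: frP_row. Qed.

Lemma flP_moves i A B : fl i A = Some B ->
  exists c, f_row i (tr A) c /\ moves (i, c) (i.+1, c) A B.
Proof.
rewrite /fl; case E: (fr i (tr A)) => [C|] // [<-].
have [c [rc H]] := frP_moves E; exists c; split=> //.
by have := moves_tr H; rewrite trK.
Qed.

Lemma moves_low q q' (A B : mat) j m : moves q q' A B ->
  low j m B + ((q.2 == j) && (q.1 < m)) = low j m A + ((q'.2 == j) && (q'.1 < m)).
Proof.
move=> H; rewrite addnC [RHS]addnC -!low_cons; apply: low_perm.
rewrite /perm_eq; apply/allP => p _; apply/eqP => /=.
by have := H p; rewrite -!count_mem_mset ![_ == p]eq_sym addnC [RHS]addnC.
Qed.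

(** The height j of A from i to i+1 and the height i of the transpose from j to j+1 have the same
    increment A (i, j) - A (i+1, j+1). Since c is the last minimum of the latter, this gives the
    inequalities in the last two cases. *)
Lemma moves_height i c (A B : mat) j : f_row i (tr A) c -> moves (i, c) (i.+1, c) A B ->
  [\/ (forall m, height j B m = height j A m) /\ (c != j),
      [/\ c = j, (height j A i < height j A i.+1)%R &
          forall m, height j B m = (height j A m - (m == i.+1)%:Z)%R] |
      [/\ c = j.+1, (height j A i.+1 <= height j A i)%R &
          forall m, height j B m = (height j A m + (m == i)%:Z)%R]].
Proof.
move=> [h1 h2] H; have := heightS i (tr A) j; rewrite !trE.
have := heightS j A i; move: (A (i, j)) (A (i.+1, j.+1)) => x y h4 h3.
have E m : height j B m = (height j A m - ((c == j) && (m == i.+1))%:Z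
                           + ((c == j.+1) && (m == i))%:Z)%R.
  have /= l1 := moves_low j m H; have /= l2 := moves_low j.+1 m.+1 H.
  rewrite /height; move: l1 l2.
  by case: (eqVneq c j) => [->|_]; rewrite ?(ltn_eqF (ltnSn _)) /=;
    case: (c == j.+1) => /=; lia.
have [cj|cj] := eqVneq c j.
  apply: Or32; split=> //; first by have := h2 j.+1; rewrite cj => /(_ (ltnSn j)); lia.
  by move=> m; rewrite E cj eqxx (ltn_eqF (ltnSn _)) addr0.
have [cj1|cj1] := eqVneq c j.+1.
  apply: Or33; split=> //; first by have := h1 j; rewrite cj1 => /(_ (ltnSn j)); lia.
  by move=> m; rewrite E cj1 eqxx (gtn_eqF (ltnSn _)) subr0.
by apply: Or31; split=> // m; rewrite E (negbTE cj) (negbTE cj1) addr0 subr0.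
Qed.

Lemma moves_weps i c (A B : mat) j : f_row i (tr A) c -> moves (i, c) (i.+1, c) A B ->
  (forall m, (0 <= height j A m)%R) <-> (forall m, (0 <= height j B m)%R).
Proof.
move=> rc mv; move: (height j A) (height j B) (moves_height j rc mv) => g h.
case=> [[E _]|[_ gi E]|[_ gi E]].
- by split=> H m; have := H m; rewrite E.
- split=> H m; last by have := H m; rewrite E; lia.
  rewrite E; have := H m; have := H i.
  by case: (eqVneq m i.+1) => [->|_] /=; lia.
split=> H m; first by have := H m; rewrite E; lia.
have := H m; have := H i.+1; rewrite !E (gtn_eqF (ltnSn i)).
by case: (eqVneq m i) => [->|_] /=; lia.
Qed.

Lemma fr_existsP i A : (exists B, fr i A = Some B) <->
  exists k, forall m, k < m -> (height i A k < height i A m)%R.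
Proof.
split=> [[B /frP_row[k [[_ H] _]]]|[k H]]; first by exists k.
exact: fr_exists H.
Qed.

Lemma moves_wphi i c (A B : mat) j : f_row i (tr A) c -> moves (i, c) (i.+1, c) A B ->
  (exists C, fr j A = Some C) <-> (exists C, fr j B = Some C).
Proof.
move=> rc mv; rewrite !fr_existsP.
move: (height j A) (height j B) (moves_height j rc mv) => g h.
case=> [[E _]|[_ gi E]|[_ gi E]].
- by split=> -[k H]; exists k => m /H; rewrite !E.
- have Ei : h i = g i by rewrite E (ltn_eqF (ltnSn _)) subr0.
  have Ei1 : h i.+1 = (g i.+1 - 1)%R by rewrite E eqxx.
  have Em m : m != i.+1 -> h m = g m by move=> /negbTE n; rewrite E n subr0.
  split=> -[k H].
    have [ki|ki] := eqVneq k i.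
      subst k; have [h2|h2] := leP (g i + 2)%R (g i.+1).
        exists i => m im; have [->|/Em ->] := eqVneq m i.+1; first by lia.
        by have := H m im; lia.
      (* The height at i+1 has dropped to that at i, so i no longer lies strictly below all later
         heights, but i+1 does. *)
      exists i.+1 => m im; rewrite Ei1 (Em m) ?(gtn_eqF im) //.
      by have := H m (ltnW im); lia.
    exists k => m km; have hk : (h k <= g k)%R by rewrite E; lia.
    have [mi|/Em ->] := eqVneq m i.+1; last by have := H m km; lia.
    rewrite mi Ei1; have := H i; have -> : k < i by lia.
    by move=> /(_ isT); lia.
  have [ki|ki] := eqVneq k i.+1.
    exists i => m im; have [->|mi] := eqVneq m i.+1; first by [].
    have := H m; rewrite ki Ei1 (Em m mi); have -> : i.+1 < m by lia.
    by move=> /(_ isT); lia.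
  by exists k => m km; have := H m km; rewrite (Em k ki) E; lia.
have Ei : h i = (g i + 1)%R by rewrite E eqxx.
have Em m : m != i -> h m = g m by move=> /negbTE n; rewrite E n addr0.
have Ei1 : h i.+1 = g i.+1 by apply: Em; rewrite (gtn_eqF (ltnSn i)).
split=> -[k H].
  have ki : k != i by apply/eqP => ki; have := H i.+1; rewrite ki ltnSn => /(_ isT); lia.
  by exists k => m km; have := H m km; rewrite (Em k ki) E; lia.
have ki : k != i.
  by apply/eqP => ki; have := H i.+1; rewrite ki ltnSn Ei Ei1 => /(_ isT); lia.
exists k => m km; have := H m km; rewrite (Em k ki).
have [mi|/Em -> //] := eqVneq m i; move=> _.
have := H i.+1; rewrite (Em k ki) Ei1 mi; have -> : k < i.+1 by lia.
by move=> /(_ isT); lia.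
Qed.

(** The last minimum moves only if it was at i and the height at i+1, which drops by one, becomes
    equal to it; the increment of the height at i turns this into the condition on the two
    entries. *)
Lemma moves_f_row i c (A B : mat) j k : f_row i (tr A) c ->
    moves (i, c) (i.+1, c) A B -> f_row j A k ->
  f_row j B (if [&& c == j, k == i & A (i, j) == (A (i.+1, j.+1)).+1] then i.+1 else k).
Proof.
move=> rc mv; rewrite /f_row; have := heightS j A i.
move: (A (i, j)) (A (i.+1, j.+1)) => x y dS.
move: (height j A) (height j B) dS (moves_height j rc mv) => g h dS.
case=> [[E ncj]|[cj gi E]|[cj gi E]] [H1 H2].
- by rewrite (negbTE ncj) /=; split=> m mk; rewrite !E; [apply: H1|apply: H2].
- have Ei : h i = g i by rewrite E (ltn_eqF (ltnSn _)) subr0.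
  have Ei1 : h i.+1 = (g i.+1 - 1)%R by rewrite E eqxx.
  have Em m : m != i.+1 -> h m = g m by move=> /negbTE n; rewrite E n subr0.
  rewrite cj eqxx /=; have [ki|ki] := eqVneq k i.
    subst k; have [/eqP e|/eqP ne] := boolP (x == _).
      have gg : g i.+1 = (g i + 1)%R by lia.
      split=> m im; rewrite Ei1 gg.
        rewrite Em ?(ltn_eqF im) //.
        by move: im; rewrite ltnS leq_eqVlt => /orP[/eqP ->|/H1]; lia.
      by rewrite Em ?(gtn_eqF im) //; have := H2 m (ltnW im); lia.
    split=> m im; rewrite Ei.
      by rewrite Em; [apply: H1|rewrite ltn_eqF // ltnW].
    have [mi|mi] := eqVneq m i.+1; first by rewrite mi Ei1; lia.
    by rewrite Em //; apply: H2.
  rewrite /=; have ki1 : k != i.+1.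
    by apply/eqP => ki1; have := H1 i; rewrite ki1 ltnSn => /(_ isT); lia.
  rewrite (Em _ ki1); split=> m mk.
    have [mi|mi] := eqVneq m i.+1; last by rewrite Em //; apply: H1.
    rewrite mi Ei1; have := H1 i; have -> : i < k by lia.
    by move=> /(_ isT); lia.
  have [mi|mi] := eqVneq m i.+1; last by rewrite Em //; apply: H2.
  rewrite mi Ei1; have := H2 i; have -> : k < i by lia.
  by move=> /(_ isT); lia.
rewrite cj (gtn_eqF (ltnSn j)) /=.
have ki : k != i by apply/eqP => ki; have := H2 i.+1; rewrite ki ltnSn => /(_ isT); lia.
have Ek : h k = g k by rewrite E (negbTE ki) addr0.
by split=> m mk; rewrite Ek E; [have := H1 m mk|have := H2 m mk]; lia.
Qed.

Lemma mat_ext (A B : mat) : (forall p, A p = B p) -> A = B.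
Proof. by move=> H; apply/msetP. Qed.

(** The exceptional condition of [moves_f_row] is symmetric in the two operators. When it holds,
    both orders carry one unit from (i, j) to (i+1, j+1), through (i+1, j) or (i, j+1); otherwise
    neither operator alters the place where the other acts. *)
Lemma fr_fl_comm i j A A1 A2 : fl i A = Some A1 -> fr j A = Some A2 ->
  exists B, fr j A1 = Some B /\ fl i A2 = Some B.
Proof.
move=> El Er; have [c [rc mc]] := flP_moves El; have [k [rk mk]] := frP_moves Er.
have [B1 E1] : exists C, fr j A1 = Some C.
  by apply/(moves_wphi j rc mc); exists A2.
have rk' : f_row j (tr (tr A)) k by rewrite trK.
have mk' := moves_tr mk.
have [C2 E2] : exists C, fr i (tr A2) = Some C.
  apply/(moves_wphi i rk' mk'); rewrite fr_tr El; by exists (tr A1).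
have [k' [rk1 mk1]] := frP_moves E1; have [c' [rc1 mc1]] := frP_moves E2.
have := f_row_uniq rk1 (moves_f_row rc mc rk).
have := f_row_uniq rc1 (moves_f_row rk' mk' rc); rewrite !trE.
have -> : [&& k == i, c == j & A (i, j) == (A (i.+1, j.+1)).+1] =
  [&& c == j, k == i & A (i, j) == (A (i.+1, j.+1)).+1] by rewrite andbCA.
move=> ec ek; exists B1; split=> //; rewrite /fl E2 /=; congr Some.
have mc2 := moves_tr mc1; rewrite trK in mc2.
apply: mat_ext => p; have := mc p; have := mk p; have := mk1 p; have := mc2 p.
rewrite ek ec; case: ifP => [/and3P[/eqP -> /eqP -> _]|_]; lia.
Qed.

Lemma fl_weps i j A B : fl i A = Some B ->
  weps j (word_l A) = 0 <-> weps j (word_l B) = 0.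
Proof.
move=> /flP_moves[c [rc mc]]; rewrite !weps_height; exact: moves_weps rc mc.
Qed.

Lemma fl_exists i j A B : fl i A = Some B ->
  (exists C, fr j A = Some C) <-> (exists C, fr j B = Some C).
Proof. by move=> /flP_moves[c [rc mc]]; apply: moves_wphi rc mc. Qed.

Lemma fr_fl_exists i j A B : fr j A = Some B ->
  (exists C, fl i A = Some C) <-> (exists C, fl i B = Some C).
Proof.
move=> E; have E' : fl j (tr A) = Some (tr B) by rewrite fl_tr E.
have := fl_exists i E'; rewrite !fr_tr.
have X A0 : (exists C, omap tr (fl i A0) = Some C) <-> (exists C, fl i A0 = Some C).
  case: (fl i A0) => [D|]; last by split=> -[].
  by split=> _; [exists D|exists (tr D)].
by rewrite !X.
Qed.

(** * Symmetric matrices *)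

Lemma moves_count q q' (A B : mat) (Q : pred (nat * nat)) : moves q q' A B ->
  count Q B + Q q = count Q A + Q q'.
Proof.
move=> H; rewrite addnC [RHS]addnC -!/(count Q (_ :: _)); apply/permP.
rewrite /perm_eq; apply/allP => p _; apply/eqP => /=.
by have := H p; rewrite -!count_mem_mset ![_ == p]eq_sym addnC [RHS]addnC.
Qed.

Lemma mult_word_l j (A : mat) : mult j (word_l A) = count (fun p => p.2 == j) A.
Proof.
rewrite word_lE /mult count_map; have /permP -> := perm_sorted_mat A.
exact: eq_count.
Qed.

Lemma M_tr A : M A -> M (tr A).
Proof. by move=> H i j; rewrite trE => /H[]. Qed.

Lemma all1P w : all (leq 1) w = (mult 0 w == 0).
Proof. by elim: w => // -[|a] w IH; rewrite mult_cons //= IH. Qed.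

Lemma M_word_l A : M A -> all (leq 1) (word_l A).
Proof.
move=> MA; rewrite word_lE all_map; apply/allP => -[a b].
by rewrite (perm_mem (perm_sorted_mat A)) -mset_neq0 => /MA[].
Qed.

Lemma fr_M i A B : 0 < i -> fr i A = Some B -> M A <-> M B.
Proof.
move=> i0 /frP_moves[k [_ H]].
have e1 := H (k, i); have e2 := H (k, i.+1).
rewrite !xpair_eqE !eqxx (ltn_eqF (ltnSn i)) (gtn_eqF (ltnSn i)) /= in e1 e2.
split=> MA a b ab.
  have k0 : 0 < k.
    have nz : A (k, i) != 0 by rewrite -[A _]addn0 -e1 addn1.
    by have [] := MA _ _ nz.
  case: (eqVneq (a, b) (k, i.+1)) => [[-> ->] //|n]; apply: MA.
  by have := H (a, b); rewrite (negbTE n) addn0 => <-; rewrite addn_eq0 negb_and ab.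
have k0 : 0 < k.
  have nz : B (k, i.+1) != 0 by rewrite -[B _]addn0 e2 addn1.
  by have [] := MA _ _ nz.
case: (eqVneq (a, b) (k, i)) => [[-> ->] //|n]; apply: MA.
by have := H (a, b); rewrite (negbTE n) addn0 => ->; rewrite addn_eq0 negb_and ab.
Qed.

Lemma fl_M i A B : 0 < i -> fl i A = Some B -> M A <-> M B.
Proof.
rewrite /fl => i0; case E: (fr i (tr A)) => [C|] // [<-].
have [h1 h2] := fr_M i0 E.
by split=> H; [apply/M_tr/h1/M_tr|rewrite -[A]trK; apply/M_tr/h2; rewrite -[C]trK; apply/M_tr].
Qed.

(** If the positions differed, the letters i strictly between them would be at most as many as the
    letters i+1, because [wphi i x'] vanishes, and more numerous, because [weps i y] vanishes. *)
Lemma f_position_inj i (x y x' y' : seq nat) : size x <= size x' -> weps i y = 0 ->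
    wphi i x' = 0 -> x ++ i.+1 :: y = x' ++ i.+1 :: y' ->
  x ++ i :: y = x' ++ i :: y'.
Proof.
move=> le y0 x0' E.
have Ex : x = take (size x) x'.
  have := congr1 (take (size x)) E; rewrite take_size_cat // => {1}->.
  move: le; rewrite take_cat leq_eqVlt => /orP[/eqP e|-> //].
  by rewrite e ltnn subnn take0 cats0 take_size.
have [z Ez] : exists z, x' = x ++ z by exists (drop (size x) x'); rewrite {1}Ex cat_take_drop.
subst x'; case: z {le Ex} E x0' => [|a z].
  by rewrite cats0 => /eqP; rewrite eqseq_cat // eqxx => /eqP[->].
rewrite -catA => /eqP; rewrite eqseq_cat // eqxx /= => /eqP[<- Ey].
move=> /eqP/wphi_eq0P/(_ (rcons x i.+1) z); rewrite cat_rcons => /(_ erefl).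
move/eqP/weps_eq0P: y0 => /(_ (rcons z i.+1) y'); rewrite cat_rcons => /(_ Ey).
rewrite -cats1 !mult_cat !mult_cons eqxx (gtn_eqF (ltnSn i)) !mult_nil; lia.
Qed.

Lemma word_f_inj i u v w : word_f i u = Some w -> word_f i v = Some w -> u = v.
Proof.
move=> /word_fP[x [y [-> -> x0 y0]]] /word_fP[x' [y' [-> E x0' y0']]].
case: (leqP (size x) (size x')) => [h|/ltnW h]; first exact: f_position_inj.
by symmetry; apply: f_position_inj.
Qed.

Lemma fr_word_k i A B : fr i A = Some B -> word_k B = word_k A.
Proof.
case/frP=> k [x [y [EA EB _ _]]].
by rewrite /word_k -/(sorted_mat A) -/(sorted_mat B) EA EB /unzip1 !map_cat.
Qed.

Lemma fr_inj i A A' B : fr i A = Some B -> fr i A' = Some B -> A = A'.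
Proof.
move=> E E'; have := word_f_inj (fr_word E) (fr_word E').
have := fr_word_k E; rewrite (fr_word_k E') => e1 e2.
rewrite -[A]seq_sorted_mat -[A']seq_sorted_mat; congr seq_mset.
have Z (s : seq (nat * nat)) : s = zip (unzip1 s) (unzip2 s).
  by elim: s => //= -[a b] s {1}->.
rewrite [LHS]Z [RHS]Z -!word_lE e2; congr zip; exact: esym.
Qed.

(** * Invariance of the tableau under f_{-i} *)

Lemma hw_dec (w : seq nat) :
  (exists j, 0 < j /\ 0 < weps j w) \/ (forall j, 0 < j -> weps j w = 0).
Proof.
have [|H] := pselect (exists j, 0 < j /\ 0 < weps j w); [by left|right=> j j0].
by case: (posnP (weps j w)) => // h; case: H; exists j.
Qed.

Lemma kappa_hw A : M A -> (forall j, 0 < j -> weps j (word_l A) = 0) ->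
  [/\ semistandard (kappa A), all (leq 1) (reading (kappa A)) &
      forall j, 0 < j -> weps j (reading (kappa A)) = 0].
Proof.
move=> MA hw; rewrite kappaE; split; first exact: Ptab_rev_semistandard.
  by rewrite all1P mult_reading_Ptab_rev -all1P M_word_l.
by move=> j j0; have [-> _] := Ptab_rev_sig j (word_l A); apply: hw.
Qed.

(** The operator f_{-i} preserves highest weight for the f_j with j > 0, and it preserves the column
    sums, which determine the tableau by [hw_inj]. *)
Lemma kappa_fl_hw i A B : 0 < i -> M A -> fl i A = Some B ->
  (forall j, 0 < j -> weps j (word_l A) = 0) -> kappa B = kappa A.
Proof.
move=> i0 MA E hw; have MB : M B by apply/(fl_M i0 E).
have hwB j : 0 < j -> weps j (word_l B) = 0 by move=> j0; apply/(fl_weps j E)/hw.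
have [h1 h2 h3] := kappa_hw MA hw; have [h1' h2' h3'] := kappa_hw MB hwB.
apply: hw_inj => // j; rewrite !kappaE !mult_reading_Ptab_rev !mult_word_l.
have [c [_ mc]] := flP_moves E.
by have /= /addIn := moves_count (fun p => p.2 == j) mc.
Qed.

(* The operators f_j and f_{-i} commute, so that A can be raised to a highest  *)
(* weight for the column crystal, where the tableau is determined by the       *)
(* column sums.                                                                *)
Lemma kappa_fl i A B : 0 < i -> M A -> fl i A = Some B -> kappa B = kappa A.
Proof.
move=> i0; move: {2}(sumn (word_l A)) (leqnn (sumn (word_l A))) => n.
elim: n A B => [|n IH] A B; (have [[j [j0 /er_exists[A0 E0]]]|hw] := hw_dec (word_l A));
  try by move=> _ MA E; apply: kappa_fl_hw E hw.
  by rewrite (word_f_sumn (fr_word E0)).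
rewrite (word_f_sumn (fr_word E0)) ltnS => sz MA E.
have MA0 : M A0 by apply/(fr_M j0 E0).
have [C EC] : exists C, fl i A0 = Some C by apply/(fr_fl_exists i E0); exists B.
have [D [ED1 ED2]] := fr_fl_comm EC E0.
move: ED2; rewrite E => -[?]; subst D.
have := IH _ _ sz MA0 EC; rewrite !kappaE => EP.
exact: Ptab_rev_f_eq EP (fr_word ED1) (fr_word E0).
Qed.

(** * The operators F_i and their inverses on symmetric matrices *)

Lemma F_pos e i A : 0 < i -> F e i A = obind (fr i) (fl i A).
Proof.
move=> i0; rewrite /F (gtn_eqF i0) f_neg // -/(fl i A).
by case: (fl i A) => // B; apply: f_pos.
Qed.

Lemma Mhat_sym e A : Mhat e A <->
  [/\ M A, tr A = A & forall k, 0 < k -> e %| A (k, k)].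
Proof.
split=> [[MA [sA dA]]|[MA sA dA]].
  split=> //; apply: mat_ext => -[i j]; rewrite trE.
  have Z k l : ~~ ((0 < k) && (0 < l)) -> A (k, l) = 0.
    by move=> kl; apply/eqP; apply: contraNT kl => /MA[-> ->].
  case: (boolP ((0 < i) && (0 < j))) => [/andP[i0 j0]|h]; first by rewrite sA.
  by rewrite !Z // andbC.
by split=> //; split=> // i j _ _; rewrite -{1}sA trE.
Qed.

Lemma F_sym e i A B : 0 < i -> tr A = A -> F e i A = Some B -> tr B = B.
Proof.
move=> i0 sA; rewrite F_pos //; case E: (fl i A) => [C|] //= E2.
have Er : fr i A = Some (tr C) by rewrite -{1}sA fr_tr E.
have [B' [E3 E4]] := fr_fl_comm E Er.
move: E3 E4; rewrite E2 => -[<-]; rewrite fl_tr E2 /= => -[]; exact.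
Qed.

(* Unless both operators act on the diagonal, F_i changes diagonal entries by  *)
(* 0 or 2; in the exceptional case it exchanges A (i,i) and A (i+1,i+1).       *)
Lemma F_diag e e' i A B : e = 1 \/ e = 2 -> 0 < i -> tr A = A -> F e' i A = Some B ->
  (forall k, 0 < k -> e %| A (k, k)) <-> (forall k, 0 < k -> e %| B (k, k)).
Proof.
move=> [->|->] i0 sA; first by move=> _; split=> _ k _; apply: dvd1n.
rewrite F_pos //; case E: (fl i A) => [C|] // E2.
have [c [rc mc]] := flP_moves E; have rc' := rc; rewrite sA in rc'.
have [k' [rk mk]] := frP_moves E2.
have := f_row_uniq rk (moves_f_row rc mc rc').
have [/and3P[/eqP ci _ /eqP Ad] ek|_ ek] := ifP; subst k'.
  subst c.
  have key k : B (k, k) = if k == i then A (i.+1, i.+1) else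
      if k == i.+1 then A (i, i) else A (k, k).
    have := mc (k, k); have := mk (k, k); rewrite !xpair_eqE.
    have [->|ki] := eqVneq k i.
      move: (A (i, i)) (A (i.+1, i.+1)) (B (i, i)) (C (i, i)) Ad.
      by move=> x y z t xy; rewrite (ltn_eqF (ltnSn i)) /=; lia.
    have [->|ki1] := eqVneq k i.+1.
      by move: Ad => ->; move: (A _) (B _) (C _) => x y z; rewrite /=; lia.
    by move: (A _) (B _) (C _) => x y z; rewrite /=; lia.
  split=> H k k0; first by rewrite key; case: ifP => _; [|case: ifP => _]; apply: H.
  have [ki|ki] := eqVneq k i.
    by have := H i.+1 isT; rewrite key (gtn_eqF (ltnSn i)) eqxx ki.
  have [ki1|ki1] := eqVneq k i.+1.
    by have := H i i0; rewrite key eqxx ki1.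
  by have := H k k0; rewrite key (negbTE ki) (negbTE ki1).
have key k : B (k, k) + 2 * ((k == i) && (k == c)) = A (k, k) + 2 * ((k == i.+1) && (k == c)).
  have := mc (k, k); have := mk (k, k); rewrite !xpair_eqE.
  by move: (A _) (B _) (C _) => x y z; lia.
have dvd2D x (y : bool) : 2 %| x + 2 * y = (2 %| x) by rewrite dvdn_addl ?dvdn_mulr.
by split=> H k k0; have := H k k0; rewrite -(dvd2D _ ((k == i) && (k == c))) key dvd2D
  || rewrite -(dvd2D _ ((k == i.+1) && (k == c))) -key dvd2D.
Qed.

Lemma F_Mhat e i A B : e = 1 \/ e = 2 -> 0 < i -> F e i A = Some B -> Mhat e A -> Mhat e B.
Proof.
move=> he i0 E /Mhat_sym[MA sA dA]; apply/Mhat_sym; split.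
- move: E; rewrite F_pos //; case E: (fl i A) => [C|] //= E2.
  by apply/(fr_M i0 E2)/(fl_M i0 E).
- exact: F_sym E.
- exact: (F_diag he i0 sA E).1 dA.
Qed.

Lemma F_exists e i A C : 0 < i -> tr A = A -> fr i A = Some C -> exists B, F e i A = Some B.
Proof.
move=> i0 sA E; have El : fl i A = Some (tr C) by rewrite -sA fl_tr E.
rewrite F_pos // El /=; apply/(fl_exists i El); by exists C.
Qed.

Lemma kappa_F e i A B : 0 < i -> M A -> F e i A = Some B ->
  exists l, Ptab_rev l = kappa A /\ word_f i l = Some (word_l B).
Proof.
move=> i0 MA; rewrite F_pos //; case E: (fl i A) => [C|] //= E2.
exists (word_l C); rewrite -kappaE; split; first exact: kappa_fl MA E.
exact: fr_word.
Qed.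

(** By symmetry e_{-i} A is the transpose of e_i A, and f_{-i} does not change whether e_i applies,
    so both operators can be undone. *)
Lemma E_exists e i A : e = 1 \/ e = 2 -> 0 < i -> Mhat e A -> 0 < weps i (word_l A) ->
  exists B, Mhat e B /\ F e i B = Some A.
Proof.
move=> he i0 /Mhat_sym[MA sA dA] eA.
have [B' E1] := er_exists eA.
have El : fl i (tr B') = Some A by rewrite fl_tr E1 /= sA.
have [D ED] : exists D, fr i D = Some (tr B').
  apply: er_exists; rewrite lt0n; apply/eqP => /(fl_weps i El).
  by move: eA; rewrite lt0n => /eqP.
have EB : fl i (tr D) = Some B' by rewrite fl_tr ED /= trK.
have EF : F e i (tr D) = Some A by rewrite F_pos // EB.
(* By commutation both D and its transpose are preimages of the transpose of [B'] under the
   injective f_i. *)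
have sD : tr (tr D) = tr D.
  have [B2 E2] : exists B2, fr i (tr D) = Some B2 by apply/(fl_exists i EB); exists A.
  have [A' [E3 E4]] := fr_fl_comm EB E2; move: E3; rewrite E1 => -[?]; subst A'.
  have E5 : fr i (tr B2) = Some A by rewrite fr_tr E4 /= sA.
  have B2B := fr_inj E5 E1; apply: (fr_inj _ E2).
  by rewrite trK ED -B2B trK.
exists (tr D); split=> //; apply/Mhat_sym; split=> //.
  by apply/(fl_M i0 EB)/(fr_M i0 E1).
exact: (F_diag he i0 sD EF).2 dA.
Qed.

(** Only f_i changes the multiset of column indices. This sum is the measure for the inductions that
    undo the F_i. *)
Lemma F_sumn e i A B : 0 < i -> M A -> F e i A = Some B ->
  sumn (word_l B) = (sumn (word_l A)).+1.
Proof.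
move=> i0 MA; rewrite F_pos //; case E: (fl i A) => [C|] //= E2.
rewrite (word_f_sumn (fr_word E2)); congr _.+1.
have [c [_ mc]] := flP_moves E.
have /(perm_big _) e1 : perm_eq (word_l C) (word_l A).
  rewrite /perm_eq; apply/allP => j _; apply/eqP.
  rewrite -!/(mult j _) !mult_word_l.
  by have /= /addIn := moves_count (fun p => p.2 == j) mc.
by rewrite !sumnE e1.
Qed.

(** * Shapes of the tableaux of symmetric matrices *)

Lemma shape_size T T' : map size T = map size T' -> shape T = shape T'.
Proof.
move=> E; rewrite /shape; have -> : size (head [::] T) = size (head [::] T').
  by case: T T' E => [|c T] [|c' T'] //= [].
apply: eq_map => i; transitivity (cnt i (map size T)); first by rewrite /cnt count_map.
by rewrite E /cnt count_map.
Qed.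

Lemma Ptab_rev_all1 w : all (leq 1) w -> all (leq 1) (reading (Ptab_rev w)).
Proof. by rewrite !all1P mult_reading_Ptab_rev. Qed.

(** Induction on the row i. For i <= j, column j is zero above row i, so the nonnegative height at i
    forces A (i, j+1) = 0; symmetry gives the other half. *)
Lemma sym_hw_diag A : M A -> tr A = A -> (forall j, 0 < j -> weps j (word_l A) = 0) ->
  forall i j, i != j -> A (i, j) = 0.
Proof.
move=> MA sA hw.
have up : forall i j, i < j -> A (i, j) = 0.
  elim/ltn_ind => i IH [|j] // ij.
  have [j0|j0] := posnP j.
    apply/eqP; apply: contraT => /MA[i0 _]; move: ij; rewrite j0 ltnS leqn0.
    by move=> /eqP ei; rewrite ei in i0.
  have := (weps_height j A).1 (hw j j0) i; rewrite /height.
  have -> : low j i A = 0.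
    apply/eqP; rewrite -leqn0 leqNgt -has_count; apply/hasPn => -[a b] ab /=.
    apply/negP => /andP[/eqP bj ai]; move: ab; rewrite -mset_neq0 bj IH //.
    exact: leq_trans ai ij.
  rewrite lowS; move: (A _) (low _ _ _) => x y; lia.
by move=> i j; rewrite neq_ltn => /orP[/up //|ji]; rewrite -sA trE up.
Qed.

Lemma shape_dvd e A : e = 1 \/ e = 2 -> Mhat e A ->
  forall j, 0 < j -> e %| part (shape (kappa A)) j.
Proof.
move=> he; move: {2}(sumn (word_l A)) (leqnn (sumn (word_l A))) => n.
elim: n A => [|n IH] A sz HA; have := HA => /Mhat_sym[MA sA dA].
all: have [[i [i0 ei]]|hw] := hw_dec (word_l A).
1,3: have [B [HB EB]] := E_exists he i0 HA ei.
1,2: have /Mhat_sym[MB sB dB] := HB; have sz' := F_sumn i0 MB EB.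
- by rewrite sz' in sz.
- move=> j j0; have [l [El Ef]] := kappa_F i0 MB EB.
  have [_ es] := Ptab_rev_f Ef.
  by rewrite kappaE (shape_size es) El IH // -ltnS -sz'.
all: move=> j j0; have [h1 h2 h3] := kappa_hw MA hw.
all: rewrite hw_shape // kappaE mult_reading_Ptab_rev mult_word_l.
all: have -> : count (fun p => p.2 == j) A = A (j, j).
1,3: rewrite -count_mem_mset; apply: eq_in_count => -[a b] ab /=; rewrite xpair_eqE.
1,2: have [->|ne] := eqVneq a b; first by case: (b == j).
1,2: by move: ab; rewrite -mset_neq0 sym_hw_diag.
all: exact: dA.
Qed.

Definition diag_mat (s : seq nat) : mat := seq_mset [seq (x, x) | x <- s].

Lemma diag_matE s i j : diag_mat s (i, j) = if i == j then mult i s else 0.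
Proof.
rewrite mset_seqE count_map; case: eqP => [<-|ij].
  by apply: eq_count => x /=; rewrite xpair_eqE andbb.
apply/eqP; rewrite -leqn0 leqNgt -has_count; apply/hasPn => x _ /=.
by rewrite xpair_eqE; apply/negP => /andP[/eqP xi /eqP xj]; apply: ij; rewrite -xi.
Qed.

Lemma count_diag_mat (Q : pred (nat * nat)) s : count Q (diag_mat s) = count (fun x => Q (x, x)) s.
Proof. by have /permP -> := perm_eq_seq_mset [seq (x, x) | x <- s]; rewrite count_map. Qed.

Lemma kappa_diag_mat T : semistandard T -> all (leq 1) (reading T) ->
    (forall j, 0 < j -> weps j (reading T) = 0) ->
  M (diag_mat (reading T)) /\ kappa (diag_mat (reading T)) = T.
Proof.
move=> sT r1 hw; set A := diag_mat _.
have MA : M A.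
  move=> i j; rewrite diag_matE; case: (eqVneq i j) => // <-.
  by rewrite -lt0n -has_count => /hasP[x /(allP r1) x1 /eqP <-]; split.
have hwA j : 0 < j -> weps j (word_l A) = 0.
  move=> j0; apply/weps_height => m; rewrite /height.
  have L k n : low k n A = if k < n then mult k (reading T) else 0.
    rewrite /low count_diag_mat; case: ifP => kn.
      by apply: eq_count => x /=; case: eqP => // ->.
    apply/eqP; rewrite -leqn0 leqNgt -has_count; apply/hasPn => x _ /=.
    by apply/negP => /andP[/eqP ->]; rewrite kn.
  rewrite !L ltnS; case: ifP => // _.
  have := weps_wphi j (reading T); rewrite hw //; lia.
split=> //; have [h1 h2 h3] := kappa_hw MA hwA.
apply: hw_inj => // j; rewrite kappaE mult_reading_Ptab_rev mult_word_l.
by rewrite count_diag_mat.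
Qed.

(** Raise w to highest weight, where a diagonal matrix has the required tableau. On the way back,
    equal tableaux have equal signatures, so f_i, and with it F_i, is defined on the matrix and
    yields the tableau of the lowered word. *)
Lemma kappa_surj e w : e = 1 \/ e = 2 -> all (leq 1) w ->
    (forall j, 0 < j -> e %| part (shape (Ptab_rev w)) j) ->
  exists2 A, Mhat e A & kappa A = Ptab_rev w.
Proof.
move=> he; move: {2}(sumn w) (leqnn (sumn w)) => n.
elim: n w => [|n IH] w sz w1 dw.
all: have [[i [i0 /weps_gt0P[x [y [Ew x0 y0]]]]]|hw] := hw_dec w.
1,3: have Ef : word_f i (x ++ i :: y) = Some w by (apply/word_fP; exists x, y).
1,2: have sz' := word_f_sumn Ef; have [_ es] := Ptab_rev_f Ef.
- by rewrite sz' in sz.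
- have [||j j0|A HA EA] := IH (x ++ i :: y).
  + by rewrite -ltnS -sz'.
  + by move: w1; rewrite Ew !all_cat /= => /andP[-> ->]; rewrite i0.
  + by rewrite -(shape_size es) dw.
  have /Mhat_sym[MA sA _] := HA.
  have [C EC] : exists C, fr i A = Some C.
    have : fr i A; last by case: (fr i A) => // C; exists C.
    have [_ e1] := Ptab_rev_sig i (word_l A); have [_ e2] := Ptab_rev_sig i (x ++ i :: y).
    by rewrite fr_isSome -e1 -kappaE EA e2 -word_f_isSome Ef.
  have [B EB] := F_exists e i0 sA EC.
  have [l [El Ef2]] := kappa_F i0 MA EB.
  exists B; first exact: F_Mhat EB HA.
  by rewrite kappaE; apply: (Ptab_rev_f_eq _ Ef2 Ef); rewrite El EA.
all: have sT := Ptab_rev_semistandard w; have r1 := Ptab_rev_all1 w1.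
all: have hT j : 0 < j -> weps j (reading (Ptab_rev w)) = 0.
1,3: by move=> j0; have [-> _] := Ptab_rev_sig j w; apply: hw.
all: have [MA kA] := kappa_diag_mat sT r1 hT.
all: exists (diag_mat (reading (Ptab_rev w))) => //.
all: apply/Mhat_sym; split=> //.
1,3: by apply: mat_ext => -[i j]; rewrite trE !diag_matE eq_sym; case: eqP => // ->.
all: by move=> j j0; rewrite diag_matE eqxx -hw_shape ?dw.
Qed.

(** * Demazure steps *)

Definition col_bounded (c : nat -> nat) (A : mat) : Prop :=
  forall m, 0 < m -> cnt m (first_col (word_l A)) <= c m.

(* If cl and cr count the elements >= m of I and J, these are the matrices all *)
(* of whose strict chains fit in the partition with Frobenius data (I, J).     *)
Definition bounded (cl cr : nat -> nat) : set mat :=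
  [set A | [/\ M A, col_bounded cr A & col_bounded cl (tr A)]].

Lemma bounded_tr cl cr A : bounded cl cr (tr A) <-> bounded cr cl A.
Proof.
split=> -[MA h1 h2]; split; rewrite ?trK //; last exact: M_tr.
  by rewrite -[A]trK; apply: M_tr.
by rewrite trK in h2.
Qed.

(** If c counts the elements >= m of a set that contains i but not i+1, then c' counts those of the
    set with i replaced by i+1. *)
Definition shifts (i : nat) (c c' : nat -> nat) : Prop :=
  [/\ forall m, c' m = c m + (m == i.+1), c i = (c i.+1).+1 & c i.+1 = c i.+2].

(** Only the count at i+1 changes, and it is at most the count at i, hence at most c i = c (i+1). *)
Lemma col_bounded_fr i c A B : fr i A = Some B -> 0 < i -> c i = c i.+1 ->
  col_bounded c A <-> col_bounded c B.
Proof.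
move=> /fr_word E i0 ci.
split=> H m m0; (have [->|mi] := eqVneq m i.+1; last by
  have := H m m0; rewrite (cnt_first_col_f E mi)).
  rewrite -ci; apply: leq_trans (H i i0); rewrite -(cnt_first_col_f E (_ : i != i.+1)).
    exact: leq_cnt.
  by rewrite (ltn_eqF (ltnSn i)).
rewrite -ci; apply: leq_trans (H i i0); rewrite (cnt_first_col_f E (_ : i != i.+1)).
  exact: leq_cnt.
by rewrite (ltn_eqF (ltnSn i)).
Qed.

Lemma col_bounded_fl i c A B : fl i A = Some B -> 0 < i -> M A ->
  col_bounded c A <-> col_bounded c B.
Proof.
move=> E i0 MA; have := kappa_fl i0 MA E; rewrite !kappaE => EP.
by rewrite /col_bounded /first_col EP.
Qed.

(** The bounds differ at i+1 only. By [cnt_first_col_hw] the count there equals the one at i+2,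
    where c (i+2) = c (i+1), or is below the one at i, where c i = c (i+1) + 1. *)
Lemma col_bounded_hw i c c' A : 0 < i -> shifts i c c' -> weps i (word_l A) = 0 ->
  col_bounded c' A -> col_bounded c A.
Proof.
move=> i0 [ec ci ci1] hw H m m0; have := H m m0; rewrite ec.
have [->|_] := eqVneq m i.+1; last by rewrite addn0.
move=> _; have [->|lt] := cnt_first_col_hw hw.
  by have := H i.+2 isT; rewrite ec ci1 (gtn_eqF (ltnSn i.+1)) addn0.
have := H i i0; rewrite ec (ltn_eqF (ltnSn i)) addn0 ci => le.
by rewrite -ltnS (leq_trans lt).
Qed.

Lemma col_bounded_leq c c' A : (forall m, c m <= c' m) -> col_bounded c A -> col_bounded c' A.
Proof. by move=> le H m m0; apply: leq_trans (le m); apply: H. Qed.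

Lemma shifts_leq i c c' m : shifts i c c' -> c m <= c' m.
Proof. by case=> -> _ _; apply: leq_addr. Qed.

Lemma shifts_eq i c c' : shifts i c c' -> c' i = c' i.+1.
Proof. by case=> ec ci _; rewrite !ec eqxx (ltn_eqF (ltnSn i)) ci addn0 addn1. Qed.

Lemma bounded_fr i cl cr A B : 0 < i -> cr i = cr i.+1 -> fr i A = Some B ->
  bounded cl cr A <-> bounded cl cr B.
Proof.
move=> i0 ci E; have [m1 m2] := fr_M i0 E; have [c1 c2] := col_bounded_fr E i0 ci.
have El : fl i (tr A) = Some (tr B) by rewrite fl_tr E.
split=> -[MA h1 h2].
  split; [exact: m1|exact: c1|apply/(col_bounded_fl cl El i0 (M_tr MA)) => //].
split; [exact: m2|exact: c2|apply/(col_bounded_fl cl El i0) => //].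
by apply/M_tr/m2.
Qed.

Lemma bounded_fl i cl cr A B : 0 < i -> cl i = cl i.+1 -> fl i A = Some B ->
  bounded cl cr A <-> bounded cl cr B.
Proof.
move=> i0 ci E; have E' : fr i (tr A) = Some (tr B) by rewrite fr_tr E.
by have := bounded_fr cr i0 ci E'; rewrite !bounded_tr.
Qed.

Lemma iterS_obind (T : Type) (g : T -> option T) n x y z :
  iter n (obind g) (Some x) = Some y -> g y = Some z ->
  iter n.+1 (obind g) (Some x) = Some z.
Proof. by move=> E; rewrite iterS E. Qed.

Lemma iter_obind_inv (T : Type) (g : T -> option T) (Q : T -> Prop) n x y :
    (forall u v, g u = Some v -> Q u -> Q v) ->
  Q x -> iter n (obind g) (Some x) = Some y -> Q y.
Proof.
move=> H Qx; elim: n y => [|n IH] y; first by move=> [<-].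
rewrite iterS; case E: (iter n _ _) => [u|] //= Ey.
exact: H Ey (IH _ E).
Qed.

(** Undo f_i until [weps] vanishes; then the smaller bound holds. Conversely, the larger bound is
    stable under f_i. *)
Lemma bounded_step_r i cl cr cr' : 0 < i -> shifts i cr cr' -> forall A,
  bounded cl cr' A <->
  exists n B, bounded cl cr B /\ iter n (obind (fr i)) (Some B) = Some A.
Proof.
move=> i0 sh A; split=> [|[n [B [HB]]]]; last first.
  apply: (iter_obind_inv (Q := bounded cl cr')).
    by move=> u v /(bounded_fr cl i0 (shifts_eq sh)) ->.
  case: HB => h1 h2 h3; split=> //; apply: col_bounded_leq h2 => m.
  exact: shifts_leq sh.
move: {2}(sumn (word_l A)) (leqnn (sumn (word_l A))) => k.
elim: k A => [|k IH] A sz HA; have [hw|/er_exists[B EB]] := posnP (weps i (word_l A)).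
- by exists 0, A; split=> //; case: HA => h1 h2 h3; split=> //; apply: (col_bounded_hw i0 sh).
- by have := word_f_sumn (fr_word EB); lia.
- by exists 0, A; split=> //; case: HA => h1 h2 h3; split=> //; apply: (col_bounded_hw i0 sh).
have [||n [C [HC EC]]] := IH B; first by have := word_f_sumn (fr_word EB); lia.
  exact/(bounded_fr cl i0 (shifts_eq sh) EB).
by exists n.+1, C; split=> //; apply: iterS_obind EC EB.
Qed.

Lemma iter_fl i n A : iter n (obind (fl i)) (Some A) =
  omap tr (iter n (obind (fr i)) (Some (tr A))).
Proof.
elim: n => [|n IH]; first by rewrite /= trK.
by rewrite !iterS IH; case: (iter n _ _) => //= B; rewrite fl_tr.
Qed.

Lemma bounded_step_l i cl cr cl' : 0 < i -> shifts i cl cl' -> forall A,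
  bounded cl' cr A <->
  exists n B, bounded cl cr B /\ iter n (obind (fl i)) (Some B) = Some A.
Proof.
move=> i0 sh A; rewrite -bounded_tr (bounded_step_r cr i0 sh).
split=> -[n [B [HB E]]]; exists n, (tr B); split; try exact/bounded_tr.
  by rewrite iter_fl trK E /= trK.
by move: E; rewrite iter_fl; case: (iter n _ _) => //= C [<-]; rewrite trK.
Qed.

(** The argument of [bounded_step_r] with F_i. For a symmetric matrix the two column bounds
    coincide, so they are lowered together. *)
Lemma bounded_step_F e i c c' : e = 1 \/ e = 2 -> 0 < i -> shifts i c c' -> forall A,
  Mhat e A /\ bounded c' c' A <->
  exists n B, (Mhat e B /\ bounded c c B) /\ iter n (obind (F e i)) (Some B) = Some A.
Proof.
move=> he i0 sh A.
have FE u v : F e i u = Some v -> bounded c' c' u <-> bounded c' c' v.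
  rewrite F_pos //; case E: (fl i u) => [C|] //= E2.
  rewrite (bounded_fl c' i0 (shifts_eq sh) E).
  exact: (bounded_fr c' i0 (shifts_eq sh) E2).
split=> [|[n [B [HB]]]]; last first.
  apply: (iter_obind_inv (Q := fun A => Mhat e A /\ bounded c' c' A)).
    by move=> u v E [h1 h2]; split; [apply: F_Mhat E h1|apply/(FE _ _ E)].
  case: HB => h0 [h1 h2 h3]; split=> //; split=> //.
    by apply: col_bounded_leq h2 => m; apply: shifts_leq sh.
  by apply: col_bounded_leq h3 => m; apply: shifts_leq sh.
move: {2}(sumn (word_l A)) (leqnn (sumn (word_l A))) => k.
have base A0 : weps i (word_l A0) = 0 -> Mhat e A0 /\ bounded c' c' A0 ->
    Mhat e A0 /\ bounded c c A0.
  move=> hw [h0 [h1 h2 h3]]; split=> //; split=> //; apply: (col_bounded_hw i0 sh) => //.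
  by have /Mhat_sym[_ -> _] := h0.
elim: k A => [|k IH] A sz HA; have [hw|hw] := posnP (weps i (word_l A)).
- by exists 0, A; split=> //; apply: base.
- have [B [HB EB]] := E_exists he i0 HA.1 hw.
  have /Mhat_sym[MB _ _] := HB; have := F_sumn i0 MB EB; lia.
- by exists 0, A; split=> //; apply: base.
have [B [HB EB]] := E_exists he i0 HA.1 hw; have /Mhat_sym[MB _ _] := HB.
have [||n [C [HC EC]]] := IH B; first by have := F_sumn i0 MB EB; lia.
  by split=> //; apply/(FE _ _ EB); case: HA.
by exists n.+1, C; split=> //; apply: iterS_obind EC EB.
Qed.

(** * The operators at the node 0 *)

Definition addn11 (n : nat) (A : mat) : mat := (A `+` msetn n (1, 1))%mset.

Lemma addn11E n A p : addn11 n A p = A p + (if p == (1, 1) then n else 0).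
Proof. by rewrite msetE2 msetnE. Qed.

Lemma addn11_add m n A : addn11 m (addn11 n A) = addn11 (n + m) A.
Proof.
apply: mat_ext => p; rewrite !addn11E; case: ifP => _; rewrite ?addn0 //.
by rewrite addnA.
Qed.

Lemma iter_f0 n A : iter n (obind (f 0)) (Some A) = Some (addn11 n A).
Proof.
elim: n => [|n IH].
  by congr Some; apply: mat_ext => p; rewrite addn11E; case: ifP; rewrite addn0.
by rewrite iterS IH [RHS](_ : _ = Some (addn11 1 (addn11 n A))) // addn11_add addn1.
Qed.

Lemma iter_F0 e n A : iter n (obind (F e 0)) (Some A) = Some (addn11 (n * e) A).
Proof.
elim: n => [|n IH]; first exact: (iter_f0 0).
by rewrite iterS IH /= /F /= iter_f0 addn11_add mulSn addnC.
Qed.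

Lemma M_addn11 n A : M (addn11 n A) <-> M A.
Proof.
split=> MA i j; have := MA i j; rewrite addn11E.
  by case: ifP => [/eqP[-> ->] //|_]; rewrite addn0.
by case: ifP => [/eqP[-> ->] //|_]; rewrite addn0.
Qed.

Lemma tr_addn11 n A : tr (addn11 n A) = addn11 n (tr A).
Proof.
apply: mat_ext => -[i j]; rewrite trE !addn11E trE !xpair_eqE.
by rewrite andbC.
Qed.

Lemma perm_addn11 n A : perm_eq (addn11 n A) (nseq n (1, 1) ++ A).
Proof.
rewrite /perm_eq; apply/allP => p _; apply/eqP => /=.
rewrite count_mem_mset addn11E count_cat count_nseq count_mem_mset addnC eq_sym.
by congr (_ + _); rewrite /= eq_sym; case: eqP; rewrite ?mul1n ?mul0n.
Qed.

Lemma cnt_first_col_addn11 m n A : 1 < m ->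
  cnt m (first_col (word_l (addn11 n A))) = cnt m (first_col (word_l A)).
Proof.
move=> m2; rewrite -(first_col_filter _ m2) -[in RHS](first_col_filter _ m2).
congr (cnt m (first_col _)); rewrite !word_lE /unzip2 !filter_map; congr map.
rewrite /sorted_mat !(filter_sort le_kl_total le_kl_trans).
apply/(perm_sortP le_kl_total le_kl_trans le_kl_anti).
apply: perm_trans (perm_filter _ (perm_addn11 n A)) _.
by rewrite filter_cat; have -> : filter (preim snd (leq 2)) (nseq n (1, 1)) = [::] by elim: n.
Qed.

Lemma sorted_kl_subseq u s : sorted le_kl u -> uniq u -> sorted le_kl s ->
  {subset u <= s} -> subseq u s.
Proof.
move=> su uu ss us; apply: subseq_trans (undup_subseq s).
apply/(subseq_uniqP (undup_uniq s)).
apply: (sorted_eq le_kl_trans le_kl_anti su).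
  apply: (subseq_sorted le_kl_trans (filter_subseq _ _)).
  exact: (subseq_sorted le_kl_trans (undup_subseq s)).
apply: uniq_perm => // [|x]; first by rewrite filter_uniq ?undup_uniq.
by rewrite mem_filter mem_undup; case xu: (x \in u) => //=; rewrite (us _ xu).
Qed.

Definition strict_kl : rel (nat * nat) := fun p q => (p.1 < q.1) && (p.2 < q.2).

Lemma strict_kl_trans : transitive strict_kl.
Proof. move=> [a b] [c d] [g h]; rewrite /strict_kl /=; lia. Qed.

Lemma chain_first_col m (B : mat) (t : seq (nat * nat)) : sorted strict_kl t -> {subset t <= B} ->
  all (fun p => m <= p.2) t -> size t <= cnt m (first_col (word_l B)).
Proof.
move=> st tB tm; rewrite -(size_map snd t); apply: size_le_first_col.
- rewrite word_lE; apply: map_subseq; apply: sorted_kl_subseq => //.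
  + by apply: sub_sorted st => -[a b] [c d]; rewrite /strict_kl /le_kl /=; lia.
  + by apply: (sorted_uniq strict_kl_trans) st => -[a b]; rewrite /strict_kl /=; lia.
  + exact: sorted_mat_sorted.
  by move=> p /tB; rewrite (perm_mem (perm_sorted_mat B)).
- by rewrite sorted_map; apply: sub_sorted st => p q /andP[].
by rewrite all_map.
Qed.

(* A strict chain that avoids (1,1) avoids the first column or the first row. *)
Lemma first_col_no11 (B : mat) : M B -> B (1, 1) = 0 ->
  cnt 1 (first_col (word_l B)) <= cnt 2 (first_col (word_l B)) \/
  cnt 1 (first_col (word_l B)) <= cnt 2 (first_col (word_l (tr B))).
Proof.
move=> MB B11; have [s [sw ss _ <-]] := first_col_subseq (word_l B) 1.
have /subseqP[mk smk Es] := sw; rewrite word_lE /unzip2 -map_mask in Es.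
set t := mask _ _ in Es; have tS : subseq t (sorted_mat B) by apply: mask_subseq.
have tB : {subset t <= B}.
  by move=> p /(mem_subseq tS); rewrite (perm_mem (perm_sorted_mat B)).
have st : sorted strict_kl t.
  have tk := subseq_sorted le_kl_trans tS (sorted_mat_sorted B).
  move: ss; rewrite Es sorted_map; elim: (t) tk => // p [|q u] IH //=.
  move=> /andP[pq qu] /andP[pq2 qu2]; apply/andP; split; last exact: IH.
  by move: pq pq2; rewrite /le_kl /strict_kl /=; lia.
rewrite Es size_map; case E: t tB st => [|p u] tB st; first by left.
have pB : p \in B by apply: tB; rewrite inE eqxx.
have pu q : q \in u -> strict_kl p q.
  by move: st; rewrite /= (path_sortedE strict_kl_trans) => /andP[/allP pu _] /pu.
case: p pB pu st tB {E} => a b pB pu st tB.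
have := pB; rewrite -mset_neq0 => nz; have [a0 b0] := MB _ _ nz.
(* The pair (a, b) is the least element of the chain: for b > 1 the chain avoids the first column,
   otherwise a > 1 and it avoids the first row. *)
have [b1|b2] := leqP b 1; last first.
  left; apply: chain_first_col => //=; rewrite b2 /=.
  by apply/allP => q /pu /andP[/= _ bq]; apply: leq_trans (ltnW bq).
have a2 : 1 < a.
  rewrite ltn_neqAle a0 andbT; apply/eqP => a1; move: nz.
  by rewrite -a1 (_ : b = 1) ?B11 //; apply/eqP; rewrite eqn_leq b1.
right; rewrite -(size_map swap); apply: chain_first_col.
- rewrite sorted_map; apply: sub_sorted st => -[x y] [z w].
  by rewrite /strict_kl /= andbC.
- move=> q /mapP[[x y] /tB xyB ->]; rewrite -mset_neq0 trE mset_neq0; exact: xyB.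
rewrite all_map /= a2 /=; apply/allP => q /pu /andP[/= aq _].
exact: leq_trans (ltnW aq).
Qed.

(** The counting functions of a set without 1 and of the same set with 1 added. *)
Definition grows (c c' : nat -> nat) : Prop :=
  (forall m, 0 < m -> c' m = c m + (m == 1)) /\ c 1 = c 2.

Lemma cnt1_le c : sorted gtn c -> cnt 1 c <= (cnt 2 c).+1.
Proof.
elim: c => // a c IH; rewrite [sorted _ _]/= path_gtnE => /andP[/allP ac cs].
rewrite !cnt_cons; have [a2|a1] := leqP 2 a; first by rewrite (ltnW a2) !add1n ltnS IH.
have -> : cnt 1 c = 0; last by case: (0 < a).
apply/eqP; rewrite -leqn0 leqNgt -has_count; apply/hasPn => x /ac /= xa.
by rewrite -leqNgt -ltnS (leq_trans xa).
Qed.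

Lemma col_bounded_addn11 n c c' A : grows c c' -> col_bounded c A ->
  col_bounded c' (addn11 n A).
Proof.
move=> [ec e1] H m m0; rewrite ec //; case: (ltngtP m 1) => m1.
- by move: m0; rewrite lt0n; case: m m1.
- by rewrite cnt_first_col_addn11 // addn0; apply: H.
rewrite m1 e1 addn1; apply: leq_trans (cnt1_le (first_col_sorted _)) _.
by rewrite cnt_first_col_addn11 // ltnS; apply: H.
Qed.

Lemma bounded_addn11 n cl cl' cr cr' A : grows cl cl' -> grows cr cr' ->
  bounded cl cr A -> bounded cl' cr' (addn11 n A).
Proof.
move=> gl gr [h1 h2 h3]; split; first exact/M_addn11.
  exact: col_bounded_addn11 h2.
by rewrite tr_addn11; apply: col_bounded_addn11 h3.
Qed.

(** Thresholds above 1 do not see the entry (1, 1). At threshold 1, [first_col_no11] passes to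
    threshold 2 for B or for its transpose; the bound may thus come from the other side, which is
    why [cl 1 = cr 1] is assumed. *)
Lemma bounded_sub11 n cl cl' cr cr' (B : mat) : grows cl cl' -> grows cr cr' ->
    cl 1 = cr 1 -> B (1, 1) = 0 ->
  bounded cl' cr' (addn11 n B) -> bounded cl cr B.
Proof.
move=> [el el1] [er er1] lr B11 [/M_addn11 MB]; rewrite tr_addn11 => h2 h3.
have H2 m : 1 < m -> cnt m (first_col (word_l B)) <= cr m.
  move=> m1; have := h2 m (ltnW m1); rewrite cnt_first_col_addn11 // er ?(ltnW m1) //.
  by rewrite (gtn_eqF m1) addn0.
have H3 m : 1 < m -> cnt m (first_col (word_l (tr B))) <= cl m.
  move=> m1; have := h3 m (ltnW m1); rewrite cnt_first_col_addn11 // el ?(ltnW m1) //.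
  by rewrite (gtn_eqF m1) addn0.
split=> // -[|[|m]] // _; try by [apply: H2|apply: H3].
  have [le|le] := first_col_no11 MB B11; apply: leq_trans le _.
    by rewrite er1; apply: H2.
  by rewrite -lr el1; apply: H3.
have [||le|le] := @first_col_no11 (tr B); rewrite ?trE //; first exact: M_tr.
  by apply: leq_trans le _; rewrite el1; apply: H3.
by apply: leq_trans le _; rewrite trK lr er1; apply: H2.
Qed.

Definition sub11 (n : nat) (A : mat) : mat := (A `\` msetn n (1, 1))%mset.

Lemma sub11E n A p : sub11 n A p = A p - (if p == (1, 1) then n else 0).
Proof. by rewrite msetE2 msetnE. Qed.

Lemma addn11_sub11 (A : mat) : addn11 (A (1, 1)) (sub11 (A (1, 1)) A) = A.
Proof.
apply: mat_ext => p; rewrite addn11E sub11E; case: eqP => [->|_].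
  by rewrite subnn.
by rewrite subn0 addn0.
Qed.

Lemma bounded_step0 cl cl' cr cr' : grows cl cl' -> grows cr cr' -> cl 1 = cr 1 ->
  forall A, bounded cl' cr' A <->
  exists n B, bounded cl cr B /\ iter n (obind (f 0)) (Some B) = Some A.
Proof.
move=> gl gr lr A; split=> [HA|[n [B [HB]]]]; last first.
  by rewrite iter_f0 => -[<-]; apply: bounded_addn11 HB.
exists (A (1, 1)), (sub11 (A (1, 1)) A); rewrite iter_f0 addn11_sub11; split=> //.
apply: (@bounded_sub11 (A (1, 1)) _ cl' _ cr') => //; first by rewrite sub11E subnn.
by rewrite addn11_sub11.
Qed.

Lemma bounded_step_F0 e c c' : 0 < e -> grows c c' ->
  forall A, Mhat e A /\ bounded c' c' A <->
  exists n B, (Mhat e B /\ bounded c c B) /\ iter n (obind (F e 0)) (Some B) = Some A.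
Proof.
move=> e0 gc A; split=> [[HA bA]|[n [B [[HB bB]]]]]; last first.
  rewrite iter_F0 => -[<-]; split; last exact: bounded_addn11 bB.
  have /Mhat_sym[MB sB dB] := HB; apply/Mhat_sym; split; first exact/M_addn11.
    by rewrite tr_addn11 sB.
  move=> k k0; rewrite addn11E; case: ifP => _; last by rewrite addn0 dB.
  by rewrite dvdn_add ?dB ?dvdn_mull.
(* All copies of (1, 1) are removed at once; as e divides their number, they amount to q
   applications of F_0. *)
have /Mhat_sym[MA sA dA] := HA; have /dvdnP[q Eq] := dA 1 isT.
exists q, (sub11 (A (1, 1)) A); rewrite iter_F0 -Eq addn11_sub11; split=> //.
have bB : bounded c c (sub11 (A (1, 1)) A).
  apply: (@bounded_sub11 (A (1, 1)) _ c' _ c') => //; first by rewrite sub11E subnn.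
  by rewrite addn11_sub11.
split=> //; apply/Mhat_sym; split; first by case: bB.
  apply: mat_ext => -[i j]; rewrite trE !sub11E -{1}sA trE !xpair_eqE.
  by rewrite andbC.
move=> k k0; rewrite sub11E; case: eqP => [[->]|_]; first by rewrite subnn.
by rewrite subn0 dA.
Qed.

(** * The Weyl group acting on the nonzero integers *)

Definition pi (i j : int) : int :=
  if j == node_p i then node_q i else if j == node_q i then node_p i else j.

Ltac split_ifs := repeat match goal with |- context [if ?b then _ else _] =>
  lazymatch b with context [if _ then _ else _] => fail | _ => case: (boolP b) => ? end end.

Ltac pi_lia := rewrite /pi /node_p /node_q; split_ifs; lia.

Lemma piK i : involutive (pi i).
Proof. move=> j; pi_lia. Qed.

Lemma pi0 i : pi i 0%R = 0%R.
Proof. pi_lia. Qed.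

Lemma pi_eq0 i j : (pi i j == 0%R) = (j == 0%R).
Proof. by rewrite -{1}(pi0 i) (inj_eq (inv_inj (piK i))). Qed.

Lemma piN i j : pi (- i)%R (- j)%R = (- pi i j)%R.
Proof. pi_lia. Qed.

(** Subtracting a multiple of alpha_i by the difference of two coordinates exchanges these
    coordinates. *)
Lemma s_pi i mu j : s i mu j = mu (pi i j).
Proof.
rewrite /s /pair_h /alpha /eps /pi ![_ == j]eq_sym.
have pq : (node_p i == node_q i) = false by rewrite /node_p /node_q; split_ifs; lia.
case: (eqVneq j (node_p i)) => [->|_]; first by rewrite pq /=; ring.
by case: (eqVneq j (node_q i)) => [->|_] /=; ring.
Qed.

Definition winv (a : seq int) (j : int) : int := foldl (fun k i => pi i k) j a.
Definition wact (a : seq int) (k : int) : int := foldr pi k a.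

Lemma winv_cons i a j : winv (i :: a) j = winv a (pi i j). Proof. by []. Qed.

Lemma foldr_s a mu j : foldr s mu a j = mu (winv a j).
Proof. by elim: a j => // i a IH j; rewrite [foldr _ _ _]/= s_pi IH. Qed.

Lemma wactK a : cancel (wact a) (winv a).
Proof. by elim: a => // i a IH j; rewrite winv_cons /= piK IH. Qed.

Lemma winvK a : cancel (winv a) (wact a).
Proof. by elim: a => // i a IH j; rewrite winv_cons /= IH piK. Qed.

Lemma winv_eq0 a j : (winv a j == 0%R) = (j == 0%R).
Proof. by elim: a j => // i a IH j; rewrite winv_cons IH pi_eq0. Qed.

Lemma wact_eq0 a j : (wact a j == 0%R) = (j == 0%R).
Proof. by rewrite -{2}(wactK a j) winv_eq0. Qed.

Definition expand (b : seq nat) : seq int :=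
  flatten [seq if i == 0 then [:: 0%R : int] else [:: Posz i; (- i%:Z)%R] | i <- b].

Lemma foldr_shat b mu : foldr shat mu b = foldr s mu (expand b).
Proof.
elim: b => // i b IH; rewrite [foldr shat _ _]/= IH /shat /expand /= -/(expand b).
by case: (i == 0).
Qed.

Definition pihat (i : nat) (j : int) : int :=
  if i == 0 then pi 0%R j else pi (- i%:Z)%R (pi i j).

Lemma pihat_pos i j : i != 0 -> (0 <= j)%R -> pihat i j = pi i j.
Proof.
move=> /negbTE i0 j0; rewrite /pihat i0.
have : (0 <= pi i j)%R by pi_lia.
move: (pi i j) => k k0; pi_lia.
Qed.

Lemma pihat_neg i j : i != 0 -> (j <= 0)%R -> pihat i j = pi (- i%:Z)%R j.
Proof.
move=> /negbTE i0 j0; rewrite /pihat i0; congr pi; pi_lia.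
Qed.

Lemma pihatN i j : pihat i (- j)%R = (- pihat i j)%R.
Proof.
case: (eqVneq i 0) => [->|i0]; first by rewrite /pihat eqxx -piN oppr0.
have [j0|j0] := leP 0%R j.
  by rewrite pihat_neg ?pihat_pos ?piN //; lia.
by rewrite pihat_pos ?pihat_neg -?piN ?opprK //; lia.
Qed.

Lemma pihatK i : involutive (pihat i).
Proof.
move=> j; case: (eqVneq i 0) => [->|i0]; first by rewrite /pihat eqxx piK.
have [j0|j0] := leP 0%R j.
  rewrite (pihat_pos i0 j0) pihat_pos ?piK //; pi_lia.
have {}j0 : (j <= 0)%R by lia.
rewrite (pihat_neg i0 j0) pihat_neg ?piK //; pi_lia.
Qed.

Lemma expand_cons i b j : winv (expand (i :: b)) j = winv (expand b) (pihat i j).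
Proof. by rewrite /expand /= -/(expand b) /pihat; case: (i == 0). Qed.

Lemma winv_expandN b j : winv (expand b) (- j)%R = (- winv (expand b) j)%R.
Proof. by elim: b j => // i b IH j; rewrite !expand_cons pihatN IH. Qed.

Lemma wact_expandN b j : wact (expand b) (- j)%R = (- wact (expand b) j)%R.
Proof. by rewrite -[RHS](winvK (expand b)) winv_expandN wactK. Qed.

Definition bounded_word (N : nat) (a : seq int) := all (fun i : int => `|i| < N)%N a.

Lemma pi_range (N : nat) i j : (`|i| < N)%N -> (`|pi i j| <= N)%N = (`|j| <= N)%N.
Proof. pi_lia. Qed.

Lemma pi_big (N : nat) i j : (`|i| < N)%N -> (N < `|j|)%N -> pi i j = j.
Proof. pi_lia. Qed.

Lemma winv_big N a j : bounded_word N a -> (N < `|j|)%N -> winv a j = j.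
Proof.
elim: a j => // i a IH j /andP[iN aN] jN.
by rewrite winv_cons (pi_big iN) // IH.
Qed.

Lemma wact_big N a j : bounded_word N a -> (N < `|j|)%N -> wact a j = j.
Proof. by move=> aN jN; rewrite -{1}(winv_big aN jN) winvK. Qed.

Lemma wact_range N a j : bounded_word N a -> (`|wact a j| <= N)%N = (`|j| <= N)%N.
Proof. by elim: a => // i a IH /andP[iN aN]; rewrite [wact _ _]/= pi_range // IH. Qed.

(** * Particles and potentials *)

(* The positions where w Lambda_0 takes the value 1/2, for w the product of a; *)
(* the other nonzero positions are called holes.                               *)
Definition particle (a : seq int) (j : int) : bool := (winv a j < 0)%R.

Lemma particle_cons i a j : particle (i :: a) j = particle a (pi i j).
Proof. by []. Qed.

Lemma particle_expandN b j : j != 0%R ->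
  particle (expand b) (- j)%R = ~~ particle (expand b) j.
Proof. by rewrite -(winv_eq0 (expand b)) /particle winv_expandN; lia. Qed.

Definition positions (N : nat) : seq int :=
  [seq (- k%:Z)%R | k <- iota 1 N] ++ [seq Posz k | k <- iota 1 N].

Lemma mem_positions N x : (x \in positions N) = (x != 0%R) && (`|x| <= N)%N.
Proof.
rewrite mem_cat; apply/orP/andP => [[]/mapP[k]|[x0 xN]].
- by rewrite mem_iota => kN ->; lia.
- by rewrite mem_iota => kN ->; lia.
have [h|h] := leP 0%R x; [right|left]; apply/mapP; exists `|x|%N; rewrite ?mem_iota; lia.
Qed.

Lemma uniq_positions N : uniq (positions N).
Proof.
rewrite cat_uniq !map_inj_uniq ?iota_uniq /=; [|by move=> x y []|by move=> x y; lia].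
rewrite andbT; apply/hasPn => _ /mapP[k + ->]; rewrite mem_iota => kN.
by apply/negP => /mapP[l]; rewrite mem_iota; lia.
Qed.

(** Measures word lengths through particles: with v = [node_rank] a letter of W gains at most 1, and
    with v the identity a generator [shat i] gains at most 2. *)
Definition potential (N : nat) (v : int -> int) (X : int -> bool) : int :=
  (\sum_(x <- positions N) v x * (X x)%:Z)%R.

Lemma sum_delta (S : seq int) (p : int) (g : int -> int) : uniq S -> p \in S ->
  (\sum_(x <- S) (x == p)%:Z * g x)%R = g p.
Proof.
move=> uS pS; rewrite (bigD1_seq p) //= eqxx mul1r big1 ?addr0 // => x /negbTE ->.
by rewrite mul0r.
Qed.

Lemma potential_pi N v X i : (`|i| < N)%N ->
  potential N v (X \o pi i) = (potential N v X +
    (v (node_q i) - v (node_p i)) * ((X (node_p i))%:Z - (X (node_q i))%:Z))%R.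
Proof.
move=> iN; rewrite /potential.
have pS : perm_eq (positions N) (map (pi i) (positions N)).
  apply: uniq_perm; rewrite ?uniq_positions ?map_inj_uniq ?uniq_positions //.
    exact/inv_inj/piK.
  move=> x; rewrite -{2}[x](piK i) mem_map; last exact/inv_inj/piK.
  by rewrite !mem_positions pi_range // pi_eq0.
rewrite (perm_big _ pS) big_map /=; under eq_bigr do rewrite piK.
have pP : node_p i \in positions N by rewrite mem_positions /node_p; case: ifP; lia.
have qP : node_q i \in positions N by rewrite mem_positions /node_q; case: ifP; lia.
have uP := uniq_positions N.
have pq : node_q i != node_p i by rewrite /node_p /node_q; split_ifs; lia.
have E x : (v (pi i x) * (X x)%:Z = v x * (X x)%:Z +
    (v (node_q i) - v (node_p i)) *
      ((x == node_p i)%:Z * (X x)%:Z - (x == node_q i)%:Z * (X x)%:Z))%R.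
  rewrite /pi; case: (eqVneq x (node_p i)) => [->|_].
    by rewrite [node_p i == _]eq_sym (negbTE pq) /=; ring.
  by case: (eqVneq x (node_q i)) => [->|_] /=; ring.
under eq_bigr do rewrite E.
by rewrite big_split /= -mulr_sumr big_split /= sumrN !sum_delta.
Qed.

(** * Minimal coset representatives *)

(* Each letter of a, from right to left, adds a box to the partition. *)
Fixpoint adds (a : seq int) : Prop :=
  if a is i :: a' then
    [/\ particle a' (node_p i), ~~ particle a' (node_q i) & adds a']
  else True.

Definition node_rank (x : int) : int := if (0 < x)%R then (x - 1)%R else x.

Lemma node_rank_pq i : (node_rank (node_q i) - node_rank (node_p i) = 1)%R.
Proof. rewrite /node_rank /node_p /node_q; split_ifs; lia. Qed.

Lemma eq_potential N v X Y : (forall x, x \in positions N -> X x = Y x) ->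
  potential N v X = potential N v Y.
Proof. by move=> H; apply: eq_big_seq => x /H ->. Qed.

Lemma potential_cons N v i a : (`|i| < N)%N -> potential N v (particle (i :: a)) =
  (potential N v (particle a) + (v (node_q i) - v (node_p i)) *
    ((particle a (node_p i))%:Z - (particle a (node_q i))%:Z))%R.
Proof. exact: potential_pi. Qed.

(** [node_rank] closes the gap at 0, so a letter gains exactly 1 if and only if it moves a particle
    from [node_p i] to the hole [node_q i]. *)
Lemma adds_rank N a : bounded_word N a ->
  (potential N node_rank (particle a) <=
     potential N node_rank (particle [::]) + (size a)%:Z)%R /\
  ((potential N node_rank (particle [::]) + (size a)%:Z <=
     potential N node_rank (particle a))%R <-> adds a).
Proof.
elim: a => [_|i a IH /andP[iN aN]]; first by rewrite addr0; split.
have [h1 h2] := IH aN; rewrite potential_cons // node_rank_pq mul1r [size _]/=.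
rewrite [adds (_ :: _)]/=.
case: (particle a (node_p i)); case: (particle a (node_q i)); rewrite /=; split; try lia.
1,3,4: by split=> [h|[]//]; exfalso; lia.
case: h2 => h3 h4; split=> [h|[_ _ /h4]]; last by lia.
by split=> //; apply: h3; lia.
Qed.

Lemma bounded_expand N b : bounded_word N (expand b) = all (ltn^~ N) b.
Proof.
elim: b => // i b IH; rewrite /expand /= -/(expand b) /bounded_word all_cat.
rewrite -[all _ (expand b)]/(bounded_word N (expand b)) IH.
by congr andb; case: (eqVneq i 0) => [->|_] /=; lia.
Qed.

Lemma particle_expand_cons i b x : particle (expand (i :: b)) x = particle (expand b) (pihat i x).
Proof. by rewrite /particle expand_cons. Qed.

Lemma expand_consE i b : expand (i :: b) =
  (if i == 0 then [:: 0%R : int] else [:: Posz i; (- i%:Z)%R]) ++ expand b.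
Proof. by []. Qed.

(** By plain position s_0 moves a particle by two units, from -1 to 1, while s_i and s_{-i} each
    move one by a single unit; so every generator gains at most 2. *)
Lemma adds_size N b : all (ltn^~ N) b ->
  (potential N id (particle (expand b)) <=
     potential N id (particle [::]) + 2 * (size b)%:Z)%R /\
  ((potential N id (particle [::]) + 2 * (size b)%:Z <=
     potential N id (particle (expand b)))%R -> adds (expand b)).
Proof.
elim: b => [_|i b IH /andP[/= iN bN]]; first by rewrite mulr0 addr0; split.
have [h1 h2] := IH bN; rewrite expand_consE.
case: (eqVneq i 0) => [i0|i0].
  rewrite cat1s potential_cons ?absz0; last by lia.
  rewrite /node_p /node_q /=.
  case: (particle _ _); case: (particle _ _) => /=; (split; first by lia) => h;
    try by exfalso; lia.
  by split=> //; apply: h2; lia.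
rewrite [cat _ _]/= potential_cons; last by rewrite absz_nat.
rewrite potential_cons; last by lia.
rewrite [adds (_ :: _)]/=.
have -> : (id (node_q i) - id (node_p i) = 1)%R by rewrite /node_p /node_q; split_ifs; lia.
have -> : (id (node_q (- i%:Z)) - id (node_p (- i%:Z)) = 1)%R.
  by rewrite /node_p /node_q; split_ifs; lia.
case: (particle (_ :: _) _); case: (particle (_ :: _) _); 
  case: (particle _ _); case: (particle _ _) => /=; (split; first by lia) => h;
  try by exfalso; lia.
by split=> //; split=> //; apply: h2; lia.
Qed.

(** * The lattice P *)

Lemma P_repr mu : P mu <-> exists (t : seq int) (g : int -> int) (m : int),
  [/\ 0%R \notin t, forall k, k \notin t -> g k = 0%R &
      forall j, mu j = ((g j)%:~R + m%:~R * Lambda0 j)%R].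
Proof.
split=> [[t [n [m [t0 ->]]]]|[t [g [m [t0 gt E]]]]].
  exists t, (fun j => \sum_(i <- t) n i * (i == j)%:Z)%R, m; split=> // [k kt|j].
    rewrite big1_seq // => i /andP[_ it]; case: eqP => [ik|]; last by rewrite mulr0.
    by rewrite -ik it in kt.
  rewrite rmorph_sum; congr (_ + _)%R; apply: eq_bigr => i _ /=.
  by rewrite /eps intrM; congr (_ * _)%R; case: (i == j).
exists (undup t), g, m; rewrite mem_undup; split=> //.
apply: funext => j; rewrite E; congr (_ + _)%R.
have [jt|jt] := boolP (j \in undup t); last first.
  have -> : g j = 0%R by apply: gt; rewrite -mem_undup.
  rewrite big1_seq // => i /andP[_ it]; rewrite /eps.
  by case: eqP => [ij|]; [rewrite -ij it in jt|rewrite mulr0].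
rewrite (bigD1_seq j) ?undup_uniq //= big1 => [|i /negbTE ij]; last by rewrite /eps ij mulr0.
by rewrite /eps eqxx mulr1 addr0.
Qed.

Lemma P_Lambda0 : P Lambda0.
Proof.
by apply/P_repr; exists [::], (fun=> 0%R), 1%R; split=> // j; rewrite mul1r add0r.
Qed.

Lemma P_eps j : j != 0%R -> P (eps j).
Proof.
move=> j0; apply/P_repr; exists [:: j], (fun k => Posz (j == k)), 0%R; split.
- by rewrite inE eq_sym.
- by move=> k; rewrite inE eq_sym => /negbTE ->.
by move=> k; rewrite mul0r addr0 /eps; case: (j == k).
Qed.

Lemma Lambda0_pi i j : (Lambda0 (pi i j) = Lambda0 j +
  (if i == 0 then (j == 1)%:Z - (j == -1)%:Z else 0)%:~R)%R.
Proof.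
have [->|i0] := eqVneq i 0%R.
  rewrite /pi /node_p /node_q /=.
  case: (eqVneq j (-1)%R) => [->|j1]; first by rewrite /Lambda0 /=; lra.
  case: (eqVneq j 1%R) => [->|j2]; first by rewrite /Lambda0 /=; lra.
  by rewrite /= addr0.
rewrite addr0 /Lambda0.
have -> : (pi i j < 0)%R = (j < 0)%R by pi_lia.
by have -> : (0 < pi i j)%R = (0 < j)%R by pi_lia.
Qed.

Lemma P_s i mu : P mu -> P (s i mu).
Proof.
move=> /P_repr[t [g [m [t0 gt E]]]]; apply/P_repr.
pose h (j : int) : int := (if i == 0 then (j == 1)%:Z - (j == -1)%:Z else 0)%R.
(* The reflection s_0 changes Lambda_0 at the positions 1 and -1, which therefore join the
   support. *)
exists (map (pi i) t ++ [:: 1; -1]%R), (fun j => (g (pi i j) + m * h j)%R), m; split.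
- rewrite mem_cat negb_or; apply/andP; split=> //.
  by apply/mapP => -[k kt /esym/eqP]; rewrite pi_eq0 => /eqP k0; rewrite -k0 kt in t0.
- move=> k; rewrite mem_cat negb_or !inE => /andP[kt /norP[k1 k2]].
  rewrite gt; last first.
    by apply: contra kt => kt; rewrite -[k](piK i) map_f.
  by rewrite /h (negbTE k1) (negbTE k2); case: ifP => _; rewrite mulr0.
by move=> j; rewrite s_pi E Lambda0_pi -/(h j) mulrDr intrD intrM; ring.
Qed.

Lemma P_foldr_s a mu : P mu -> P (foldr s mu a).
Proof. by move=> Pm; elim: a => //= i a; apply: P_s. Qed.

Lemma P_foldr_shat b mu : P mu -> P (foldr shat mu b).
Proof. by rewrite foldr_shat; apply: P_foldr_s. Qed.

(** * Length *)

Lemma len_le (I : Type) (g : I -> weight -> weight) w a :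
  expresses g a w -> len g w <= size a.
Proof.
move=> aw; have ex : exists n, `[< exists2 a', expresses g a' w & size a' = n >].
  by exists (size a); apply/asboolP; exists a.
case: (ex_minnP ex) => n /asboolP en nmin.
have : is_length g w (len g w).
  apply: (@xgetPex _ 0 (is_length g w)); exists n; split=> // a' aw'.
  by apply: nmin; apply/asboolP; exists a'.
by case=> _; apply.
Qed.

Lemma shatK i mu : shat i (shat i mu) = mu.
Proof.
apply: funext => j; rewrite -[LHS]/(foldr shat mu [:: i; i] j) foldr_shat foldr_s.
by rewrite !expand_cons pihatK.
Qed.

Lemma foldr_shat_rev b mu : foldr shat (foldr shat mu b) (rev b) = mu.
Proof.
elim: b => // i b IH; rewrite rev_cons -cats1 foldr_cat /= shatK; exact: IH.
Qed.

Lemma foldr_shat_sigma b mu : foldr shat (sigma mu) b = sigma (foldr shat mu b).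
Proof.
apply: funext => j; rewrite /sigma !foldr_shat !foldr_s.
by rewrite winv_expandN.
Qed.

Lemma What_word (b : seq nat) : What (fun mu => foldr shat mu b).
Proof.
split; first by exists (expand b) => mu _; rewrite foldr_shat.
by move=> mu _; apply: foldr_shat_sigma.
Qed.

Lemma particle_nil x : particle [::] x = (x < 0)%R. Proof. by []. Qed.

Lemma potential_shat N (X : int -> bool) i : i < N -> (forall j, j != 0%R -> X (- j)%R = ~~ X j) ->
    X i.+1%:Z%R -> (0 < i -> ~~ X i%:Z%R) ->
  potential N id X = (potential N id (X \o pihat i) + 2)%R.
Proof.
move=> iN sX Xi1 Xi; have [i0|i0] := posnP i.
  have -> : potential N id (X \o pihat i) = potential N id (X \o pi 0).
    by apply: eq_potential => x _ /=; rewrite /pihat i0.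
  rewrite potential_pi; last by rewrite absz0; lia.
  rewrite i0 in Xi1; have -> : node_p 0 = (- 1%:Z)%R by [].
  have -> : node_q 0 = 1%:Z%R by [].
  by rewrite sX // Xi1 /=; lia.
have -> : potential N id (X \o pihat i) = potential N id ((X \o pi (- i%:Z)%R) \o pi i).
  by apply: eq_potential => x _ /=; rewrite /pihat (gtn_eqF i0).
rewrite potential_pi //= potential_pi; last by lia.
have -> : node_p i = i by rewrite /node_p; split_ifs; lia.
have -> : node_q i = i.+1 by rewrite /node_q; split_ifs; lia.
have -> : node_p (- i%:Z)%R = (- i.+1%:Z)%R by rewrite /node_p; split_ifs; lia.
have -> : node_q (- i%:Z)%R = (- i%:Z)%R by rewrite /node_q; split_ifs; lia.
have -> : pi (- i%:Z)%R i = i by pi_lia.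
have -> : pi (- i%:Z)%R i.+1 = i.+1 by pi_lia.
rewrite !sX; [|by lia..].
by rewrite Xi1 (negbTE (Xi i0)) /=; lia.
Qed.

(** Greedy sorting: if i+1 is the least positive particle, [shat i] lowers the potential by 2.
    Without positive particles antisymmetry leaves the ground state. The lower bound -C makes the
    descent finite. *)
Lemma short_word N (X : int -> bool) : X 0%R = false ->
    (forall j, j != 0%R -> X (- j)%R = ~~ X j) ->
    (forall j : nat, N < j -> X j = false) ->
  exists v, [/\ all (ltn^~ N) v, forall j, X j = particle (expand v) j &
    potential N id X = (potential N id (particle [::]) + 2 * (size v)%:Z)%R].
Proof.
pose C : int := (\sum_(x <- positions N) `|x|)%R.
have lb Y : (- C <= potential N id Y)%R.
  rewrite -sumrN; apply: ler_sum => x _ /=; case: (Y x) => /=; lia.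
have [n] : exists n : nat, (potential N id X + C <= n%:Z)%R.
  by exists `|(potential N id X + C)%R|%N; lia.
elim: n X => [|n IH] X hn X0 sX bX.
all: have [[j /andP[j0 Xj]]|none] := pselect (exists j : nat, (0 < j) && X j); last first.
1,3: exists [::]; rewrite mulr0 addr0; have XE j : X j = particle [::] j.
1,3: rewrite particle_nil; have [j0|j0] := ltP j 0%R.
1,3: rewrite -[j]opprK sX; last by lia.
1,2: apply/negP => Xj; apply: none; exists `|j|%N.
1,2: by rewrite (_ : Posz `|j| = - j)%R ?Xj ?andbT; lia.
1,2: have [->|j1] := eqVneq j 0%R; first exact: X0.
1,2: apply/negP => Xj; apply: none; exists `|j|%N.
1,2: by rewrite (_ : Posz `|j| = j)%R ?Xj ?andbT; lia.
1,2: by split=> //; apply: eq_potential.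
all: have [] := ex_minnP (ex_intro (fun j : nat => (0 < j) && X j) j _); first by apply/andP.
all: case=> [//|i] /andP[_ Xi] imin.
all: have iN : i < N by rewrite leqNgt; apply/negP => /bX; rewrite Xi.
all: have pX : potential N id X = (potential N id (X \o pihat i) + 2)%R.
1,3: apply: potential_shat => // i0; apply/negP => Xii; have := imin i.
1,2: by rewrite i0 Xii ltnn => /(_ isT).
  by have := lb (X \o pihat i); lia.
have [||k|k kN|v [vN Ev Pv]] := IH (X \o pihat i).
- by lia.
- by rewrite /= (_ : pihat i 0 = 0)%R // /pihat; case: eqP => _; rewrite !pi0.
- move=> k0; rewrite /= pihatN sX //; apply: contra k0 => /eqP k0.
  by rewrite -(pihatK i k) k0 /pihat; case: ifP => _; rewrite !pi0.
- rewrite /= (_ : pihat i k = k) ?bX // /pihat.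
  case: ifP => _; rewrite ?(@pi_big N) //=; lia.
exists (i :: v); split; first by rewrite /= iN.
  by move=> k; rewrite particle_expand_cons -Ev /= pihatK.
by rewrite pX Pv /=; lia.
Qed.

Lemma particle_Lambda0 a j : particle a j = (0 < foldr s Lambda0 a j)%R.
Proof.
rewrite foldr_s /particle /Lambda0; case: (ltrgtP (winv a j) 0%R) => // _.
Qed.

Lemma Lambda0_particle a a' : (forall j, particle a j = particle a' j) ->
  foldr s Lambda0 a = foldr s Lambda0 a'.
Proof.
move=> H; apply: funext => j; have := H j; rewrite !foldr_s /particle /Lambda0 => ->.
case: ifP => // n0; have e0 : (winv a j == 0%R) = (winv a' j == 0%R) by rewrite !winv_eq0.
have := H j; rewrite /particle => n0'.
have -> // : (0 < winv a j)%R = (0 < winv a' j)%R.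
by move: e0 n0 n0'; case: (ltrgtP (winv a j) 0%R); case: (ltrgtP (winv a' j) 0%R).
Qed.

Lemma foldr_shat_scale e b mu :
  foldr shat (fun j => e%:R * mu j)%R b = (fun j => e%:R * foldr shat mu b j)%R.
Proof. by apply: funext => j; rewrite !foldr_shat !foldr_s. Qed.

Lemma word_bound (b : seq nat) : exists N, all (ltn^~ N) b.
Proof.
exists (\max_(i <- b) i).+1; apply/allP => i ib; rewrite /= ltnS.
exact: (@leq_bigmax_seq _ _ predT id).
Qed.

(** Let v be a word from [short_word] with the particles of w. Then u = w^{-1} v stabilizes the
    weight, so by minimality b is no longer than v. Hence the potential reaches the maximum that
    [adds_size] allows for the size of b. *)
Lemma What_min_adds e w b : What_min e w -> reduced shat b w -> adds (expand b).
Proof.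
move=> [_ wmin] [bw lb]; have [N bN] := word_bound b.
have [_] := adds_size bN; apply.
have [||j jN|v [vN Ev Pv]] := @short_word N (particle (expand b)).
- by rewrite /particle (_ : winv _ _ = 0)%R //; apply/eqP; rewrite winv_eq0.
- exact: particle_expandN.
- by rewrite /particle (@winv_big N) // bounded_expand.
rewrite Pv; have EL : foldr shat Lambda0 b = foldr shat Lambda0 v.
  by rewrite !foldr_shat; apply: Lambda0_particle.
pose u mu := foldr shat mu (rev b ++ v).
have uL : u (hatLambda0 e) = hatLambda0 e.
  rewrite /u foldr_cat /hatLambda0 foldr_shat_scale -EL -foldr_shat_scale.
  exact: foldr_shat_rev.
have := wmin u (What_word _) uL; rewrite -lb.
have vw : expresses shat v (w \o u).
  move=> mu Pm /=; rewrite -(bw (u mu)); last exact: P_foldr_shat.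
  by have := foldr_shat_rev (rev b) (foldr shat mu v); rewrite revK /u foldr_cat => ->.
by move=> h; have := leq_trans h (len_le vw); lia.
Qed.

Lemma adds_expand_size N b : bounded_word N (expand b) -> adds (expand b) ->
  potential N node_rank (particle (expand b)) =
  (potential N node_rank (particle [::]) + (size (expand b))%:Z)%R.
Proof. by move=> bN /(adds_rank bN).2 h; have := (adds_rank bN).1; lia. Qed.

(** Both words have the same particles, hence the same potential, which is maximal for the size of
    [expand b]. As a is no longer, it attains its own maximum too. *)
Lemma reduced_adds w a b : reduced s a w -> expresses shat b w -> adds (expand b) ->
  adds a /\ forall j, particle a j = particle (expand b) j.
Proof.
move=> [aw la] bw ab.
have E j : particle a j = particle (expand b) j.
  by rewrite !particle_Lambda0 -foldr_shat bw ?aw //; apply: P_Lambda0.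
split=> //; pose N := (\max_(i <- a ++ expand b) `|i|%N).+1.
have bd c : {subset c <= a ++ expand b} -> bounded_word N c.
  move=> cs; apply/allP => i /cs ic; rewrite ltnS.
  exact: (@leq_bigmax_seq _ _ predT (fun i : int => `|i|%N)).
have aN : bounded_word N a by apply: bd => i ia; rewrite mem_cat ia.
have bN : bounded_word N (expand b) by apply: bd => i ib; rewrite mem_cat ib orbT.
have EP : potential N node_rank (particle a) = potential N node_rank (particle (expand b)).
  by apply: eq_potential => x _; apply: E.
apply/(adds_rank aN).2; rewrite EP.
rewrite (adds_expand_size bN ab) lerD2l lez_nat la.
by apply: len_le => mu Pm; rewrite -foldr_shat bw.
Qed.

(** * Demazure crystals of matrices *)

Definition above (N : nat) (Y : nat -> bool) (m : nat) : nat :=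
  count (fun j => (m <= j) && Y j) (iota 1 N).

Lemma aboveS N Y m : Y 0 = false -> above N Y m = (Y m && (m <= N)) + above N Y m.+1.
Proof.
move=> Y0; have -> : (Y m && (m <= N)) = count (fun j => (j == m) && Y m) (iota 1 N) :> nat.
  case Ym: (Y m); last first.
    rewrite (eq_count (a2 := pred0)) ?count_pred0 // => j.
    by rewrite andbF.
  rewrite (eq_count (a2 := pred1 m)) => [|j]; last by rewrite /= andbT.
  rewrite count_uniq_mem ?iota_uniq // mem_iota add1n ltnS.
  by case: m Ym; rewrite ?Y0.
rewrite /above -count_predUI [X in _ + X](eq_count (a2 := pred0)) => [|j]; last first.
  by rewrite /=; case: eqP => // ->; rewrite ltnn andbF.
rewrite count_pred0 addn0; apply: eq_count => j /=.
rewrite leq_eqVlt eq_sym; case: eqP => [->|] //=.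
by rewrite ltnn orbF.
Qed.

Lemma above_big N Y m : N < m -> above N Y m = 0.
Proof.
move=> Nm; rewrite /above (eq_in_count (a2 := pred0)) ?count_pred0 // => j.
rewrite mem_iota add1n ltnS => /andP[_ jN]; apply/negbTE.
by rewrite negb_and -ltnNge (leq_ltn_trans jN).
Qed.

Lemma above_shifts N (Y Y' : nat -> bool) i : 0 < i < N -> Y 0 = false -> Y' 0 = false ->
    Y i -> ~~ Y i.+1 -> ~~ Y' i -> Y' i.+1 ->
    (forall j, j != i -> j != i.+1 -> Y' j = Y j) ->
  shifts i (above N Y) (above N Y').
Proof.
move=> /andP[i0 iN] Y0 Y0' Yi Yi1 Yi' Yi1' YY; split.
- suff H k m : k + m = N.+1 -> above N Y' m = above N Y m + (m == i.+1).
    move=> m; have [mN|Nm] := leqP m N.+1; first by apply: (H (N.+1 - m)); rewrite subnK.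
    rewrite !above_big ?(ltnW Nm) //; first by rewrite gtn_eqF // (leq_ltn_trans iN) // ltnW.
  elim: k m => [|k IH] m; first by rewrite add0n => ->; rewrite !above_big // gtn_eqF.
  rewrite addSnnS => km; rewrite !(@aboveS N _ m) // (IH _ km).
  have [->|mi] := eqVneq m i.
    by rewrite Yi (negbTE Yi') (ltnW iN) eqxx (ltn_eqF (ltnSn i)) /= addn0 addn1.
  have [->|mi1] := eqVneq m i.+1.
    by rewrite (negbTE Yi1) Yi1' iN (gtn_eqF (ltnSn i.+1)) /= addn0 addn1.
  by rewrite YY // eqSS (negbTE mi) !addn0.
- by rewrite aboveS // Yi (ltnW iN).
by rewrite aboveS // (negbTE Yi1).
Qed.

Lemma above_grows N (Y Y' : nat -> bool) : 0 < N -> Y 0 = false -> Y' 0 = false ->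
    ~~ Y 1 -> Y' 1 -> (forall j, 1 < j -> Y' j = Y j) ->
  grows (above N Y) (above N Y').
Proof.
move=> N0 Y0 Y0' Y1 Y1' YY; split; last by rewrite aboveS // (negbTE Y1).
have H m : 1 < m -> above N Y' m = above N Y m.
  move=> m1; apply: eq_count => j; case: (leqP m j) => //= mj.
  by rewrite YY // (leq_trans m1).
case=> [|[|m]] // _; last by rewrite H // addn0.
by rewrite !(@aboveS N _ 1) // (negbTE Y1) Y1' N0 H // addn1.
Qed.

(** With [neg_above], these are the counting functions of the sets I of positive particles and J of
    negative holes, up to sign: the Frobenius data of the partition. *)
Definition pos_above (N : nat) (a : seq int) := above N (fun j => particle a j%:Z%R).

Definition neg_above (N : nat) (a : seq int) :=
  above N (fun j => (0 < j) && ~~ particle a (- j%:Z)%R).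

Lemma particle0 a : particle a 0%R = false.
Proof. by rewrite /particle; have /eqP -> : winv a 0%R == 0%R by rewrite winv_eq0. Qed.

Lemma demazure_cons (I : Type) (g : I -> mat -> option mat) i a A :
  demazure g (i :: a) A <->
  exists n B, demazure g a B /\ iter n (obind (g i)) (Some B) = Some A.
Proof.
split=> [[[//|n m] /= [sm] E]|[n [B [[m sm EB] E]]]].
  move: E; set x := foldr _ _ _; case Ex: x => [B|]; last by rewrite iter_None.
  by move=> E; exists n, B; split=> //; exists m.
by exists (n :: m); rewrite /= ?sm // EB.
Qed.

Lemma eq_iter_obind (T : Type) (g h : T -> option T) n x : g =1 h ->
  iter n (obind g) x = iter n (obind h) x.
Proof. by move=> gh; elim: n => //= n ->; case: (iter n _ _) => //= y. Qed.

Lemma bounded_ext cl cl' cr cr' A : cl =1 cl' -> cr =1 cr' ->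
  bounded cl cr A -> bounded cl' cr' A.
Proof.
by move=> el er [h1 h2 h3]; split=> // m m0; rewrite -?el -?er; [apply: h2|apply: h3].
Qed.

Lemma bounded_ext_iff cl cl' cr cr' A : cl =1 cl' -> cr =1 cr' ->
  bounded cl cr A <-> bounded cl' cr' A.
Proof. by move=> el er; split; apply: bounded_ext. Qed.

Lemma bounded_zero cl cr A : cl 1 = 0 -> cr 1 = 0 -> bounded cl cr A <-> A = mset0.
Proof.
move=> l0 r0; split=> [[MA h _]|->].
  have := h 1 isT; rewrite r0 leqn0 => /eqP c0.
  have wA : word_l A = [::].
    case E: (word_l A) (M_word_l MA) c0 => [|a l] // /andP[a1 _].
    rewrite first_col_cons => c0; have : 0 < cnt 1 (col_ins (first_col l) a).
      by rewrite -has_count; apply/hasP; exists a; rewrite // mem_col_ins eqxx.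
    by rewrite c0.
  have : size (word_l A) = 0 by rewrite wA.
  rewrite word_lE size_map => /size0nil sA.
  by rewrite -[A]seq_sorted_mat sA; apply: mat_ext => p; rewrite mset_seqE mset0E.
have M0 : M mset0 by move=> i j; rewrite mset0E.
have w0 : word_l mset0 = [::].
  rewrite word_lE; have := perm_sorted_mat mset0; rewrite enum_mset0.
  by move=> /perm_nilP ->.
have t0 : tr mset0 = mset0 by apply: mat_ext => -[i j]; rewrite trE !mset0E.
by split; rewrite ?t0 // => m m0; rewrite w0.
Qed.

Lemma demazure_nil (I : Type) (g : I -> mat -> option mat) A :
  demazure g [::] A <-> A = mset0.
Proof. by split=> [[[|//] _ /= [<-]] //|->]; exists [::]. Qed.

Lemma pos_above_nil N m : pos_above N [::] m = 0.
Proof.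
rewrite /pos_above /above (eq_count (a2 := pred0)) ?count_pred0 // => j.
by rewrite andbF.
Qed.

Lemma neg_above_nil N m : neg_above N [::] m = 0.
Proof.
rewrite /neg_above /above (eq_count (a2 := pred0)) ?count_pred0 // => j.
by rewrite /= particle_nil; lia.
Qed.

Lemma pos_above_shifts N i a : 0 < i < N -> particle a i%:Z%R -> ~~ particle a i.+1%:Z%R ->
  shifts i (pos_above N a) (pos_above N (i%:Z%R :: a)).
Proof.
move=> iN Xi Xi1; have /andP[i0 _] := iN; apply: above_shifts => //.
- exact: particle0.
- exact: particle0.
- by rewrite particle_cons (_ : pi _ _ = i.+1%:Z%R) //; pi_lia.
- by rewrite particle_cons (_ : pi _ _ = i%:Z%R) //; pi_lia.
by move=> j j1 j2; rewrite particle_cons (_ : pi _ _ = j%:Z%R) //; pi_lia.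
Qed.

Lemma neg_above_pos N i a : 0 < i -> neg_above N (i%:Z%R :: a) =1 neg_above N a.
Proof.
move=> i0 m; apply: eq_count => j; rewrite particle_cons.
by rewrite (_ : pi _ _ = (- j%:Z)%R) //; pi_lia.
Qed.

Lemma pos_above_neg N i a : 0 < i -> pos_above N ((- i%:Z)%R :: a) =1 pos_above N a.
Proof.
move=> i0 m; apply: eq_count => j; rewrite particle_cons.
by rewrite (_ : pi _ _ = j%:Z%R) //; pi_lia.
Qed.

Lemma neg_above_shifts N i a : 0 < i < N -> ~~ particle a (- i%:Z)%R ->
    particle a (- i.+1%:Z)%R ->
  shifts i (neg_above N a) (neg_above N ((- i%:Z)%R :: a)).
Proof.
move=> iN Xi Xi1; have /andP[i0 _] := iN; apply: above_shifts => //.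
- by rewrite i0.
- by rewrite Xi1 andbF.
- rewrite particle_cons (_ : pi _ _ = (- i.+1%:Z)%R) ?Xi1 ?andbF //; pi_lia.
- rewrite particle_cons (_ : pi _ _ = (- i%:Z)%R) ?Xi //; pi_lia.
move=> j j1 j2; rewrite particle_cons (_ : pi _ _ = (- j%:Z)%R) //; pi_lia.
Qed.

Lemma pos_above_grows N a : 0 < N -> particle a (-1)%R -> ~~ particle a 1%R ->
  grows (pos_above N a) (pos_above N (0%R :: a)).
Proof.
move=> N0 X1 Y1; apply: above_grows => //; try exact: particle0.
move=> j j1; rewrite particle_cons (_ : pi _ _ = j%:Z%R) //; pi_lia.
Qed.

Lemma neg_above_grows N a : 0 < N -> particle a (-1)%R -> ~~ particle a 1%R ->
  grows (neg_above N a) (neg_above N (0%R :: a)).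
Proof.
move=> N0 X1 Y1; apply: above_grows => //; first by rewrite X1.
move=> j j1; rewrite particle_cons (_ : pi _ _ = (- j%:Z)%R) //; pi_lia.
Qed.

(** A letter i > 0 shifts I and fixes J, a letter i < 0 shifts J and fixes I, and 0 adds 1 to both.
    The equality at 1, meaning that I and J have equally many elements, is carried along for
    [bounded_step0]. *)
Lemma demazure_bounded N a : bounded_word N a -> adds a ->
  (forall A, demazure f a A <-> bounded (neg_above N a) (pos_above N a) A) /\
  neg_above N a 1 = pos_above N a 1.
Proof.
elim: a => [_ _|i a IH /andP[iN aN] [Xp Xq aa]].
  split=> [A|]; last by rewrite pos_above_nil neg_above_nil.
  by rewrite demazure_nil bounded_zero ?pos_above_nil ?neg_above_nil.
have {IH}[IH e1] := IH aN aa.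
case: i iN Xp Xq => [[|i]|i] iN Xp Xq.
- have N0 : 0 < N by [].
  have gl := neg_above_grows N0 Xp Xq; have gr := pos_above_grows N0 Xp Xq.
  split=> [A|]; last by rewrite gl.1 // gr.1 // e1.
  rewrite demazure_cons (bounded_step0 gl gr e1).
  by split=> -[n [B [HB E]]]; exists n, B; split=> //; apply/IH.
- have ep : node_p i.+1 = i.+1%:Z%R by rewrite /node_p; split_ifs; lia.
  have eq : node_q i.+1 = i.+2%:Z%R by rewrite /node_q; split_ifs; lia.
  rewrite ep in Xp; rewrite eq in Xq.
  have sr := @pos_above_shifts N i.+1 a iN Xp Xq.
  have el := @neg_above_pos N i.+1 a isT.
  split=> [A|]; last by case: sr => -> _ _; rewrite el e1 addn0.
  rewrite demazure_cons (bounded_ext_iff A el (frefl _)) (bounded_step_r _ _ sr) //.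
  by split=> -[n [B [HB E]]]; exists n, B; split=> //; apply/IH.
rewrite NegzE in iN Xp Xq *.
have ep : node_p (- i.+1%:Z)%R = (- i.+2%:Z)%R by rewrite /node_p; split_ifs; lia.
have eq : node_q (- i.+1%:Z)%R = (- i.+1%:Z)%R by rewrite /node_q; split_ifs; lia.
rewrite ep in Xp; rewrite eq in Xq; rewrite abszN in iN.
have sl := @neg_above_shifts N i.+1 a iN Xq Xp.
have er := @pos_above_neg N i.+1 a isT.
split=> [A|]; last by case: sl => -> _ _; rewrite er e1 addn0.
rewrite demazure_cons (bounded_ext_iff A (frefl _) er) (bounded_step_l _ _ sl) //.
have ef n B : iter n (obind (f (- i.+1%:Z)%R)) B = iter n (obind (fl i.+1)) B.
  by apply: eq_iter_obind => C; apply: f_neg.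
by split=> -[n [B [HB E]]]; exists n, B; split; rewrite ?ef // -?ef //; apply/IH.
Qed.

Lemma pos_above_expand N b : pos_above N (expand b) =1 neg_above N (expand b).
Proof.
move=> m; apply: eq_in_count => j; rewrite mem_iota => /andP[j0 _].
by rewrite j0 particle_expandN ?negbK //; lia.
Qed.

(** The same induction inside [Mhat e], with I as the bound on both sides; s_{-i} does not touch the
    positive positions. *)
Lemma demazure_hat_bounded e N b : e = 1 \/ e = 2 -> all (ltn^~ N) b -> adds (expand b) ->
  forall A, demazure (F e) b A <->
    Mhat e A /\ bounded (pos_above N (expand b)) (pos_above N (expand b)) A.
Proof.
move=> he; have e0 : 0 < e by case: he => ->.
elim: b => [_ _ A|i b IH /andP[/= iN bN] ab A].
  rewrite demazure_nil; split=> [->|[_]]; last first.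
    by move/(bounded_zero _ (pos_above_nil N 1) (pos_above_nil N 1)).1.
  split; last exact/(bounded_zero _ (pos_above_nil N 1) (pos_above_nil N 1)).
  split; first by move=> k l; rewrite mset0E.
  by split=> *; rewrite !mset0E ?dvdn0.
have E : pos_above N (expand (i :: b)) =1 pos_above N (i%:Z%R :: expand b).
  move=> m; apply: eq_count => j; rewrite particle_expand_cons particle_cons.
  case: (eqVneq i 0) => [->|i0]; first by rewrite /pihat eqxx.
  by rewrite pihat_pos.
rewrite (bounded_ext_iff A E E) demazure_cons.
have [ab' Xp Xq] : [/\ adds (expand b), particle (expand b) (node_p i) &
    ~~ particle (expand b) (node_q i)].
  move: ab; rewrite expand_consE; case: (eqVneq i 0) => [->|i0]; first by case.
  case=> Xp Xq [_ _ ab]; split=> //.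
    by move: Xp; rewrite particle_cons (_ : pi _ _ = node_p i) //; pi_lia.
  by move: Xq; rewrite particle_cons (_ : pi _ _ = node_q i) //; pi_lia.
have {}IH B := IH bN ab' B.
have R (Q : nat -> mat -> Prop) : (exists n B, (Mhat e B /\
      bounded (pos_above N (expand b)) (pos_above N (expand b)) B) /\ Q n B) <-> exists n B, demazure (F e) b B /\ Q n B.
  by split=> -[n [B [HB E']]]; exists n, B; split=> //; apply/IH.
case: (posnP i) => [i0|i0].
  subst i; rewrite (bounded_step_F0 e0 (pos_above_grows iN Xp Xq) A).
  exact: iff_sym (R (fun n B => iter n (obind (F e 0)) (Some B) = Some A)).
have ep : node_p i = i%:Z%R by rewrite /node_p; split_ifs; lia.
have eq : node_q i = i.+1%:Z%R by rewrite /node_q; split_ifs; lia.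
rewrite ep in Xp; rewrite eq in Xq.
have iN' : 0 < i < N by rewrite i0.
rewrite (bounded_step_F he i0 (pos_above_shifts iN' Xp Xq) A).
exact: iff_sym (R (fun n B => iter n (obind (F e i)) (Some B) = Some A)).
Qed.

Lemma demazure_hatE e w a b : e = 1 \/ e = 2 -> reduced s a w -> expresses shat b w ->
  adds (expand b) -> demazure (F e) b = Mhat e `&` demazure f a.
Proof.
move=> he ra bw ab; have [aa E] := reduced_adds ra bw ab.
pose N := maxn (\max_(i <- a) `|i|%N).+1 (\max_(i <- b) i).+1.
have aN : bounded_word N a.
  apply/allP => i ia; rewrite /= leq_max ltnS.
  by rewrite (@leq_bigmax_seq _ _ predT (fun i : int => `|i|%N)).
have bN : all (ltn^~ N) b.
  by apply/allP => i ib; rewrite /= leq_max !ltnS (@leq_bigmax_seq _ _ predT id) ?orbT.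
have [Da _] := demazure_bounded aN aa.
have er : pos_above N a =1 pos_above N (expand b).
  by move=> m; apply: eq_count => j; rewrite E.
have el : neg_above N a =1 pos_above N (expand b).
  by move=> m; rewrite pos_above_expand; apply: eq_count => j; rewrite E.
rewrite eqEsubset; split=> A.
  move/(demazure_hat_bounded he bN ab) => [h1 h2].
  by split=> //; apply/Da/(bounded_ext_iff A el er).
by move=> [h1 /Da/(bounded_ext_iff A el er) h2]; apply/(demazure_hat_bounded he bN ab).
Qed.

(** * The flag of a Weyl group element *)

Lemma pi_mono i (u v : int) : u != 0%R -> v != 0%R -> (u < v)%R ->
  ~ (u = node_p i /\ v = node_q i) -> (pi i u < pi i v)%R.
Proof.
move=> u0 v0 uv H.
have {}H : (u == node_p i) && (v == node_q i) = false.
  by apply/negP => /andP[/eqP ? /eqP ?]; apply: H.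
by move: H; rewrite /pi /node_p /node_q; split_ifs; lia.
Qed.

(** The transposition [pi i] reverses no pair of nonzero integers except [node_p i] and [node_q i].
    By [adds] these are a particle and a hole, whose labels have opposite signs, so w is increasing
    on each side of 0. *)
Lemma wact_mono a (x y : int) : adds a -> (x < y)%R -> (0 < x)%R || (y < 0)%R ->
  (wact a x < wact a y)%R.
Proof.
elim: a => // i a IH [Xp Xq aa] xy sgn; rewrite [X in (X < _)%R]/= [X in (_ < X)%R]/=.
apply: pi_mono; rewrite ?wact_eq0; [by lia|by lia|exact: IH|move=> [ep eq]].
by move: Xp Xq; rewrite /particle -ep -eq !wactK; lia.
Qed.

Lemma card_seq (T : choiceType) (A : set T) (t : seq T) : uniq t ->
  (forall x, A x <-> x \in t) -> Defs.card A = size t.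
Proof.
move=> ut At; have -> : A = [set` t] by rewrite eqEsubset; split=> x /At.
rewrite /Defs.card; have -> : fset_set [set` t] = [fset x in t]%fset.
  have -> : [set` t] = [set` [fset x in t]%fset].
    by rewrite eqEsubset; split=> x /=; rewrite !inE.
  exact: set_fsetK.
by rewrite card_fseq undup_id.
Qed.

Lemma eps_inj (j k : int) : eps j = eps k -> j = k.
Proof.
move=> /(congr1 (fun mu => mu k)); rewrite /eps eqxx.
by case: (eqVneq j k) => // _ /eqP; rewrite eq_sym oner_eq0.
Qed.

Lemma foldr_s_eps a (j : int) : foldr s (eps j) a = eps (wact a j).
Proof.
apply: funext => x; rewrite foldr_s /eps; congr (_%:R)%R; congr nat_of_bool.
by apply/eqP/eqP => [->|<-]; rewrite ?winvK ?wactK.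
Qed.

Lemma zactE a w (j : int) : expresses s a w -> j != 0%R -> zact w j = wact a j.
Proof.
move=> aw j0; rewrite /zact; set S := [set k | _].
have ew : w (eps j) = eps (wact a j) by rewrite -aw ?foldr_s_eps //; apply: P_eps.
have Sw : S (wact a j) by split; rewrite ?wact_eq0.
have [_] : S (xget 0%R S) := xgetPex 0%R (ex_intro _ _ Sw).
by rewrite ew => /eps_inj/esym.
Qed.

Lemma zact_invE a w (j : int) : expresses s a w -> j != 0%R -> zact_inv w j = winv a j.
Proof.
move=> aw j0; rewrite /zact_inv; set S := [set k | _].
have ew k : k != 0%R -> w (eps k) = eps (wact a k).
  by move=> k0; rewrite -aw ?foldr_s_eps //; apply: P_eps.
have Sw : S (winv a j) by split; rewrite ?winv_eq0 ?ew ?winvK ?winv_eq0.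
have [k0] : S (xget 0%R S) := xgetPex 0%R (ex_intro _ _ Sw).
by rewrite ew // => /eps_inj <-; rewrite wactK.
Qed.

Lemma count_down N (Q : pred nat) : (forall i, 0 < i -> Q i.+1 -> Q i) ->
  (forall i, 0 < i -> Q i -> i <= N) ->
  forall i, 0 < i -> (i <= count Q (iota 1 N)) = Q i.
Proof.
move=> Qd QN; have [m [mN Em]] : exists m, m <= N /\ forall i, 0 < i -> Q i = (i <= m).
  elim: N QN => [|N IH] QN.
    exists 0; split=> // i i0; apply/idP/idP; first exact: QN.
    by rewrite leqn0 => /eqP ei; rewrite ei in i0.
  have [QN1|nQ] := boolP (Q N.+1).
    exists N.+1; split=> // i i0; apply/idP/idP; first exact: QN.
    have H k : forall j, j + k = N.+1 -> 0 < j -> Q j.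
      elim: k => [|k IHk] j; first by rewrite addn0 => ->.
      by rewrite -addSnnS => /IHk h j0; apply/Qd/h.
    by move=> iN; apply: (H (N.+1 - i)); rewrite ?subnKC.
  have [i i0 Qi|m [mN Em]] := IH.
    by have := QN i i0 Qi; rewrite leq_eqVlt => /orP[/eqP ei|//]; rewrite -ei Qi in nQ.
  by exists m; split=> //; apply: leqW.
move=> i i0; rewrite Em //; have -> : count Q (iota 1 N) = count (leq^~ m) (iota 1 N).
  by apply: eq_in_count => k; rewrite mem_iota => /andP[k0 _]; rewrite Em.
have -> : count (leq^~ m) (iota 1 N) = m; last by [].
rewrite -{1}(subnKC mN) iotaD count_cat.
have -> : count (leq^~ m) (iota 1 m) = m.
  rewrite -[RHS](size_iota 1); apply/eqP; rewrite -all_count; apply/allP => k.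
  by rewrite mem_iota add1n ltnS => /andP[].
rewrite (eq_in_count (a2 := pred0)) ?count_pred0 ?addn0 // => k.
by rewrite mem_iota => /andP[mk _]; apply/negbTE; rewrite -ltnNge; lia.
Qed.

Definition holes_before (N : nat) (c : seq int) (i : nat) : nat :=
  count (fun k : nat => (wact c k%:Z < wact c (- i%:Z))%R) (iota 1 N).

(** By [wact_mono] a position left of w(-i) with label above -i has a positive label. Labels above N
    are fixed by w and lie to the right of w(-i), so truncation at N loses nothing. *)
Lemma lamE N c w i : bounded_word N c -> adds c -> expresses s c w -> 0 < i ->
  lam w i = holes_before N c i.
Proof.
move=> cN ac cw i0.
pose t := [seq wact c k%:Z%R | k <- iota 1 N & (wact c k%:Z < wact c (- i%:Z))%R].
rewrite /lam (@card_seq _ _ t).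
- by rewrite size_map size_filter.
- by rewrite map_inj_uniq ?filter_uniq ?iota_uniq // => k l /(can_inj (wactK c)) [].
move=> x; split=> [[x0]|].
  rewrite (zact_invE cw x0) (zactE cw); last by lia.
  move=> h1 h2; have y0 : (winv c x == 0%R) = false by rewrite winv_eq0; apply/negbTE.
  have h3 : (0 < winv c x)%R.
    rewrite ltNge le_eqVlt y0 /=; apply/negP => h3.
    have := wact_mono ac h1; rewrite h3 orbT => /(_ isT).
    by rewrite winvK; lia.
  apply/mapP; exists `|winv c x|%N; last by rewrite gez0_abs ?winvK //; lia.
  rewrite mem_filter mem_iota gez0_abs; last by lia.
  rewrite winvK h2 /=; apply/andP; split; first by lia.
  rewrite add1n ltnS leqNgt; apply/negP => hN.
  have := wact_big cN hN; rewrite winvK => ex; rewrite -ex in h1 h3 hN h2.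
  have [iN|iN] := leqP i N.
    by have := wact_range (- i%:Z)%R cN; rewrite abszN absz_nat iN; lia.
  by have := @wact_big N c (- i%:Z)%R cN; rewrite abszN absz_nat iN => /(_ isT); lia.
move=> /mapP[k]; rewrite mem_filter mem_iota => /andP[h /andP[k0 _]] ->.
have x0 : wact c k%:Z%R != 0%R by rewrite wact_eq0; lia.
by split=> //; rewrite ?(zact_invE cw x0) ?(zactE cw) ?wactK //; lia.
Qed.

Lemma leq_holes_before N c i k : bounded_word N c -> adds c -> 0 < i -> 0 < k ->
  (i <= holes_before N c k) = (wact c i%:Z < wact c (- k%:Z))%R.
Proof.
move=> cN ac i0 k0; apply: (@count_down N (fun i => wact c i%:Z < wact c (- k%:Z))%R) => //.
- by move=> j j0; apply: lt_trans; apply: (wact_mono ac); lia.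
move=> j j0 h; rewrite leqNgt; apply/negP => hN.
have ej : wact c j%:Z%R = j%:Z%R by apply: (wact_big cN); rewrite absz_nat.
rewrite ej in h; have [kN|kN] := leqP k N.
  by have := wact_range (- k%:Z)%R cN; rewrite abszN absz_nat kN; lia.
by have := @wact_big N c (- k%:Z)%R cN; rewrite abszN absz_nat kN => /(_ isT); lia.
Qed.

(** The partition is self-conjugate: w commutes with negation, so w(i) < w(-k) if and only if w(k) <
    w(-i). *)
Lemma conj_partE N b w i : all (ltn^~ N) b -> adds (expand b) -> expresses s (expand b) w ->
  0 < i -> conj_part (lam w) i = holes_before N (expand b) i.
Proof.
rewrite -bounded_expand => cN ac cw i0.
rewrite /conj_part (@card_seq _ _ (iota 1 (holes_before N (expand b) i))).
- by rewrite size_iota.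
- exact: iota_uniq.
move=> k; rewrite mem_iota add1n ltnS.
have E : 0 < k -> (i <= lam w k) = (k <= holes_before N (expand b) i).
  move=> k0; rewrite (lamE cN ac cw k0) !leq_holes_before // !wact_expandN.
  by apply/idP/idP; lia.
by split=> [[k0 h]|/andP[k0 h]]; [rewrite k0 -E|split; rewrite ?E].
Qed.

Definition num_particles (N : nat) (c : seq int) : nat :=
  count (fun j : nat => particle c j%:Z%R) (iota 1 N).

Lemma perm_positions N c : bounded_word N c ->
  perm_eq [seq wact c x | x <- positions N] (positions N).
Proof.
move=> cN; apply: uniq_perm; rewrite ?uniq_positions //.
  by rewrite map_inj_uniq ?uniq_positions //; apply: can_inj (wactK c).
move=> x; rewrite -{1}[x](winvK c) mem_map; last exact: can_inj (wactK c).
by rewrite !mem_positions winv_eq0 -(wact_range _ cN) winvK.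
Qed.

Lemma count_positions N (Q : pred int) : count Q (positions N) =
  count (fun k : nat => Q (- k%:Z)%R) (iota 1 N) + count (fun k : nat => Q k%:Z%R) (iota 1 N).
Proof. by rewrite count_cat !count_map. Qed.

Lemma count_labels N c (Q : pred int) : bounded_word N c ->
  count Q (positions N) = count (fun k : nat => Q (wact c (- k%:Z)%R)) (iota 1 N) +
    count (fun k : nat => Q (wact c k%:Z%R)) (iota 1 N).
Proof.
move=> cN; have /permP <- := perm_positions cN; rewrite count_map.
exact: (@count_positions N (fun x => Q (wact c x))).
Qed.

Lemma num_particlesE N c : bounded_word N c -> adds c ->
  forall i, 0 < i -> (i <= num_particles N c) = (0 < wact c (- i%:Z))%R.
Proof.
move=> cN ac.
have -> : num_particles N c = count (fun k : nat => 0 < wact c (- k%:Z))%R (iota 1 N).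
  have := count_labels (fun x => particle c x && (0 < x)%R) cN.
  rewrite count_positions.
  rewrite [X in X + _](eq_count (a2 := pred0)) => [|k]; last by rewrite /=; lia.
  rewrite [X in _ = _ + X](eq_in_count (a2 := pred0)) => [|k]; last first.
    by rewrite mem_iota /particle wactK /=; lia.
  rewrite !count_pred0 add0n addn0 => E; transitivity (count
      (fun k : nat => particle c k%:Z%R && (0 < k%:Z)%R) (iota 1 N)).
    by apply: eq_in_count => k; rewrite mem_iota => /andP[k0 _]; rewrite [(0 < _)%R]k0 andbT.
  rewrite E; apply: eq_in_count => k; rewrite mem_iota /particle wactK => /andP[k0 _].
  by rewrite (_ : (- k%:Z < 0)%R) //; lia.
apply: (@count_down N (fun i => 0 < wact c (- i%:Z))%R).
  by move=> i i0 h; apply: lt_trans h _; apply: (wact_mono ac); lia.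
move=> i i0 h; rewrite leqNgt; apply/negP => iN.
by have := @wact_big N c (- i%:Z)%R cN; rewrite abszN absz_nat iN => /(_ isT); lia.
Qed.

(** The inequality i <= lambda_i means w(i) < w(-i) = -w(i), that is, the i-th particle from the
    right is at a positive position. *)
Lemma diag_lengthE N b w : all (ltn^~ N) b -> adds (expand b) -> expresses s (expand b) w ->
  d w = num_particles N (expand b).
Proof.
rewrite -bounded_expand => cN ac cw.
rewrite /d /diag_length (@card_seq _ _ (iota 1 (num_particles N (expand b)))).
- by rewrite size_iota.
- exact: iota_uniq.
move=> i; rewrite mem_iota add1n ltnS.
have E : 0 < i -> (i <= lam w i) = (i <= num_particles N (expand b)).
  move=> i0; rewrite (lamE cN ac cw i0) leq_holes_before // num_particlesE // wact_expandN.
  by apply/idP/idP; lia.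
by split=> [[i0 h]|/andP[i0 h]]; [rewrite i0 -E|split; rewrite ?E].
Qed.

(* There are D + (y - 1) - (D - i) holes left of the i-th particle, at y > 0,  *)
(* where D is the number of particles at positive positions.                   *)
Lemma holes_beforeE N b i : all (ltn^~ N) b -> adds (expand b) -> 0 < i ->
    (0 < wact (expand b) (- i%:Z))%R ->
  ((holes_before N (expand b) i - i + 1)%N%:Z = wact (expand b) (- i%:Z))%R.
Proof.
move=> bN ac i0; set c := expand b; have cN : bounded_word N c by rewrite bounded_expand.
case Ey: (wact c (- i%:Z)%R) => [y|//] y0; rewrite ltz_nat in y0.
have iN : i <= N.
  rewrite leqNgt; apply/negP => iN; have := @wact_big N c (- i%:Z)%R cN.
  by rewrite abszN absz_nat iN Ey => /(_ isT); lia.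
have yN : y <= N.
  by have := wact_range (- i%:Z)%R cN; rewrite Ey abszN !absz_nat iN.
have count_0 (Q : pred nat) : (forall k, 0 < k -> ~~ Q k) -> count Q (iota 1 N) = 0.
  move=> H; rewrite (eq_in_count (a2 := pred0)) ?count_pred0 // => k.
  by rewrite mem_iota => /andP[k0 _]; apply/negbTE/H.
have count_E (Q R : pred nat) : (forall k, 0 < k -> Q k = R k) ->
    count Q (iota 1 N) = count R (iota 1 N).
  by move=> H; apply: eq_in_count => k; rewrite mem_iota => /andP[k0 _]; apply: H.
(* All negative holes lie left of y, and by antisymmetry they are as many as the positive
   particles. *)
have h1 : holes_before N c i = num_particles N c +
    count (fun k : nat => ~~ particle c k%:Z%R && (k < y)) (iota 1 N).
  have := count_labels (fun x => ~~ particle c x && (x < y%:Z)%R) cN; rewrite count_positions.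
  rewrite [X in _ = X + _]count_0 => [|k k0]; last by rewrite /particle wactK; lia.
  rewrite add0n => E; rewrite /holes_before Ey.
  transitivity (count (fun k : nat =>
      ~~ particle c (wact c k%:Z)%R && (wact c k%:Z < y%:Z)%R) (iota 1 N)).
    by apply: count_E => k k0; rewrite /particle wactK; lia.
  rewrite -E; congr (_ + _); apply: count_E => k k0.
  rewrite particle_expandN ?negbK; last by lia.
  by rewrite (_ : (- k%:Z < y%:Z)%R) ?andbT //; lia.
(* The particles at or to the right of y carry the labels -1, ..., -i. *)
have h2 : i = count (fun k : nat => particle c k%:Z%R && (y <= k)) (iota 1 N).
  have := count_labels (fun x => particle c x && (y%:Z <= x)%R) cN; rewrite count_positions.
  rewrite [X in X + _]count_0 => [|k k0]; last by lia.
  rewrite [X in _ = _ + X]count_0 => [|k k0]; last by rewrite /particle wactK; lia.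
  rewrite addn0 add0n => E; transitivity (count (fun k : nat =>
      particle c (wact c (- k%:Z))%R && (y%:Z <= wact c (- k%:Z))%R) (iota 1 N)); last first.
    by rewrite -E; apply: count_E => k k0; rewrite lez_nat.
  have -> : count (fun k : nat => particle c (wact c (- k%:Z))%R &&
      (y%:Z <= wact c (- k%:Z))%R) (iota 1 N) = count (leq^~ i) (iota 1 N).
    apply: count_E => k k0; rewrite /particle wactK -Ey (_ : (- k%:Z < 0)%R) /=; last by lia.
    have [ki|ik] := leqP k i.
      case: (ltngtP k i) ki => // [ki|->] _; last by rewrite lexx.
      by rewrite ltW //; apply: (wact_mono ac); lia.
    by apply/negbTE; rewrite -ltNge; apply: (wact_mono ac); lia.
  have := @count_down N (leq^~ i) (fun j _ => @ltnW j i) (fun j _ h => leq_trans h iN).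
  move=> H; apply/eqP; rewrite eqn_leq H // leqnn /= leqNgt.
  by have := H i.+1 isT; rewrite ltnn => ->.
have h3 : num_particles N c = count (fun k : nat => particle c k%:Z%R && (k < y)) (iota 1 N) + i.
  rewrite [X in _ = _ + X]h2 /num_particles -count_predUI.
  rewrite [X in _ + X]count_0 => [|k k0]; last by rewrite /=; lia.
  by rewrite addn0; apply: count_E => k k0 /=; case: (particle _ _); rewrite //= ltnNge orNb.
have h4 : y.-1 = count (fun k : nat => particle c k%:Z%R && (k < y)) (iota 1 N) +
    count (fun k : nat => ~~ particle c k%:Z%R && (k < y)) (iota 1 N).
  rewrite -count_predUI [X in _ + X]count_0 => [|k k0]; last by rewrite /=; lia.
  rewrite addn0 (count_E _ (leq^~ y.-1)) => [|k k0]; last first.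
    by rewrite /=; case: (particle _ _); rewrite /= ?orbF; lia.
  have := @count_down N (leq^~ y.-1) (fun j _ => @ltnW j _).
  move=> /(_ (fun j _ h => leq_trans h (leq_trans (leq_pred y) yN))) H.
  have [z|z] := posnP y.-1; first by rewrite z count_0 // => k; rewrite -ltnNge.
  apply/eqP; rewrite eqn_leq H // leqnn /= leqNgt.
  by have := H y.-1.+1 isT; rewrite ltnn => ->.
by rewrite h1; apply/eqP; rewrite eqz_nat; apply/eqP; lia.
Qed.

(** By [holes_beforeE] the entries of [phi w] are the positive positions w(-i); both lists increase
    and have the same elements. *)
Lemma phiE N b w : all (ltn^~ N) b -> adds (expand b) -> expresses s (expand b) w ->
  phi w = [seq j <- iota 1 N | particle (expand b) (Posz j)].
Proof.
move=> bN ab cw; have cN : bounded_word N (expand b) by rewrite bounded_expand.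
set c := expand b; pose y (i : nat) := `|wact c (- i%:Z)%R|%N.
have Ep : phi w = rev [seq y i | i <- iota 1 (num_particles N c)].
  rewrite /phi (diag_lengthE bN ab cw) -/c; congr rev; apply/eq_in_map => i.
  rewrite mem_iota add1n ltnS => /andP[i0 iD].
  rewrite (conj_partE bN ab cw i0).
  have y0 : (0 < wact c (- i%:Z))%R by rewrite -(num_particlesE cN ab).
  by rewrite /y -(holes_beforeE bN ab i0 y0) absz_nat.
have yE i : 0 < i <= num_particles N c -> (y i)%:Z%R = wact c (- i%:Z)%R.
  by move=> /andP[i0 iD]; rewrite /y gez0_abs // ltW // -(num_particlesE cN ab).
have mem_y x : x \in [seq y i | i <- iota 1 (num_particles N c)] <->
    x \in [seq j <- iota 1 N | particle c (Posz j)].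
  rewrite mem_filter mem_iota add1n ltnS; split=> [/mapP[i]|/andP[px /andP[x0 xN]]].
    rewrite mem_iota add1n ltnS => iD ->; rewrite /particle yE // wactK.
    have /andP[i0 iD'] := iD.
    have y0 : (0 < wact c (- i%:Z))%R by rewrite -(num_particlesE cN ab).
    have yi : 0 < y i by rewrite -ltz_nat yE.
    rewrite yi (_ : (- i%:Z < 0)%R) /=; last by lia.
    rewrite /y (wact_range _ cN) abszN absz_nat leqNgt; apply/negP => iN.
    by have := @wact_big N c (- i%:Z)%R cN; rewrite abszN absz_nat iN => /(_ isT); lia.
  apply/mapP; exists `|winv c x%:Z|%N; last first.
    by rewrite /y ltz0_abs // opprK winvK absz_nat.
  rewrite mem_iota add1n ltnS num_particlesE //; last first.
    by rewrite absz_gt0 winv_eq0; lia.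
  rewrite ltz0_abs // opprK winvK absz_gt0 winv_eq0; lia.
apply: (@irr_sorted_eq _ ltn).
- by move=> i j k; apply: ltn_trans.
- by move=> i; apply: ltnn.
- rewrite Ep rev_sorted sorted_map.
  apply: (@sub_in_sorted _ (mem (iota 1 (num_particles N c))) ltn); last exact: iota_ltn_sorted.
    move=> i j; rewrite !mem_iota !add1n !ltnS => /andP[i0 iD] /andP[j0 jD] ij.
    rewrite /= -ltz_nat !yE ?i0 ?j0 //; apply: (wact_mono ab); lia.
  exact: allss.
- by apply: (sorted_filter ltn_trans); apply: iota_ltn_sorted.
by move=> x; rewrite Ep mem_rev; apply/idP/idP => /mem_y.
Qed.

(** * Flagged tableaux *)

Lemma rows_ok_head T c : rows_ok T -> c \in T -> cntle c (head [::] T).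
Proof.
elim: T => // c0 T IH [h rT]; rewrite inE => /orP[/eqP -> m //|/(IH rT) le m].
exact: leq_trans (le m) (h m).
Qed.

(** Rows increase to the right, so it suffices to test the rightmost column, which is compared from
    the bottom with the decreasing list [rev ph]. *)
Lemma SST_flagP ph nu T : sorted ltn ph -> all (leq 1) ph -> SST nu T ->
    size (head [::] T) <= size ph ->
  SST_flag ph nu T <-> forall m, 0 < m -> cnt m (head [::] T) <= cnt m ph.
Proof.
move=> sph ph1 sT le; have [[cs n0 rT] r1 _] := (SST_semistandard nu T).1 sT.
have rs : sorted gtn (rev ph) by rewrite rev_sorted.
have hs : sorted gtn (head [::] T) by case: (T) cs => //= c T' /andP[].
have cr m : cnt m (rev ph) = cnt m ph by rewrite /cnt count_rev.
have nr i : 0 < i <= size ph -> nth 0 (rev ph) i.-1 = part ph (size ph - i + 1).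
  case: i => // i /= iN; rewrite nth_rev // /part; congr nth; lia.
split=> [[_ H]|H].
  case: T sT le cs n0 rT r1 hs H => [|c T] //= sT le cs n0 rT r1 hs H m _.
  rewrite -cr; apply: (cntleP hs rs).2; rewrite size_rev; split=> // r rc.
  have rN := leq_trans rc le; rewrite (nr r.+1) //.
  by apply: (H r.+1 c) => //; rewrite inE eqxx.
split=> // i c /andP[i0 iN] cT ic.
have csort : sorted gtn c by apply: (allP cs).
rewrite -nr ?i0 //; apply: ((cntleP csort rs).1 _).2; last by rewrite prednK.
move=> m; rewrite cr; apply: leq_trans (rows_ok_head rT cT m) _.
case: m => [|m]; last exact: H.
by rewrite !cnt0.
Qed.

Lemma all_dvdn_part e nu : all (dvdn e) nu <-> forall j, 0 < j -> e %| part nu j.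
Proof.
split=> [/allP H [|j] // _|H].
  rewrite /part /=; have [h|h] := ltnP j (size nu); first by rewrite H ?mem_nth.
  by rewrite nth_default.
by apply/(all_nthP 0) => j _; apply: (H j.+1).
Qed.

Lemma SST_shape T : semistandard T -> all (leq 1) (reading T) -> SST (shape T) T.
Proof.
move=> sT r1; apply/SST_semistandard; split=> // i i0.
by rewrite part_shape //; case: sT.
Qed.

Lemma part_SST nu T i : SST nu T -> 0 < i -> part nu i = part (shape T) i.
Proof.
move=> /SST_semistandard[[_ _ rT] _ H] i0.
by rewrite part_shape // H.
Qed.

Lemma kappa_demazure e N b w : e = 1 \/ e = 2 -> all (ltn^~ N) b -> adds (expand b) ->
    expresses s (expand b) w ->
  kappa @` demazure (F e) b = \bigcup_(nu in
    [set nu | [/\ is_partition nu, size nu <= d w & all (dvdn e) nu]]) SST_flag (phi w) nu.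
Proof.
move=> he bN ab cw.
have Eph := phiE bN ab cw; have szd : size (phi w) = d w by rewrite size_rev size_map size_iota.
have sph : sorted ltn (phi w).
  by rewrite Eph; apply: (sorted_filter ltn_trans); apply: iota_ltn_sorted.
have ph1 : all (leq 1) (phi w).
  by rewrite Eph; apply/allP => j; rewrite mem_filter mem_iota => /and3P[].
have Ec m : pos_above N (expand b) m = cnt m (phi w) by rewrite Eph /cnt count_filter.
have sz1 c : all (leq 1) c -> cnt 1 c = size c by rewrite all_count => /eqP.
rewrite eqEsubset; split=> [_ [A /(demazure_hat_bounded he bN ab)[HA [MA hA _]] <-]|T].
  have [sT r1] : semistandard (kappa A) /\ all (leq 1) (reading (kappa A)).
    by rewrite kappaE; split; [apply: Ptab_rev_semistandard|apply/Ptab_rev_all1/M_word_l].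
  have [_ _ rT] := sT; have sST := SST_shape sT r1.
  have hd : head [::] (kappa A) = first_col (word_l A) by rewrite kappaE.
  have h1 : all (leq 1) (head [::] (kappa A)).
    by move: r1; rewrite all_reading; case: (kappa A) => //= c T /andP[].
  (* The bound at threshold 1 limits the height of the first column, hence the number of parts, by
     d(w). *)
  have szh : size (head [::] (kappa A)) <= size (phi w).
    by rewrite -!sz1 // -Ec hd; apply: hA.
  exists (shape (kappa A)); first split.
  - exact: shape_partition.
  - by rewrite size_shape -szd.
  - exact/all_dvdn_part/shape_dvd.
  by apply/SST_flagP => // m m0; rewrite hd -Ec; apply: hA.
move=> [nu [pnu snu dnu] fT]; have [sST _] := fT.
have [sT r1 _] := (SST_semistandard nu T).1 sST; have [cs n0 rT] := sT.
have ET := Ptab_rev_reading cs n0 rT.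
have Enu : nu = shape T.
  by apply: part_inj => // [|i i0]; [apply: shape_partition|apply: part_SST].
have szh : size (head [::] T) <= size (phi w) by rewrite szd -size_shape -Enu.
have [|A HA kA] := @kappa_surj e (reading T) he r1.
  by move=> j j0; rewrite ET -Enu; move/all_dvdn_part: dnu; apply.
exists A; last by rewrite kA.
apply/(demazure_hat_bounded he bN ab); split=> //.
have /Mhat_sym[MA sA _] := HA; have hA : col_bounded (pos_above N (expand b)) A.
  move=> m m0; rewrite Ec; have := (SST_flagP sph ph1 sST szh).1 fT m m0.
  by rewrite -ET -kA kappaE.
by split=> //; rewrite sA.
Qed.

Lemma trivIset_SST_flag ph (Q : set (seq nat)) : (forall nu, Q nu -> is_partition nu) ->
  trivIset Q (SST_flag ph).
Proof.
move=> H nu nu' Qnu Qnu' [T [[h1 _] [h2 _]]]; apply: part_inj; try exact: H.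
by move=> i i0; rewrite (part_SST h1 i0) (part_SST h2 i0).
Qed.

Theorem proposition5p17 (e : nat) (he : e = 1 \/ e = 2)
  (w : weight -> weight) (hw : What_min e w)
  (a : seq int) (ha : reduced s a w)
  (b : seq nat) (hb : reduced shat b w) :
  demazure (F e) b = Mhat e `&` demazure f a /\
  (let D := [set nu | [/\ is_partition nu, size nu <= d w & all (dvdn e) nu]] in
   kappa @` demazure (F e) b = \bigcup_(nu in D) SST_flag (phi w) nu /\
   trivIset D (SST_flag (phi w))).
Proof.
have ab := What_min_adds hw hb; have [bw _] := hb.
have [N bN] := word_bound b.
have cw : expresses s (expand b) w by move=> mu Pm; rewrite -foldr_shat bw.
split; first exact: demazure_hatE ha bw ab.
split; first exact: kappa_demazure bN ab cw.
by apply: trivIset_SST_flag => nu [].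
Qed.
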